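(* Let $1<\gamma\le 2$ and let $u:\mathbb{R}\to\mathbb{R}$ belong to $$\mathscr{C}^{6+\gamma}(\mathbb{R})=\Big\{u \;\Big|\; u\in L^1(\mathbb{R}),\ \int_{\mathbb{R}}(1+|s|)^{6+\gamma}\,|\hat u(s)|\,\mathrm{d}s<\infty\Big\},$$ where $\hat u$ is the Fourier transform of $u$. For $h>0$ define $$\delta_{h,\mathbb{R}}^{\gamma}u(x)=-h^{-\gamma}\sum_{m=-\infty}^{+\infty}g_m^{(\gamma)}\,u(x-mh).$$ Then $$\partial_{x,\mathbb{R}}^{\gamma}u(x)=\delta_{h,\mathbb{R}}^{\gamma}u(x)+\mathcal{O}(h^6)$$ uniformly in $x\in\mathbb{R}$ as $h\to 0$, where $\partial_{x,\mathbb{R}}^{\gamma}$ is the Riesz derivative of order $\gamma$ on $\mathbb{R}$.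
   Context: Riesz derivative on $\mathbb{R}$: for $1<\gamma<2$, $$\partial^\gamma_{x,\mathbb{R}}u(x)=-\frac{1}{2\cos(\frac{\pi}{2}\gamma)\Gamma(2-\gamma)}\frac{\mathrm{d}^2}{\mathrm{d}x^2}\int_{\mathbb{R}}|x-s|^{1-\gamma}u(s)\,\mathrm{d}s;$$ for $\gamma=2$ it is understood as $u''(x)$ (in all cases it has Fourier symbol $-|\varpi|^\gamma$, with the convention that the Fourier transform of $u'$ is $\pm\mathrm{i}\varpi\hat u(\varpi)$). Coefficients: let $$G(w)=(2-w-w^{-1})^{\gamma/2}\Big[1+\tfrac{\gamma}{24}(2-w-w^{-1})+\tfrac{\gamma(5\gamma+22)}{5760}(2-w-w^{-1})^2\Big],$$ so that $2-e^{\mathrm{i}s}-e^{-\mathrm{i}s}=4\sin^2(s/2)\ge 0$. Then for $m\in\mathbb{Z}$ $$g_m^{(\gamma)}=\frac{1}{2\pi}\int_{-\pi}^{\pi}G(e^{\mathrm{i}s})e^{-\mathrm{i}ms}\,\mathrm{d}s .$$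
   Formalization: u is additionally assumed continuous (the continuous representative of its class); for other representatives the pointwise claim fails, e.g. the indicator of {0} with γ<2, whose Fourier transform vanishes while the difference at 0 is of size h^{-γ}. *)

(* Defs.v *)
From HB Require Import structures.
From mathcomp Require Import all_boot all_order all_algebra.
From mathcomp Require Import all_classical all_reals all_analysis.
From mathcomp Require Import measurable_realfun ring complex.
Import Order.TTheory GRing.Theory Num.Theory.
Import numFieldNormedType.Exports.

Set Implicit Arguments.
Unset Strict Implicit.
Unset Printing Implicit Defensive.

Local Open Scope classical_set_scope.
Local Open Scope ring_scope.
Local Open Scope complex_scope.

Section Defs.
Context {R : realType}.
Implicit Types (gamma h s x : R) (u f : R -> R) (m : int).

Local Notation mu := (@lebesgue_measure R).

Definition expi (t : R) : R[i] := cos t +i* sin t.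

Definition cintegral (D : set R) (f : R -> R[i]) : R[i] :=
  (\int[mu]_(t in D) complex.Re (f t)) +i* (\int[mu]_(t in D) complex.Im (f t)).

(* Angular-frequency convention: the transform of [u'] is [s 'i * fourier u s].
   A constant normalising factor would not affect [in_C] below. *)
Definition fourier u (s : R) : R[i] :=
  cintegral setT (fun x => (u x)%:C * expi (- (s * x))).

(* The literal class, in terms of L^1 representatives.  The second condition
   makes [u] equal almost everywhere to a continuous function; the pointwise
   values of [u] matter for difference formulas, so the continuity of the
   representative has to be assumed separately. *)
Definition in_C (beta : R) u : Prop :=
  mu.-integrable setT (EFin \o u) /\
  (\int[mu]_s (((1 + `|s|) `^ beta * Normc.normc (fourier u s))%:E) < +oo)%E.

Definition Gamma (z : R) : R :=
  \int[mu]_(t in `]0, +oo[) (t `^ (z - 1) * expR (- t)).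

Definition riesz_kernel gamma u x s : R := `|x - s| `^ (1 - gamma) * u s.

Definition riesz_potential gamma u x : R :=
  \int[mu]_s riesz_kernel gamma u x s.

Definition riesz_derivative gamma u x : R :=
  if gamma == 2 then u^`(2)%classic x
  else - (2 * cos (pi / 2 * gamma) * Gamma (2 - gamma))^-1
       * (riesz_potential gamma u)^`(2)%classic x.

Definition twice_derivable f : Prop :=
  forall x, derivable f x 1 /\ derivable f^`()%classic x 1.

(* Integrals and derivatives are total functions with junk values, so that the
   expression [riesz_derivative gamma u x] is meaningful, for every [x], only
   under this condition. *)
Definition riesz_derivable gamma u : Prop :=
  if gamma == 2 then twice_derivable u
  else (forall x, mu.-integrable setT (EFin \o riesz_kernel gamma u x)) /\
       twice_derivable (riesz_potential gamma u).

(* The power [z ^ (gamma / 2)] is only needed for [z = 2 - w - w^-1] with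
   [`|w| = 1]; then [z] is a nonnegative real, see [symbol_base_expi]. *)
Definition G gamma (w : R[i]) : R[i] :=
  let z : R[i] := 2 - w - w^-1 in
  (complex.Re z `^ (gamma / 2))%:C *
  (1 + (gamma / 24)%:C * z
     + (gamma * (5 * gamma + 22) / 5760)%:C * z ^+ 2).

Definition gcoef gamma m : R[i] :=
  ((2 * pi)^-1)%:C *
  cintegral `[- pi, pi] (fun s => G gamma (expi s) * expi (- (m%:~R * s))).

(* Sum over all integers, [Negz n] being [- n.+1].  It does not depend on the
   order of summation when [a] is absolutely summable. *)
Definition bisum (a : int -> R) : R :=
  limn (series (fun n : nat => a (Posz n))) +
  limn (series (fun n : nat => a (Negz n))).

(* The real part loses nothing: [gcoef gamma m] is real, see [Im_gcoef]. *)
Definition delta_term gamma h u x m : R :=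
  complex.Re (gcoef gamma m) * u (x - m%:~R * h).

Definition delta gamma h u x : R :=
  - h `^ (- gamma) * bisum (delta_term gamma h u x).

Lemma symbol_base_expi (s : R) :
  2 - expi s - (expi s)^-1 = (4 * sin (s / 2) ^+ 2)%:C.
Proof.
have -> : (expi s)^-1 = cos s -i* sin s.
  apply: (@mulfI _ (expi s)).
    by apply/eqP => -[c0 s0]; move: (cos2Dsin2 s);
      rewrite c0 s0 !expr0n addr0 => /esym/eqP; rewrite oner_eq0.
  rewrite mulfV; last first.
    by apply/eqP => -[c0 s0]; move: (cos2Dsin2 s);
      rewrite c0 s0 !expr0n addr0 => /esym/eqP; rewrite oner_eq0.
  apply/eqP; rewrite eq_complex /=; apply/andP; split; apply/eqP.
    by rewrite mulrN opprK -!expr2 cos2Dsin2.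
  by rewrite mulrN mulrC addNr.
have cE : cos s = 1 - 2 * sin (s / 2) ^+ 2.
  have {1}-> : s = s / 2 *+ 2 by rewrite -mulr_natr divfK// pnatr_eq0.
  rewrite cos_mulr2n cos2sin2; ring.
by apply/eqP; rewrite eq_complex /= cE; apply/andP; split; apply/eqP; ring.
Qed.

Lemma integrand_expi gamma m (s : R) :
  complex.Im (G gamma (expi s) * expi (- (m%:~R * s))) =
  (4 * sin (s / 2) ^+ 2) `^ (gamma / 2) *
  (1 + gamma / 24 * (4 * sin (s / 2) ^+ 2)
     + gamma * (5 * gamma + 22) / 5760 * (4 * sin (s / 2) ^+ 2) ^+ 2) *
  - sin (m%:~R * s).
Proof.
rewrite /G symbol_base_expi.
set z := 4 * _; rewrite -!rmorphXn -!rmorphM -(rmorph1 (real_complex R)).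
rewrite -!rmorphD -rmorphM /= mul0r addr0 sinN; congr (_ * _).
Qed.

Let Rintegral_odd (a : R) (f : R -> R) : measurable_fun [set: R] f ->
  (forall x, f (- x) = - f x) -> \int[mu]_(x in `[- a, a]) f x = 0.
Proof.
move=> mf fN; rewrite /Rintegral integralE.
set I : set R := `[- a, a]%classic.
have IN : I = (-%R : _ -> measurableTypeR R) @^-1` I.
  by rewrite /I opp_preimage_itvbndbnd opprK.
pose F : R -> \bar R := EFin \o f.
have mF : measurable_fun [set: R] F by exact/measurable_EFinP.
have -> : (\int[mu]_(x in I) F^\+ x = \int[mu]_(x in I) F^\- x)%E.
  transitivity (\int[mu]_(x in (-%R : _ -> measurableTypeR R) @^-1` I)
                  (F^\- (- x)%R))%E.
    rewrite -IN; apply: eq_integral => x _.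
    by rewrite funeposE funenegE /F /= fN opprK.
  rewrite -ge0_integral_pushforward//=; first last.
  - exact: measurable_funS (measurable_funeneg mF).
  - exact: measurable_itv.
  by apply: eq_measure_integral => //= A mA AS; exact: lebesgue_measureN.
by case: (\int[mu]_(x in _) _)%E => [r| |]//=; rewrite subrr.
Qed.

Lemma Im_gcoef gamma m : complex.Im (gcoef gamma m) = 0.
Proof.
have ImZ (r : R) (z : R[i]) : complex.Im (r%:C * z) = r * complex.Im z.
  by case: z => z1 z2 /=; rewrite mul0r addr0.
rewrite /gcoef ImZ [X in _ * X](_ : _ = 0) ?mulr0// /cintegral.
rewrite [LHS]/complex.Im; under eq_Rintegral do rewrite integrand_expi.
apply: Rintegral_odd => [|x].
  have msin (c : R) : measurable_fun [set: R] (fun s => sin (c * s)).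
    apply: measurableT_comp; last exact: measurable_funM.
    by apply: continuous_measurable_fun => ?; exact: continuous_sin.
  have mz : measurable_fun [set: R] (fun s : R => 4 * sin (s / 2) ^+ 2).
    apply: measurable_funM => //; apply: measurable_funX.
    by under eq_fun do rewrite mulrC; exact: msin.
  apply: measurable_funM; last exact: measurableT_comp (msin _).
  apply: measurable_funM; first exact: (measurableT_comp (measurable_powR _) mz).
  apply: measurable_funD; last by apply: measurable_funM => //; exact: measurable_funX.
  by apply: measurable_funD => //; exact: measurable_funM.
by rewrite !mulNr !mulrN !sinN !sqrrN mulrN.
Qed.

End Defs.

(* Main.v *)
(* Write A(w), B(w) for the cosine and sine transforms of u.  The weight in the
   class makes w^p A and w^p B integrable on the half line for 0 <= p <= 6 + gamma,
   so that u(x) = 1/pi * int_0^oo (A(w) cos(w x) + B(w) sin(w x)) dw by inversion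
   (Abel summation and the Poisson kernel).  Both operators act on this
   representation as Fourier multipliers.
   - The kernel |x - s|^(1 - gamma) is the limit of |x - s|^(1 - gamma) e^(- e |x - s|),
     whose cosine transform is a Gamma integral in closed form; the Riesz potential
     thus multiplies by a constant times w^(gamma - 2), and differentiating twice under
     the integral turns this into - w^gamma.
   - The symbol S(t) = G(e^(it)) is Lipschitz and piecewise C^1, hence is the sum of
     its absolutely convergent Fourier series, and the difference operator multiplies
     by - h^(- gamma) S(h w).
   The coefficients of G are chosen so that S(t) = t^gamma + O(t^(6 + gamma)) at 0; this
   holds for all t > 0 because S is bounded, so the two multipliers differ by
   O(h^6 w^(6 + gamma)), which is integrable against |A| + |B|. *)
Require Import Defs.
From HB Require Import structures.
From mathcomp Require Import all_boot all_order all_algebra.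
From mathcomp Require Import all_classical all_reals all_analysis.
From mathcomp Require Import measurable_realfun ring lra complex.
Import Order.TTheory GRing.Theory Num.Theory.
Import numFieldNormedType.Exports.
Local Open Scope classical_set_scope.
Local Open Scope ring_scope.

Set Implicit Arguments.
Unset Strict Implicit.
Unset Printing Implicit Defensive.

(** * Integration on the line and the half line *)

Local Notation mu := lebesgue_measure.
Local Notation intg D f := (mu.-integrable D (EFin \o f)).

Section integration.
Context {R : realType}.
Implicit Types (D : set R) (f g : R -> R).

(** Two obstacles shape the proof. The Riesz kernel is not integrable at infinity, so Fubini does
    not apply to its product with the inversion integral; the factor e^(- e |x - s|) makes it
    integrable, and the bound Gamma(b) w^(- b), with b = 2 - gamma, on the half-line cosine
    transform is uniform in e and lets e tend to 0. For gamma < 2 one has 0 < b < 1, so w^(- b) is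
    integrable at 0, where A and B are merely known to be bounded. Second, S behaves like |t|^gamma
    at 0, so for gamma < 2 its second derivative is unbounded there; absolute convergence of the
    Fourier series is drawn from S' alone, through Bessel's inequality. The constants in G come from
    t = 2 arcsin(r / 2) with r = 2 sin(t / 2): (t / r)^gamma = 1 + gamma r^2 / 24 + gamma (5 gamma +
    22) r^4 / 5760 + O(r^6), and G is r^gamma times these three terms. *)

Lemma le_intg D f g : measurable D -> measurable_fun D f ->
  (forall x, D x -> `|f x| <= g x) -> intg D g -> intg D f.
Proof.
move=> mD mf fg ig; apply: le_integrable ig => //; first exact/measurable_EFinP.
by move=> x Dx /=; rewrite lee_fin (le_trans (fg _ Dx))// ler_norm.
Qed.

Lemma intg_measurable D f : intg D f -> measurable_fun D f.
Proof. by move/(measurable_int mu)/measurable_EFinP. Qed.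

Lemma intgZ D f c : measurable D -> intg D f -> intg D (fun x => c * f x).
Proof.
by move=> mD; exact: (@integrableZl _ _ _ mu D mD c (EFin \o f)).
Qed.

Lemma intgD D f g : measurable D -> intg D f -> intg D g ->
  intg D (fun x => f x + g x).
Proof.
by move=> mD; exact: (@integrableD _ _ _ mu D mD (EFin \o f) (EFin \o g)).
Qed.

Lemma intgB D f g : measurable D -> intg D f -> intg D g ->
  intg D (fun x => f x - g x).
Proof.
by move=> mD; exact: (@integrableB _ _ _ mu D mD (EFin \o f) (EFin \o g)).
Qed.

Lemma intg_norm D f : measurable D -> intg D f -> intg D (fun x => `|f x|).
Proof. by move=> mD /integrable_norm. Qed.

Lemma intgM_bounded D f g M : measurable D -> measurable_fun D g ->
  (forall x, D x -> `|g x| <= M) -> intg D f -> intg D (fun x => f x * g x).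
Proof.
move=> mD mg gM fi; apply: (@le_intg _ _ (fun x => M * `|f x|)) => //.
- by apply: measurable_funM => //; exact: intg_measurable.
- by move=> x Dx; rewrite normrM mulrC ler_wpM2r// gM.
- by apply: intgZ => //; exact: intg_norm.
Qed.

Lemma Rintegral_le_norm D f g : measurable D -> measurable_fun D f ->
  (forall x, D x -> `|f x| <= g x) -> intg D g ->
  `|\int[mu]_(x in D) f x| <= \int[mu]_(x in D) g x.
Proof.
move=> mD mf fg ig; have fi := le_intg mD mf fg ig.
apply: (le_trans (@le_normr_Rintegral _ _ _ mu D f mD fi)).
by apply: le_Rintegral => //; exact: intg_norm.
Qed.

(** Convergence is asked at every point of [D], so that measurability of the limit comes for
    free. *)
Lemma dominated_Rintegral D (f_ : nat -> R -> R) f g : measurable D ->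
  (forall n, measurable_fun D (f_ n)) ->
  (forall x, D x -> f_ ^~ x @ \oo --> f x) ->
  (forall n x, D x -> `|f_ n x| <= g x) -> intg D g ->
  intg D f /\ \int[mu]_(x in D) f_ n x @[n --> \oo] --> \int[mu]_(x in D) f x.
Proof.
move=> mD mf_ ff fg ig.
have mf : measurable_fun D f by exact: measurable_fun_cvg ff.
have := @dominated_convergence _ _ R mu D mD (fun n => EFin \o f_ n) (EFin \o f) (EFin \o g).
case=> //.
- by move=> n /=; apply/measurable_EFinP; exact: mf_.
- exact/measurable_EFinP.
- by apply: aeW => x Dx; apply: cvg_EFin; [exact: nearW | exact: ff].
- by apply: aeW => x n Dx /=; rewrite lee_fin fg.
move=> intf _ h; split=> //.
apply: fine_cvg; rewrite fineK; first exact: h.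
exact: (@integrable_fin_num _ _ _ mu D mD _ intf).
Qed.

(** One change of variables serves twice: [c = x] for convolutions and [c = 0] for parity. *)
Let reflect (c : R) : measurableTypeR R -> measurableTypeR R := fun s => c - s.

Let measurable_reflect c : measurable_fun setT (reflect c).
Proof. by apply: measurable_funB. Qed.

(** By uniqueness of Lebesgue measure it is enough to test []a, b]], whose preimage is half open on
    the other side but has the same length. *)
Let lebesgue_measure_reflect c (A : set R) : measurable A ->
  pushforward mu (reflect c) A = mu A.
Proof.
move=> mA; apply/esym/lebesgue_measure_unique => //=.
move=> _ [[a b] _ <-].
rewrite /pushforward.
have -> : reflect c @^-1` `]a, b]%classic = `[c - b, c - a[%classic.
  by apply/seteqP; split => s /=; rewrite /reflect !in_itv/= => /andP[? ?]; apply/andP; split; lra.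
rewrite !lebesgue_measure_itv/= !lte_fin ltrD2l ltrN2; case: ifPn => // _.
by rewrite -!EFinB; congr EFin; lra.
Qed.

Lemma intg_reflect c f : intg setT f -> intg setT (fun s => f (c - s)).
Proof.
move=> /integrableP[mf foo].
have mfc : measurable_fun setT ((EFin \o f) \o reflect c : measurableTypeR R -> _).
  by apply: measurableT_comp => //; exact: measurable_reflect.
apply/integrableP; split; first exact: mfc.
rewrite (_ : (\int[mu]_x _)%E = (\int[mu]_x `|(EFin \o f) x|)%E)//.
transitivity (\int[mu]_(x in reflect c @^-1` setT) (abse \o (EFin \o f)) (reflect c x))%E => //.
rewrite -(@ge0_integral_pushforward _ _ _ _ _ _ (measurable_reflect c) mu setT (abse \o (EFin \o f)))//; last 2 first.
- exact: measurableT_comp.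
- by move=> x _; rewrite lee_fin.
by apply: eq_measure_integral => A mA _; exact: lebesgue_measure_reflect.
Qed.

Lemma Rintegral_reflect c f : intg setT f ->
  \int[mu]_s f (c - s) = \int[mu]_s f s.
Proof.
move=> fi; rewrite /Rintegral; congr fine.
transitivity (\int[mu]_(x in reflect c @^-1` setT) ((EFin \o f) (reflect c x)))%E => //.
rewrite -(@integral_pushforward _ _ _ _ _ _ (measurable_reflect c) mu setT (EFin \o f))//.
- by apply: eq_measure_integral => A mA _; exact: lebesgue_measure_reflect.
- exact: measurable_int fi.
- exact: intg_reflect.
Qed.

End integration.

Local Notation Y := (`]0, +oo[%classic).

(** * Parity, and the fundamental theorem of calculus on the open half line *)

Section half_line.
Context {R : realType}.
Implicit Types (D : set R) (f g F : R -> R).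

Lemma Rintegral_half_lines f : intg setT f ->
  \int[mu]_x f x = \int[mu]_(x in Y) f x + \int[mu]_(x in Y) f (- x).
Proof.
move=> fi.
have -> : [set: R] = `]-oo, 0[%classic `|` `[0, +oo[%classic.
  by apply/seteqP; split => x //= _; rewrite !in_itv/= andbT; case: (ltP x 0) => ?; [left|right].
rewrite Rintegral_setU//; first last.
- by apply/disj_setPS => x [] /=; rewrite !in_itv/= andbT => /lt_geF ->.
- by apply: (@integrableS _ _ _ mu setT) fi => //; exact: measurableU.
rewrite addrC; congr (_ + _).
  by rewrite -Rintegral_itv_obnd_cbnd//; exact: integrableS fi.
rewrite Rintegral_mkcond -(Rintegral_reflect 0); last first.
  rewrite -restrict_EFin; apply: ((@integrable_mkcond _ _ _ mu _ (EFin \o f) (measurable_itv _)).1).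
  by apply: (@integrableS _ _ _ mu setT) fi.
rewrite [RHS]Rintegral_mkcond; apply: eq_Rintegral => x _.
rewrite /patch sub0r; congr (if _ then _ else _).
by apply/idP/idP; rewrite !inE/= !in_itv/= ?andbT; lra.
Qed.

Lemma Rintegral_even f : intg setT f -> (forall x, f (- x) = f x) ->
  \int[mu]_x f x = 2 * \int[mu]_(x in Y) f x.
Proof.
move=> fi fN; rewrite Rintegral_half_lines//.
by under [X in _ + X]eq_Rintegral do rewrite fN; rewrite mulr_natl mulr2n.
Qed.

Lemma Rintegral_odd f : intg setT f -> (forall x, f (- x) = - f x) ->
  \int[mu]_x f x = 0.
Proof.
move=> fi fN; have := Rintegral_reflect 0 fi.
under eq_Rintegral do rewrite sub0r fN -mulN1r.
by rewrite RintegralZl// mulN1r => h; lra.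
Qed.

Lemma intg_even f : intg Y f -> (forall x, f (- x) = f x) -> intg setT f.
Proof.
move=> fi fN.
have fY : intg setT (f \_ Y).
  by rewrite -restrict_EFin; exact: ((@integrable_mkcond _ _ _ mu Y (EFin \o f) (measurable_itv _)).1 fi).
have fYN := intg_reflect 0 fY.
(* [Y] is open, so the restriction to [Y] and its mirror image both miss the origin; this term
   restores equality at every point. *)
have f0 : intg setT (fun x => f 0 * \1_(`[0, 0]%classic : set R) x).
  by apply: intgZ => //; exact: integrable_indic_itv.
have := intgD measurableT f0 (intgD measurableT fY fYN).
apply: eq_integrable => // x _ /=; congr EFin; rewrite indicE /patch sub0r !mem_setE !in_itv/= !andbT.
case: (ltgtP x 0) => [x0|x0|->]; rewrite ?oppr_gt0 ?x0 ?oppr0 ?lexx ?ltxx/= ?mulr0 ?mulr1 ?add0r ?addr0//.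
- by rewrite (ltNge x 0) (ltW x0)/= addr0.
Qed.

(** A compact exhaustion of [Y]; the left end moves too because integrands may be singular at 0. *)
Let I_ n : set R := `[(n.+1%:R)^-1, n.+1%:R]%classic.

Let I_Y n : I_ n `<=` Y.
Proof. by move=> x; rewrite /I_ /= !in_itv/= andbT => /andP[nx _]; rewrite (lt_le_trans _ nx)// invr_gt0. Qed.

Let I_mono i j : (i <= j)%N -> I_ i `<=` I_ j.
Proof.
move=> ij x; rewrite /I_ /= !in_itv/= => /andP[ix xi]; apply/andP; split.
  by apply: le_trans ix; rewrite lef_pV2 ?posrE// ler_nat ltnS.
by apply: (le_trans xi); rewrite ler_nat ltnS.
Qed.

Let I_near x : 0 < x -> \forall n \near \oo, I_ n x.
Proof.
move=> x0; near=> n; rewrite /I_/= in_itv/=; apply/andP; split.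
- rewrite invf_ple ?posrE//; apply/ltW.
  by rewrite (@lt_trans _ _ n%:R) ?ltr_nat//; near: n; exact: nbhs_infty_gtr.
- by apply/ltW; rewrite (@lt_trans _ _ n%:R) ?ltr_nat//; near: n; exact: nbhs_infty_gtr.
Unshelve. all: by end_near. Qed.

Let cvg_I_ (F : R -> R) l m : F x @[x --> 0^'+] --> m ->
  F x @[x --> +oo] --> l ->
  F n.+1%:R - F (n.+1%:R)^-1 @[n --> \oo] --> l - m.
Proof.
move=> F0 Fy; apply: cvgB.
- have /cvg_pinftyP := Fy; apply.
  by apply/cvgrnyP; rewrite (cvg_shiftS id).
- have /cvg_at_rightP := F0; apply; split => //.
  exact: cvg_harmonic.
Qed.

Let FTC_I_ (F f : R -> R) n : (forall x : R, 0 < x -> is_derive x 1 F (f x)) ->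
  (forall x : R, 0 < x -> {for x, continuous f}) ->
  \int[mu]_(x in I_ n) f x = F n.+1%:R - F (n.+1%:R)^-1.
Proof.
move=> dF cf.
have n0 : 0 < (n.+1%:R : R)^-1 by rewrite invr_gt0.
have cF x : 0 < x -> {for x, continuous F}.
  by move=> x0; apply/differentiable_continuous/derivable1_diffP; case: (dF x x0).
(* For [n = 0] the interval is the single point 1, while the fundamental theorem asks for distinct
   end points. *)
have [->|nneq0] := eqVneq n 0%N.
  by rewrite /I_ invr1 set_itv1 Rintegral_set1 subrr.
have nn : (n.+1%:R : R)^-1 < n.+1%:R.
  rewrite (@lt_trans _ _ 1)//; last by rewrite ltr1n ltnS lt0n.
  by rewrite invf_lt1// ltr1n ltnS lt0n.
rewrite /Rintegral (@continuous_FTC2 _ f F)//.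
- apply: continuous_in_subspaceT => x; rewrite inE => /I_Y/=.
  by rewrite in_itv/= andbT; exact: cf.
- split.
  + move=> x; rewrite in_itv/= => /andP[nx _].
    by case: (dF x (lt_trans n0 nx)).
  + apply: cvg_at_right_filter; exact: cF.
  + apply: cvg_at_left_filter; apply: cF; exact: lt_trans n0 nn.
- move=> x; rewrite in_itv/= => /andP[nx _].
  by rewrite derive1E; case: (dF x (lt_trans n0 nx)).
Qed.

Let restrict_cvg f x : Y x -> (fun n => (f \_ (I_ n)) x) @ \oo --> f x.
Proof.
rewrite /= in_itv/= andbT => x0; apply: cvg_near_cst.
by apply: filterS (I_near x0) => n In; rewrite /patch mem_set.
Qed.

Lemma FTC_half_line (F f : R -> R) l m :
  (forall x : R, 0 < x -> is_derive x 1 F (f x)) ->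
  (forall x : R, 0 < x -> {for x, continuous f}) ->
  F x @[x --> 0^'+] --> m -> F x @[x --> +oo] --> l -> intg Y f ->
  \int[mu]_(x in Y) f x = l - m.
Proof.
move=> dF cf F0 Fy fi.
have mI n : measurable (I_ n) by exact: measurable_itv.
have [|||||_ h] := @dominated_Rintegral _ Y (fun n => f \_ (I_ n)) f (fun x => `|f x|).
- exact: measurable_itv.
- move=> n; apply/measurable_restrict => //.
  by apply: measurable_funS (intg_measurable fi) => // x [].
- exact: restrict_cvg.
- by move=> n x Yx; rewrite /patch; case: ifPn; rewrite ?normr0.
- exact: intg_norm.
have := cvg_I_ F0 Fy; move/cvg_lim => <- //; apply/esym/cvg_lim => //.
apply: cvg_trans h; apply: near_eq_cvg; near=> n.
rewrite -(FTC_I_ n dF cf) -Rintegral_mkcondr; congr Rintegral.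
by apply/seteqP; split => [x /= [_]//|x Ix]; split=> //; exact: I_Y Ix.
Unshelve. all: by end_near. Qed.

(** Positivity takes the place of integrability: by monotone convergence along the exhaustion the
    integral is [l - m], hence finite. The integrability of the Gamma integrand and of the Poisson
    kernel rests on this. *)
Lemma ge0_intg_half_line (F f : R -> R) (l m : R) :
  (forall x : R, 0 < x -> is_derive x 1 F (f x)) ->
  (forall x : R, 0 < x -> {for x, continuous f}) ->
  (forall x : R, 0 < x -> 0 <= f x) ->
  F x @[x --> 0^'+] --> m -> F x @[x --> +oo] --> l -> intg Y f.
Proof.
move=> dF cf f0 F0 Fy.
have mI n : measurable (I_ n) by exact: measurable_itv.
have mf : measurable_fun (Y : set R) f.
  apply: open_continuous_measurable_fun => // x.
  by rewrite inE/= in_itv/= andbT; exact: cf.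
apply/integrableP; split; first exact/measurable_EFinP.
have YfE : {in (Y : set R), (fun x => `|(EFin \o f) x|)%E =1 (fun x => limn (fun n => ((f \_ (I_ n)) x)%:E))}.
  move=> x /set_mem Yx; apply/esym/cvg_lim => //.
  have x0 : 0 < x by move: Yx; rewrite /= in_itv/= andbT.
  rewrite gee0_abs; last by rewrite lee_fin f0.
  by apply: cvg_EFin; [exact: nearW | exact: restrict_cvg].
rewrite (@eq_integral _ _ _ mu Y _ _ YfE) monotone_convergence//; first last.
- move=> x Yx i j ij; rewrite lee_fin /patch.
  case: ifPn => [/set_mem Iix|_].
    by rewrite mem_set//; exact: I_mono ij _ Iix.
  by case: ifPn => // _; apply: f0; move: Yx; rewrite /= in_itv/= andbT.
- by move=> n x Yx; rewrite lee_fin /patch; case: ifPn => // _; apply: f0; move: Yx; rewrite /= in_itv/= andbT.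
- move=> n; apply/measurable_EFinP; apply/measurable_restrict => //; first exact: mI.
  by apply: measurable_funS mf => // x [].
have h : (\int[mu]_(x in Y) ((f \_ (I_ n)) x)%:E)%E @[n --> \oo] --> (l - m)%:E.
  rewrite (_ : (fun n => _) = (fun n => (F n.+1%:R - F (n.+1%:R)^-1)%:E)).
    by apply: cvg_EFin; [exact: nearW | exact: cvg_I_].
  apply/funext => n.
  rewrite /= -(FTC_I_ n dF cf) /Rintegral fineK; last first.
    apply: (@integrable_fin_num _ _ _ mu) => //; first exact: mI.
    apply: continuous_compact_integrable; first exact: segment_compact.
    apply: continuous_in_subspaceT => x; rewrite inE => /I_Y/=.
    by rewrite in_itv/= andbT; exact: cf.
  transitivity (\int[mu]_(x in Y) (((EFin \o f) \_ (I_ n)) x))%E.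
    by apply: eq_integral => x _; rewrite restrict_EFin.
  rewrite -integral_mkcondr; congr (integral mu _ _).
  by apply/seteqP; split => [x /= [_]//|x Ix]; split=> //; exact: I_Y Ix.
by move/cvg_lim : h => -> //; exact: ltry.
Qed.

End half_line.

(** * Integrals depending on a parameter, and Fubini *)

Section parameters.
Context {R : realType}.
Implicit Types (D : set R).

(** Domination is asked only on a window []u, v[] around the point: for a decay rate [e > 0] no
    bound holds down to [e = 0]. *)
Lemma is_derive_under_integral D (f f' : R -> R -> R) (G : R -> R) u v a :
  measurable D -> u < a < v ->
  (forall x, u < x < v -> intg D (f x)) ->
  (forall x y, u < x < v -> D y -> is_derive x 1 (f^~ y) (f' x y)) ->
  (forall x y, u < x < v -> D y -> `|f' x y| <= G y) -> intg D G ->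
  is_derive a 1 (fun x => \int[mu]_(y in D) f x y) (\int[mu]_(y in D) f' a y).
Proof.
move=> mD uav fi df f'G Gi.
have d1 x y : u < x < v -> D y -> partial1of2 f x y = f' x y.
  by move=> xuv Dy; rewrite partial1of2E; case: (df x y xuv Dy).
have Ia : `]u, v[%classic a by rewrite /= in_itv.
have fi' x : `]u, v[%classic x -> intg D (f x) by rewrite /= in_itv/=; exact: fi.
have df' x y : `]u, v[%classic x -> D y -> derivable (f^~ y) x 1.
  by rewrite /= in_itv/= => xuv Dy; case: (df x y xuv Dy).
have GG : intg D (fun y => `|G y|) by exact: intg_norm.
have f'G' x y : `]u, v[%classic x -> D y -> `|partial1of2 f x y| <= `|G y|.
  rewrite /= in_itv/= => xuv Dy; rewrite d1//.
  by rewrite (le_trans (f'G x y xuv Dy))// ler_norm.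
split.
  have := @derivable_under_integral _ _ _ mu f D mD _ _ _ Ia fi' df' _ (fun y => normr_ge0 (G y)) GG f'G'.
  exact.
rewrite -derive1E.
have -> := @differentiation_under_integral _ _ _ mu f D mD _ _ _ Ia fi' df' _ (fun y => normr_ge0 (G y)) GG f'G'.
by apply: eq_Rintegral => y /set_mem Dy; rewrite d1.
Qed.

(** The integrand on the plane is dominated by |f(x)| |g(y)|, whose integral is the product of two
    finite norms. *)
Lemma Fubini_bounded (f g : R -> R) (k : R -> R -> R) :
  intg setT f -> intg setT g ->
  measurable_fun setT (fun z : measurableTypeR R * measurableTypeR R => k z.1 z.2) ->
  (forall x y, `|k x y| <= 1) ->
  \int[mu]_x (f x * \int[mu]_y (g y * k x y)) =
  \int[mu]_y (g y * \int[mu]_x (f x * k x y)).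
Proof.
move=> fi gi mk k1.
have mf := intg_measurable fi; have mg := intg_measurable gi.
have mk1 x : measurable_fun setT (k x).
  by apply: (measurableT_comp mk (pair1_measurable x)).
have mk2 y : measurable_fun setT (k^~ y).
  by apply: (measurableT_comp mk (pair2_measurable y)).
have gki x : intg setT (fun y => g y * k x y) by exact: (@intgM_bounded _ _ _ _ 1).
have fki y : intg setT (fun x => f x * k x y) by exact: (@intgM_bounded _ _ _ _ 1).
pose h (z : measurableTypeR R * measurableTypeR R) : \bar R := (f z.1 * g z.2 * k z.1 z.2)%:E.
have mh : measurable_fun setT h.
  apply/measurable_EFinP; apply: measurable_funM => //; apply: measurable_funM.
  - exact: (measurableT_comp mf measurable_fst).
  - exact: (measurableT_comp mg measurable_snd).
have hi : (mu \x mu)%E.-integrable setT h.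
  apply/integrable12ltyP => //.
  apply: (@le_lt_trans _ _ (\int[mu]_x ((\int[mu]_y `|g y|%:E) * `|f x|%:E)))%E.
    apply: ge0_le_integral => //.
    - by move=> x _; apply: integral_ge0.
    - apply: (measurable_fun_fubini_tonelli_F (abse \o h)) => //.
        exact: measurableT_comp.
      by move=> z; rewrite lee_fin.
    - by apply: measurable_funeM; apply/measurable_EFinP; exact: measurableT_comp.
    - move=> x _; rewrite muleC -ge0_integralZl//; last first.
      + by apply/measurable_EFinP; exact: measurableT_comp.
      apply: ge0_le_integral => //.
      + apply: measurableT_comp => //.
        exact: (measurableT_comp mh (pair1_measurable x)).
      + by apply: measurable_funeM; apply/measurable_EFinP; exact: measurableT_comp.
      + move=> y _; rewrite /h/= -EFinM lee_fin !normrM.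
        by rewrite ler_piMr// mulr_ge0.
  rewrite ge0_integralZl//; last 2 first.
  - by apply/measurable_EFinP; exact: measurableT_comp.
  - exact: integral_ge0.
  have /integrableP[_ f1] := fi; have /integrableP[_ g1] := gi.
  by rewrite lte_mul_pinfty// ?integral_ge0// ge0_fin_numE// integral_ge0.
rewrite /Rintegral; congr fine.
transitivity (\int[mu]_x \int[mu]_y h (x, y))%E.
  apply: eq_integral => x _; rewrite EFinM fineK; last exact: (@integrable_fin_num _ _ _ mu setT measurableT _ (gki x)).
  rewrite -(@integralZl _ _ _ mu setT measurableT (EFin \o _) (gki x))//.
  by apply: eq_integral => y _; rewrite /h/= -EFinM mulrA.
rewrite Fubini//.
apply: eq_integral => y _; rewrite EFinM fineK; last exact: (@integrable_fin_num _ _ _ mu setT measurableT _ (fki y)).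
rewrite -(@integralZl _ _ _ mu setT measurableT (EFin \o _) (fki y))//.
by apply: eq_integral => x _; rewrite /h/= -EFinM mulrA (mulrC (f x)).
Qed.

End parameters.

(** * The Laplace transform of powers times trigonometric functions *)

Section derivation_rules.
Context {R : realType}.
Implicit Types (f g : R -> R) (x a b : R).

Lemma rderivM f g x a b : is_derive x 1 f a -> is_derive x 1 g b ->
  is_derive x 1 (fun t => f t * g t) (a * g x + f x * b).
Proof.
move=> df dg; have := is_deriveM df dg.
by move/is_derive_eq; apply; rewrite addrC /GRing.scale/= (mulrC a).
Qed.

Lemma rderivD f g x a b : is_derive x 1 f a -> is_derive x 1 g b ->
  is_derive x 1 (fun t => f t + g t) (a + b).
Proof. by move=> df dg; have := is_deriveD df dg. Qed.

Lemma rderivZ f x a c : is_derive x 1 f a -> is_derive x 1 (fun t => c * f t) (c * a).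
Proof. by move=> df; have := is_deriveZ c df. Qed.

Lemma rderiv_comp f g x a b : is_derive (f x) 1 g b -> is_derive x 1 f a ->
  is_derive x 1 (fun t => g (f t)) (b * a).
Proof. by move=> dg df; have := is_derive1_comp dg df. Qed.

Lemma rderivMl (c x : R) : is_derive x 1 (fun t => c * t) c.
Proof. by have := rderivZ c (is_derive_id x (1 : R)); rewrite mulr1. Qed.

Lemma rderivMr (c x : R) : is_derive x 1 (fun t => t * c) c.
Proof. by under eq_fun do rewrite mulrC; exact: rderivMl. Qed.

Lemma rderiv_cos (c x : R) : is_derive x 1 (fun t => cos (t * c)) (- (sin (x * c) * c)).
Proof. by rewrite -mulNr; apply: rderiv_comp (rderivMr c x). Qed.

Lemma rderiv_sin (c x : R) : is_derive x 1 (fun t => sin (t * c)) (cos (x * c) * c).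
Proof. by apply: rderiv_comp (rderivMr c x). Qed.

Lemma rderiv_expN (c x : R) : is_derive x 1 (fun t => expR (- (t * c))) (- (expR (- (x * c)) * c)).
Proof.
have -> : (fun t => expR (- (t * c))) = (fun t => expR (t * - c)).
  by apply/funext => t; rewrite mulrN.
by rewrite -mulrN -mulrN; apply: rderiv_comp (rderivMr _ x).
Qed.

Lemma rderiv_cosl (c x : R) : is_derive x 1 (fun t => cos (c * t)) (- (sin (c * x) * c)).
Proof. by under eq_fun do rewrite mulrC; rewrite (mulrC c); exact: rderiv_cos. Qed.

Lemma rderiv_sinl (c x : R) : is_derive x 1 (fun t => sin (c * t)) (cos (c * x) * c).
Proof. by under eq_fun do rewrite mulrC; rewrite (mulrC c); exact: rderiv_sin. Qed.

Lemma rderiv_expNl (c x : R) : is_derive x 1 (fun t => expR (- (c * t))) (- (expR (- (c * x)) * c)).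
Proof. by under eq_fun do rewrite mulrC; rewrite (mulrC c); exact: rderiv_expN. Qed.

Lemma is_derive_continuous f x a : is_derive x 1 f a -> {for x, continuous f}.
Proof. by case=> d _; exact/differentiable_continuous/derivable1_diffP. Qed.

End derivation_rules.

Section powers.
Context {R : realType}.
Implicit Types (b e s y : R).

(** The inequality ln t <= t - 1 at t = (e / b) (1 + y), multiplied by [b], gives the constant
    explicitly. *)
Lemma powR_exp_bounded b e : 0 < b -> 0 < e ->
  exists C, forall y, 0 < y -> (1 + y) `^ b * expR (- (e * y)) <= C.
Proof.
move=> b0 e0; exists (expR (e - b - b * ln (e / b))) => y y0.
have y1 : 0 < 1 + y by lra.
rewrite /powR gt_eqF// -expRD ler_expR.
have d0 : 0 < e / b by exact: divr_gt0.
have : ln ((e / b) * (1 + y)) <= (e / b) * (1 + y) - 1.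
  have := @le_ln1Dx R ((e / b) * (1 + y) - 1).
  by rewrite [1 + (_ - 1)]addrC subrK; apply; rewrite ltrBrDl subrr mulr_gt0.
rewrite lnM ?posrE// => h.
have : b * (ln (e / b) + ln (1 + y)) <= b * (e / b * (1 + y) - 1) by rewrite ler_pM2l.
rewrite mulrBr mulrA (mulrCA b) divff ?gt_eqF// mulr1 => h2; lra.
Qed.

Lemma powR_cvgy b : 0 < b -> y `^ b @[y --> +oo] --> +oo.
Proof.
move=> b0; apply/cvgryPge => A; near=> y.
have y0 : 0 <= y by near: y; exact: nbhs_pinfty_ge.
have Ay : `|A| `^ b^-1 <= y by near: y; apply: nbhs_pinfty_ge; rewrite num_real.
rewrite (le_trans (ler_norm A))//.
have -> : `|A| = (`|A| `^ b^-1) `^ b by rewrite -powRrM mulVf ?gt_eqF// powRr1.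
by apply: ge0_ler_powR => //; rewrite ?nnegrE ?powR_ge0 ?ltW.
Unshelve. all: by end_near. Qed.

Let measurable_powR_exp b e D : measurable_fun D (fun y => y `^ (b - 1) * expR (- (e * y))).
Proof.
apply: measurable_funTS; apply: measurable_funM; first exact: measurable_powR.
by apply: measurableT_comp => //; apply: measurableT_comp.
Qed.

(** Comparison with the derivative b y^(b - 1) / (1 + y^(2 b)) of atan(y^b): it has the same
    singularity at 0 and an antiderivative with finite limits, and the exponential absorbs the
    denominator. *)
Lemma intg_powR_exp b e : 0 < b -> 0 < e ->
  intg Y (fun y => y `^ (b - 1) * expR (- (e * y))).
Proof.
move=> b0 e0.
have [C hC] := @powR_exp_bounded (b * 2) e ltac:(lra) e0.
pose f y := (1 + (y `^ b) ^+ 2)^-1 * (b * y `^ (b - 1)).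
have fi : intg Y f.
  apply: (@ge0_intg_half_line _ (fun y => atan (y `^ b)) _ (pi / 2) 0).
  - move=> y y0; exact: (@rderiv_comp R (fun t => t `^ b) atan y _ _ (is_derive1_atan _) (is_derive1_powR b y0)).
  - move=> y y0; apply: cvgM.
      apply: cvgV; first by rewrite gt_eqF// ltr_pwDl// sqr_ge0.
      apply: cvgD; first exact: cvg_cst.
      have cb := is_derive_continuous (is_derive1_powR b y0).
      rewrite (_ : (fun y => (y `^ b) ^+ 2) = (fun y => (y `^ b) * (y `^ b)))//.
      by rewrite expr2; apply: cvgM.
    apply: cvgM; first exact: cvg_cst.
    exact: is_derive_continuous (is_derive1_powR _ y0).
  - move=> y y0; rewrite /f mulr_ge0//; last by rewrite mulr_ge0 ?powR_ge0// ltW.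
    by rewrite invr_ge0 ltW// ltr_pwDl// sqr_ge0.
  - rewrite -[X in _ --> X](@atan0 R); apply: (cvg_comp _ _ (powR_cvg0 b0)).
    exact: continuous_atan.
  - exact: (cvg_comp _ _ (powR_cvgy b0) (@cvgy_atan R)).
apply: (@le_intg _ _ _ (fun y => ((1 + C) / b) * f y)) => //.
  move=> y; rewrite /= in_itv/= andbT => y0.
  rewrite ger0_norm ?mulr_ge0 ?powR_ge0 ?expR_ge0//.
  rewrite /f [leRHS](_ : _ = y `^ (b - 1) * ((1 + C) * (1 + y `^ b ^+ 2)^-1)); last first.
    by field; rewrite (gt_eqF b0)/= gt_eqF// ltr_pwDl// sqr_ge0.
  rewrite ler_wpM2l ?powR_ge0//.
  rewrite ler_pdivlMr; last by rewrite ltr_pwDl// sqr_ge0.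
  rewrite mulrDr mulr1 lerD//.
    by rewrite -expR0 ler_expR oppr_le0 mulr_ge0 ?ltW.
  apply: le_trans (hC y y0); rewrite mulrC ler_wpM2r ?expR_ge0//.
  rewrite -powR_mulrn ?powR_ge0// -powRrM.
  by apply: ge0_ler_powR; rewrite ?nnegrE; lra.
by apply: intgZ => //; exact: measurable_itv.
Qed.

Lemma powR_exp_cvg0 b e : 0 < b -> 0 < e ->
  y `^ b * expR (- (e * y)) @[y --> 0^'+] --> 0 /\
  y `^ b * expR (- (e * y)) @[y --> +oo] --> 0.
Proof.
move=> b0 e0; split.
  rewrite -[X in _ --> X](mul0r (1 : R)); apply: cvgM; first exact: powR_cvg0.
  apply: cvg_at_right_filter.
  have := is_derive_continuous (rderiv_expNl e (0 : R)).
  by rewrite /prop_for /continuous_at mulr0 oppr0 expR0.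
have e20 : 0 < e / 2 by lra.
have [C hC] := powR_exp_bounded b0 e20.
apply: (@squeeze_cvgr _ _ _ _ (fun=> 0) (fun y => C * expR (- (e / 2 * y)))).
- near=> y; have y0 : 0 < y by near: y; exact: nbhs_pinfty_gt.
  rewrite mulr_ge0 ?powR_ge0 ?expR_ge0//=.
  rewrite [X in expR (- X)](_ : _ = e / 2 * y + e / 2 * y); last by field.
  rewrite opprD expRD mulrA ler_wpM2r ?expR_ge0//.
  apply: le_trans (hC y y0); rewrite ler_wpM2r ?expR_ge0//.
  by apply: ge0_ler_powR; rewrite ?nnegrE; lra.
- exact: cvg_cst.
- rewrite -[X in _ --> X](mulr0 C); apply: cvgM; first exact: cvg_cst.
  apply: (cvg_comp (fun y => e / 2 * y) (fun x => expR (- x)) _ (@cvgr_expR R)).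
  exact: gt0_cvgMry.
Unshelve. all: by end_near. Qed.

End powers.

Section laplace_mellin.
Context {R : realType}.
Implicit Types (b e s y : R).

(** [mellinC] and [mellinS] are, the latter up to sign, the real and imaginary parts of Gamma(b) (e
    + i s)^(- b), the Laplace transform of y^(b - 1) at e + i s. *)
Definition mellinC b e s : R :=
  \int[mu]_(y in Y) (y `^ (b - 1) * expR (- (e * y)) * cos (s * y)).
Definition mellinS b e s : R :=
  \int[mu]_(y in Y) (y `^ (b - 1) * expR (- (e * y)) * sin (s * y)).

Let mcos s D : measurable_fun D (fun y => cos (s * y)).
Proof.
by apply: measurable_funTS; apply: continuous_measurable_fun => x;
  exact: is_derive_continuous (rderiv_cosl s x).
Qed.

Let msin s D : measurable_fun D (fun y => sin (s * y)).
Proof.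
by apply: measurable_funTS; apply: continuous_measurable_fun => x;
  exact: is_derive_continuous (rderiv_sinl s x).
Qed.

Let intgC b e s : 0 < b -> 0 < e ->
  intg Y (fun y => y `^ (b - 1) * expR (- (e * y)) * cos (s * y)).
Proof.
move=> b0 e0; apply: (@intgM_bounded _ _ _ _ 1) => //.
- by move=> x _; exact: cos_max.
- exact: intg_powR_exp.
Qed.

Let intgS b e s : 0 < b -> 0 < e ->
  intg Y (fun y => y `^ (b - 1) * expR (- (e * y)) * sin (s * y)).
Proof.
move=> b0 e0; apply: (@intgM_bounded _ _ _ _ 1) => //.
- by move=> x _; exact: sin_max.
- exact: intg_powR_exp.
Qed.

Let cvg0_bounded (F G : R -> R) (A : set_system R) : Filter A ->
  F y @[y --> A] --> 0 -> (forall y, `|G y| <= 1) ->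
  F y * G y @[y --> A] --> 0.
Proof.
move=> FA F0 G1; apply/norm_cvg0P.
have /(_ FA) := cvg_norm F0; rewrite normr0 => F0'.
apply: (@squeeze_cvgr _ _ _ _ (fun=> 0) (fun y => `|F y|)) => //; last exact: cvg_cst.
by apply: nearW => y; rewrite normr_ge0 normrM ler_piMr.
Qed.

Let powR_exp_derive b e y : 0 < y ->
  is_derive y 1 (fun y => y `^ b * expR (- (e * y)))
   (b * (y `^ (b - 1) * expR (- (e * y))) - e * (y `^ b * expR (- (e * y)))).
Proof.
move=> y0; have := rderivM (is_derive1_powR b y0) (rderiv_expNl e y).
by move/is_derive_eq; apply; ring.
Qed.

(* Integrate the derivatives of [y^b e^(- e y) cos (s y)] and
   [y^b e^(- e y) sin (s y)] over the half line. *)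
Lemma mellinC_rec b e s : 0 < b -> 0 < e ->
  b * mellinC b e s = e * mellinC (b + 1) e s + s * mellinS (b + 1) e s.
Proof.
move=> b0 e0; have b1 : 0 < b + 1 by lra.
have [F0 Fy] := powR_exp_cvg0 b0 e0.
have cb1 y : 0 < y -> {for y, continuous (fun t : R => t `^ (b - 1))}.
  by move=> y0; exact: is_derive_continuous (is_derive1_powR (b - 1) y0).
pose f y := b * (y `^ (b - 1) * expR (- (e * y)) * cos (s * y))
   - (e * (y `^ (b + 1 - 1) * expR (- (e * y)) * cos (s * y))
   + s * (y `^ (b + 1 - 1) * expR (- (e * y)) * sin (s * y))).
have mY : measurable (Y : set R) by exact: measurable_itv.
have fi : intg Y f.
  apply: intgB => //; first by apply: intgZ => //; exact: intgC.
  by apply: intgD => //; apply: intgZ => //; [exact: intgC|exact: intgS].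
have : \int[mu]_(y in Y) f y = 0 - 0.
  apply: (@FTC_half_line _ (fun y => y `^ b * expR (- (e * y)) * cos (s * y))) => //.
  - move=> y y0; have := rderivM (powR_exp_derive b e y0) (rderiv_cosl s y).
    by move/is_derive_eq; apply; rewrite /f addrK; ring.
  - move=> y y0; have ? := cb1 y y0.
    have cb : {for y, continuous (fun t : R => t `^ b)} by exact: is_derive_continuous (is_derive1_powR b y0).
    have ce : {for y, continuous (fun y : R => expR (- (e * y)))} by exact: is_derive_continuous (rderiv_expNl e y).
    have cc : {for y, continuous (fun y : R => cos (s * y))} by exact: is_derive_continuous (rderiv_cosl s y).
    have cs : {for y, continuous (fun y : R => sin (s * y))} by exact: is_derive_continuous (rderiv_sinl s y).
    rewrite /f addrK; apply: cvgB; first by apply: cvgM; [exact: cvg_cst|apply: cvgM => //; exact: cvgM].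
    by apply: cvgD; apply: cvgM; try exact: cvg_cst; apply: cvgM => //; exact: cvgM.
  - by apply: cvg0_bounded => // y; exact: cos_max.
  - by apply: cvg0_bounded => // y; exact: cos_max.
rewrite subrr RintegralB//; first last.
- by apply: intgD => //; apply: intgZ => //; [exact: intgC|exact: intgS].
- by apply: intgZ => //; exact: intgC.
rewrite RintegralD//; first last.
- by apply: intgZ => //; exact: intgS.
- by apply: intgZ => //; exact: intgC.
rewrite !RintegralZl//; [|exact: intgS|exact: intgC|exact: intgC].
by move/eqP; rewrite subr_eq0 => /eqP.
Qed.

Lemma mellinS_rec b e s : 0 < b -> 0 < e ->
  b * mellinS b e s = e * mellinS (b + 1) e s - s * mellinC (b + 1) e s.
Proof.
move=> b0 e0; have b1 : 0 < b + 1 by lra.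
have [F0 Fy] := powR_exp_cvg0 b0 e0.
have cb1 y : 0 < y -> {for y, continuous (fun t : R => t `^ (b - 1))}.
  by move=> y0; exact: is_derive_continuous (is_derive1_powR (b - 1) y0).
pose f y := b * (y `^ (b - 1) * expR (- (e * y)) * sin (s * y))
   - (e * (y `^ (b + 1 - 1) * expR (- (e * y)) * sin (s * y))
   - s * (y `^ (b + 1 - 1) * expR (- (e * y)) * cos (s * y))).
have mY : measurable (Y : set R) by exact: measurable_itv.
have fi : intg Y f.
  apply: intgB => //; first by apply: intgZ => //; exact: intgS.
  by apply: intgB => //; apply: intgZ => //; [exact: intgS|exact: intgC].
have : \int[mu]_(y in Y) f y = 0 - 0.
  apply: (@FTC_half_line _ (fun y => y `^ b * expR (- (e * y)) * sin (s * y))) => //.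
  - move=> y y0; have := rderivM (powR_exp_derive b e y0) (rderiv_sinl s y).
    by move/is_derive_eq; apply; rewrite /f addrK; ring.
  - move=> y y0; have ? := cb1 y y0.
    have cb : {for y, continuous (fun t : R => t `^ b)} by exact: is_derive_continuous (is_derive1_powR b y0).
    have ce : {for y, continuous (fun y : R => expR (- (e * y)))} by exact: is_derive_continuous (rderiv_expNl e y).
    have cc : {for y, continuous (fun y : R => cos (s * y))} by exact: is_derive_continuous (rderiv_cosl s y).
    have cs : {for y, continuous (fun y : R => sin (s * y))} by exact: is_derive_continuous (rderiv_sinl s y).
    rewrite /f addrK; apply: cvgB; first by apply: cvgM; [exact: cvg_cst|apply: cvgM => //; exact: cvgM].
    by apply: cvgB; apply: cvgM; try exact: cvg_cst; apply: cvgM => //; exact: cvgM.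
  - by apply: cvg0_bounded => // y; exact: sin_max.
  - by apply: cvg0_bounded => // y; exact: sin_max.
rewrite subrr RintegralB//; first last.
- by apply: intgB => //; apply: intgZ => //; [exact: intgS|exact: intgC].
- by apply: intgZ => //; exact: intgS.
rewrite RintegralB//; first last.
- by apply: intgZ => //; exact: intgC.
- by apply: intgZ => //; exact: intgS.
rewrite !RintegralZl//; [|exact: intgC|exact: intgS|exact: intgS].
by move/eqP; rewrite subr_eq0 => /eqP.
Qed.

(** Differentiating in [s] brings down a factor y, which raises [b] by one; the integrand without
    its trigonometric factor dominates for all [s]. *)
Lemma mellinC_derive b e s : 0 < b -> 0 < e ->
  is_derive s 1 (mellinC b e) (- mellinS (b + 1) e s).
Proof.
move=> b0 e0; have b1 : 0 < b + 1 by lra.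
have mY : measurable (Y : set R) by exact: measurable_itv.
have h : is_derive s 1 (mellinC b e)
   (\int[mu]_(y in Y) (- 1 * (y `^ (b + 1 - 1) * expR (- (e * y)) * sin (s * y)))).
  apply: (@is_derive_under_integral _ Y _ (fun s y => - 1 * (y `^ (b + 1 - 1) * expR (- (e * y)) * sin (s * y)))
    (fun y => y `^ (b + 1 - 1) * expR (- (e * y))) (s - 1) (s + 1)) => //.
  - by apply/andP; split; lra.
  - by move=> x _; exact: intgC.
  - move=> x y _; rewrite /= in_itv/= andbT => y0.
    have := rderivZ (y `^ (b - 1) * expR (- (e * y))) (rderiv_cos y x).
    move/is_derive_eq; apply; rewrite addrK -(mulr_powRB1 (ltW y0) b0); ring.
  - move=> x y _ _; rewrite !normrM normrN1 mul1r (ger0_norm (powR_ge0 _ _)) (ger0_norm (expR_ge0 _)).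
    by rewrite ler_piMr ?mulr_ge0 ?powR_ge0 ?expR_ge0// sin_max.
  - exact: intg_powR_exp.
by apply: is_derive_eq h _; rewrite RintegralZl ?mulN1r//; exact: intgS.
Qed.

Lemma mellinS_derive b e s : 0 < b -> 0 < e ->
  is_derive s 1 (mellinS b e) (mellinC (b + 1) e s).
Proof.
move=> b0 e0; have b1 : 0 < b + 1 by lra.
have mY : measurable (Y : set R) by exact: measurable_itv.
apply: (@is_derive_under_integral _ Y _ (fun s y => y `^ (b + 1 - 1) * expR (- (e * y)) * cos (s * y))
    (fun y => y `^ (b + 1 - 1) * expR (- (e * y))) (s - 1) (s + 1)) => //.
- by apply/andP; split; lra.
- by move=> x _; exact: intgS.
- move=> x y _; rewrite /= in_itv/= andbT => y0.
  have := rderivZ (y `^ (b - 1) * expR (- (e * y))) (rderiv_sin y x).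
  move/is_derive_eq; apply; rewrite addrK -(mulr_powRB1 (ltW y0) b0); ring.
- move=> x y _ _; rewrite !normrM (ger0_norm (powR_ge0 _ _)) (ger0_norm (expR_ge0 _)).
  by rewrite ler_piMr ?mulr_ge0 ?powR_ge0 ?expR_ge0// cos_max.
- exact: intg_powR_exp.
Qed.

(** On the window from [e / 2] to [e + 1] every exponential lies below e^(- (e / 2) y), which
    supplies the dominating function. *)
Let mellinC_derive_e b e : 0 < b -> 0 < e ->
  is_derive e 1 (fun e => mellinC b e 0) (- mellinC (b + 1) e 0).
Proof.
move=> b0 e0; have b1 : 0 < b + 1 by lra.
have mY : measurable (Y : set R) by exact: measurable_itv.
have h : is_derive e 1 (fun e => mellinC b e 0)
   (\int[mu]_(y in Y) (- 1 * (y `^ (b + 1 - 1) * expR (- (e * y)) * cos (0 * y)))).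
  apply: (@is_derive_under_integral _ Y (fun e y => y `^ (b - 1) * expR (- (e * y)) * cos (0 * y))
     (fun e y => - 1 * (y `^ (b + 1 - 1) * expR (- (e * y)) * cos (0 * y)))
    (fun y => y `^ (b + 1 - 1) * expR (- (e / 2 * y))) (e / 2) (e + 1)) => //.
  - by apply/andP; split; lra.
  - by move=> x /andP[ex _]; apply: intgC => //; lra.
  - move=> x y _; rewrite /= in_itv/= andbT => y0; rewrite mul0r cos0.
    have := rderivM (rderivZ (y `^ (b - 1)) (rderiv_expN y x)) (is_derive_cst (1 : R) x (1 : R)).
    move/is_derive_eq; apply; rewrite addrK -(mulr_powRB1 (ltW y0) b0) /=; ring.
  - move=> x y /andP[ex _]; rewrite /= in_itv/= andbT => y0.
    rewrite mul0r cos0 mulr1 !normrM normrN1 mul1r (ger0_norm (powR_ge0 _ _)) (ger0_norm (expR_ge0 _)).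
    by rewrite ler_wpM2l ?powR_ge0// ler_expR lerN2 ler_wpM2r ?ltW.
  - by apply: intg_powR_exp => //; lra.
by apply: is_derive_eq h _; rewrite RintegralZl ?mulN1r//; exact: intgC.
Qed.

(** Scaling obtained from a differential equation instead of a substitution: e^b times the integral
    has zero derivative by [mellinC_rec] at [s = 0]. Writing the rate as [expR t] gives a function
    differentiable on the whole line, equal to [Gamma b] at [t = 0]. *)
Lemma mellinC0 b e : 0 < b -> 0 < e -> mellinC b e 0 = Gamma b * e `^ (- b).
Proof.
move=> b0 e0.
pose h t := expR (b * t) * mellinC b (expR t) 0.
have h' (t : R) : is_derive t 1 h 0.
  have d1 : is_derive t 1 (fun t => expR (b * t)) (expR (b * t) * b).
    by apply: rderiv_comp; exact: rderivMl.
  have d2 : is_derive t 1 (fun t => mellinC b (expR t) 0) (- mellinC (b + 1) (expR t) 0 * expR t).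
    by apply: (@rderiv_comp _ expR (fun e => mellinC b e 0)); apply: mellinC_derive_e => //; exact: expR_gt0.
  have := rderivM d1 d2; move/is_derive_eq; apply.
  have := mellinC_rec 0 b0 (expR_gt0 t); rewrite (mul0r (mellinS _ _ _)) addr0 => E.
  by rewrite -mulrA E mulNr (mulrC (mellinC _ _ _)) mulrN subrr.
have := @is_derive_0_is_cst _ h (ln e) 0 h'.
rewrite /h mulr0 expR0 (mul1r (mellinC _ _ _)) lnK ?posrE// => E.
have -> : Gamma b = mellinC b 1 0.
  by apply: eq_Rintegral => y _; rewrite mul1r mul0r cos0 mulr1.
have eb : e `^ b = expR (b * ln e) by rewrite /powR gt_eqF.
by rewrite -E powRN eb (mulrC (expR _)) mulfK// gt_eqF// expR_gt0.
Qed.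

Lemma mellinS0 b e : mellinS b e 0 = 0.
Proof.
rewrite /mellinS; under eq_Rintegral do rewrite mul0r sin0 mulr0.
by rewrite Rintegral_cst ?mul0r//; exact: measurable_itv.
Qed.

End laplace_mellin.

Section mellin_closed_form.
Context {R : realType}.
Implicit Types (b e s y : R).

(* In complex notation, [Z = mellinC - i mellinS] solves [(e + i s) Z' = - i b Z],
   so that [(e + i s)^b Z] does not depend on [s]; below, its real and imaginary
   parts are written in polar coordinates. *)
Lemma mellinC_polar b e s : 0 < b -> 0 < e ->
  (e ^+ 2 + s ^+ 2) `^ (b / 2) * mellinC b e s = Gamma b * cos (b * atan (s / e)).
Proof.
move=> b0 e0.
pose rho (s : R) := (e ^+ 2 + s ^+ 2) `^ (b / 2).
pose th (s : R) := b * atan (s / e).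
have D0 (t : R) : 0 < e ^+ 2 + t ^+ 2 by rewrite ltr_pwDl ?exprn_gt0 ?sqr_ge0.
have drho (t : R) : is_derive t 1 rho (b * t / (e ^+ 2 + t ^+ 2) * rho t).
  have d1 : is_derive t 1 (fun t => e ^+ 2 + t * t) (0 + (1 * t + t * 1)).
    exact: (@rderivD R (cst (e ^+ 2)) (fun t => t * t) t _ _ (is_derive_cst _ _ _)
      (rderivM (is_derive_id t (1 : R)) (is_derive_id t (1 : R)))).
  have -> : rho = (fun t => (e ^+ 2 + t * t) `^ (b / 2)) by [].
  have := @rderiv_comp R (fun t => e ^+ 2 + t * t) (fun t => t `^ (b / 2)) t _ _
     (is_derive1_powR (b / 2) (D0 t)) d1.
  move/is_derive_eq; apply.
  rewrite -[X in _ = _ * X](mulr_powRB1 (ltW (D0 t)) _); last by rewrite divr_gt0.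
  by field; rewrite gt_eqF.
have dth (t : R) : is_derive t 1 th (b * (e / (e ^+ 2 + t ^+ 2))).
  apply: rderivZ.
  have := @rderiv_comp R (fun t => t / e) atan t _ _ (is_derive1_atan _) (rderivMr e^-1 t).
  by move/is_derive_eq; apply; field; rewrite (gt_eqF e0) gt_eqF//.
have dcos (t : R) : is_derive t 1 (fun t => cos (th t)) (- sin (th t) * (b * (e / (e ^+ 2 + t ^+ 2)))).
  exact: (@rderiv_comp R th cos t _ _ (is_derive_cos _) (dth t)).
have dsin (t : R) : is_derive t 1 (fun t => sin (th t)) (cos (th t) * (b * (e / (e ^+ 2 + t ^+ 2)))).
  exact: (@rderiv_comp R th sin t _ _ (is_derive_sin _) (dth t)).
(* The two recurrences are a linear system for the transforms at [b + 1]; up to sign its determinant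
   is e^2 + t^2. *)
have S1E (t : R) : mellinS (b + 1) e t = b * (t * mellinC b e t + e * mellinS b e t) / (e ^+ 2 + t ^+ 2).
  have hC := mellinC_rec t b0 e0; have hS := mellinS_rec t b0 e0.
  rewrite mulrDr !(mulrCA b) hC hS.
  move: (mellinC (b + 1) e t) (mellinS (b + 1) e t) => c d.
  by field; rewrite gt_eqF.
have C1E (t : R) : mellinC (b + 1) e t = b * (e * mellinC b e t - t * mellinS b e t) / (e ^+ 2 + t ^+ 2).
  have hC := mellinC_rec t b0 e0; have hS := mellinS_rec t b0 e0.
  rewrite mulrBr !(mulrCA b) hC hS.
  move: (mellinC (b + 1) e t) (mellinS (b + 1) e t) => c d.
  by field; rewrite gt_eqF.
(* [U] and [- V] are the real and imaginary parts of (e + i t)^b Z; a rotation by [th] recovers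
   [mellinC] from them at the end. *)
pose U t := rho t * (mellinC b e t * cos (th t) + mellinS b e t * sin (th t)).
pose V t := rho t * (mellinS b e t * cos (th t) - mellinC b e t * sin (th t)).
have dU (t : R) : is_derive t 1 U 0.
  have := rderivM (drho t) (rderivD (rderivM (mellinC_derive t b0 e0) (dcos t)) (rderivM (mellinS_derive t b0 e0) (dsin t))).
  move/is_derive_eq; apply; rewrite S1E C1E.
  move: (mellinC b e t) (mellinS b e t) (rho t) (cos (th t)) (sin (th t)) => c d r x y.
  by field; rewrite gt_eqF.
have dV (t : R) : is_derive t 1 V 0.
  have := rderivM (drho t) (rderivD (rderivM (mellinS_derive t b0 e0) (dcos t)) (rderivZ (-1) (rderivM (mellinC_derive t b0 e0) (dsin t)))).
  rewrite (_ : (fun t => _) = V); last by apply/funext => x; rewrite /V mulN1r.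
  move/is_derive_eq; apply; rewrite S1E C1E.
  move: (mellinC b e t) (mellinS b e t) (rho t) (cos (th t)) (sin (th t)) => c d r x y.
  by field; rewrite gt_eqF.
have th0 : th 0 = 0 by rewrite /th mul0r atan0 mulr0.
have rho0 : rho 0 = e `^ b.
  rewrite /rho expr0n addr0 -powR_mulrn ?(ltW e0)// -powRrM; congr (_ `^ _); by field.
have UE : U s = Gamma b.
  rewrite (@is_derive_0_is_cst _ U s 0 dU) /U th0 cos0 sin0 mulr1 mulr0 addr0.
  rewrite rho0 mellinC0// mulrCA -powRD ?subrr ?powRr0 ?mulr1//.
  by rewrite (gt_eqF e0) implybT.
have VE : V s = 0.
  by rewrite (@is_derive_0_is_cst _ V s 0 dV) /V th0 sin0 mellinS0 mul0r mulr0 subr0 mulr0.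
have : U s * cos (th s) - V s * sin (th s) = rho s * mellinC b e s.
  rewrite /U /V -[RHS]mulr1 -(cos2Dsin2 (th s)).
  by move: (mellinC b e s) (mellinS b e s) (rho s) (cos (th s)) (sin (th s)) => c d r x y; ring.
by rewrite UE VE mul0r subr0 => <-.
Qed.

Lemma Gamma_ge0 b : 0 <= Gamma b.
Proof. by apply: Rintegral_ge0 => x _; rewrite mulr_ge0 ?powR_ge0 ?expR_ge0. Qed.

(** In the polar form (e^2 + s^2)^(b / 2) is at least s^b. The bound is free of [e], so it can
    dominate as [e] tends to 0. *)
Lemma mellinC_bound b e s : 0 < b -> 0 < e -> 0 < s ->
  `|mellinC b e s| <= Gamma b * s `^ (- b).
Proof.
move=> b0 e0 s0; have sb : 0 < s `^ b by exact: powR_gt0.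
rewrite powRN ler_pdivlMr// mulrC.
apply: (@le_trans _ _ ((e ^+ 2 + s ^+ 2) `^ (b / 2) * `|mellinC b e s|)).
  rewrite ler_wpM2r// [in leLHS](_ : b = 2 * (b / 2)); last by field.
  rewrite powRrM; apply: ge0_ler_powR; rewrite ?nnegrE ?powR_ge0//.
  - by lra.
  - by rewrite addr_ge0 ?sqr_ge0.
  - by rewrite (@powR_mulrn _ s 2) ?(ltW s0)// lerDr sqr_ge0.
rewrite -[X in X * _](ger0_norm (powR_ge0 _ _)) -normrM mellinC_polar// normrM.
by rewrite (ger0_norm (Gamma_ge0 b)) ler_piMr ?Gamma_ge0// cos_max.
Qed.

(** As the rate tends to 0, the angle atan(s / e) of the polar form tends to pi / 2; this is where
    the cosine in the Riesz constant originates. *)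
Lemma mellinC_cvg b s : 0 < b -> 0 < s ->
  mellinC b (n.+1%:R)^-1 s @[n --> \oo] --> Gamma b * cos (b * (pi / 2)) * s `^ (- b).
Proof.
move=> b0 s0.
have E n : mellinC b (n.+1%:R)^-1 s =
    Gamma b * cos (b * atan (s * n.+1%:R)) * ((((n.+1%:R)^-1) ^+ 2 + s ^+ 2) `^ (- (b / 2))).
  have D0 : 0 < ((n.+1%:R)^-1) ^+ 2 + s ^+ 2 by rewrite ltr_pwDl ?exprn_gt0 ?sqr_ge0// invr_gt0.
  have := @mellinC_polar b (n.+1%:R)^-1 s b0.
  rewrite invr_gt0 ltr0n => /(_ isT); rewrite invrK => <-.
  rewrite powRN mulrAC divff ?mul1r// gt_eqF// powR_gt0//.
under eq_fun do rewrite E.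
have n1_oo : (n.+1%:R : R) @[n --> \oo] --> +oo by apply/cvgrnyP; rewrite (cvg_shiftS id).
have n_oo : (s * n.+1%:R) @[n --> \oo] --> +oo.
  exact: (cvg_comp _ _ n1_oo (gt0_cvgMry s0 cvg_id)).
apply: cvgM.
  apply: cvgM; first exact: cvg_cst.
  apply: (@continuous_cvg _ _ _ _ _ (fun n => b * atan (s * n.+1%:R)) cos); first exact: continuous_cos.
  apply: cvgM; first exact: cvg_cst.
  exact: (cvg_comp _ _ n_oo (@cvgy_atan R)).
have -> : s `^ (- b) = (0 ^+ 2 + s ^+ 2) `^ (- (b / 2)).
  rewrite expr0n add0r -powR_mulrn ?ltW// -powRrM; congr (_ `^ _); by field.
apply: (@continuous_cvg _ _ _ _ _ (fun n => ((n.+1%:R)^-1) ^+ 2 + s ^+ 2) (fun t => t `^ (- (b / 2)))).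
  have s20 : 0 < 0 ^+ 2 + s ^+ 2 by rewrite expr0n add0r exprn_gt0.
  exact: is_derive_continuous (is_derive1_powR (- (b / 2)) s20).
apply: cvgD; last exact: cvg_cst.
rewrite expr2; under eq_fun do rewrite expr2.
by apply: cvgM; exact: cvg_harmonic.
Qed.

(** For exponent [b = 1] an elementary antiderivative exists, and it yields a rational value with no
    arctangent. *)
Lemma laplace_cos e s : 0 < e ->
  \int[mu]_(y in Y) (expR (- (e * y)) * cos (y * s)) = e / (e ^+ 2 + s ^+ 2).
Proof.
move=> e0.
have D0 : 0 < e ^+ 2 + s ^+ 2 by rewrite ltr_pwDl ?exprn_gt0 ?sqr_ge0.
pose F y := (e ^+ 2 + s ^+ 2)^-1 * (expR (- (e * y)) * (s * sin (s * y) - e * cos (s * y))).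
have dF y : is_derive y 1 F (expR (- (e * y)) * cos (y * s)).
  have := rderivZ (e ^+ 2 + s ^+ 2)^-1 (rderivM (rderiv_expNl e y)
    (rderivD (rderivZ s (rderiv_sinl s y)) (rderivZ (- e) (rderiv_cosl s y)))).
  rewrite (_ : (fun t => _) = F); last by apply/funext => x; rewrite /F mulNr.
  by move/is_derive_eq; apply; rewrite (mulrC y); field; rewrite gt_eqF.
have -> : e / (e ^+ 2 + s ^+ 2) = 0 - F 0.
  by rewrite /F !mulr0 oppr0 expR0 cos0 sin0; field; rewrite gt_eqF.
apply: (@FTC_half_line _ F).
- move=> y _; apply: cvgM; first exact: is_derive_continuous (rderiv_expNl e y).
  exact: is_derive_continuous (rderiv_cos s y).
- by apply: cvg_at_right_filter; exact: is_derive_continuous (dF 0).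
- apply/norm_cvg0P; pose M := (e ^+ 2 + s ^+ 2)^-1 * (`|s| + e).
  apply: (@squeeze_cvgr _ _ _ _ (fun=> 0) (fun y => M * expR (- (e * y)))).
  + apply: nearW => y; rewrite normr_ge0 /F /M /= normrM ger0_norm ?invr_ge0 ?(ltW D0)//.
    rewrite -mulrA ler_wpM2l ?invr_ge0 ?(ltW D0)// normrM ger0_norm ?expR_ge0// mulrC ler_wpM2r ?expR_ge0//.
    rewrite (le_trans (ler_normB _ _))// !normrM (gtr0_norm e0) lerD// ler_piMr ?sin_max ?cos_max// ltW//.
  + exact: cvg_cst.
  + rewrite -[X in _ --> X](mulr0 M); apply: cvgM; first exact: cvg_cst.
    apply: (cvg_comp (fun y => e * y) (fun x => expR (- x)) _ (@cvgr_expR R)).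
    exact: gt0_cvgMry.
- apply: (@intgM_bounded _ _ _ _ 1).
  + exact: measurable_itv.
  + apply: measurable_funTS; apply: continuous_measurable_fun => x.
    exact: is_derive_continuous (rderiv_cos s x).
  + by move=> x _; exact: cos_max.
  + have := @intg_powR_exp R 1 e ltr01 e0.
    by under [X in integrable _ _ X]eq_fun do rewrite /= subrr powRr0 mul1r.
Qed.

End mellin_closed_form.

(** * The Poisson kernel as an approximate identity *)

Section poisson_kernel.
Context {R : realType}.
Implicit Types (e t x y : R).

(** Without the usual factor 1 / pi: the total mass is pi, and limits below carry that factor. *)
Definition poisson e t : R := e / (e ^+ 2 + t ^+ 2).

Lemma poisson_continuous e : 0 < e -> continuous (poisson e).
Proof.
move=> e0 t; have D0 : 0 < e ^+ 2 + t ^+ 2 by rewrite ltr_pwDl ?exprn_gt0 ?sqr_ge0.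
apply: cvgM; first exact: cvg_cst.
apply: cvgV; first by rewrite gt_eqF.
by apply: cvgD; [exact: cvg_cst|exact: exprn_continuous].
Qed.

Lemma poisson_gt0 e t : 0 < e -> 0 < poisson e t.
Proof. by move=> e0; rewrite divr_gt0// ltr_pwDl ?exprn_gt0 ?sqr_ge0. Qed.

Let poissonN e t : poisson e (- t) = poisson e t.
Proof. by rewrite /poisson sqrrN. Qed.

Let poisson_atan e t : 0 < e -> is_derive t 1 (fun t => atan (t / e)) (poisson e t).
Proof.
move=> e0; have D0 : 0 < e ^+ 2 + t ^+ 2 by rewrite ltr_pwDl ?exprn_gt0 ?sqr_ge0.
have := @rderiv_comp R (fun t => t / e) atan t _ _ (is_derive1_atan _) (rderivMr e^-1 t).
by move/is_derive_eq; apply; rewrite /poisson; field; rewrite (gt_eqF e0) gt_eqF.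
Qed.

Let atan_cvg0 e : 0 < e -> atan (t / e) @[t --> 0^'+] --> 0.
Proof.
move=> e0; apply: cvg_at_right_filter; have := is_derive_continuous (poisson_atan 0 e0).
by rewrite /prop_for /continuous_at mul0r atan0.
Qed.

Let atan_cvgy e : 0 < e -> atan (t / e) @[t --> +oo] --> pi / 2.
Proof.
move=> e0; apply: (cvg_comp (fun t => t / e) _ _ (@cvgy_atan R)).
by apply: gt0_cvgMly => //; rewrite invr_gt0.
Qed.

Let intgY_poisson e : 0 < e -> intg Y (poisson e).
Proof.
move=> e0; apply: (@ge0_intg_half_line _ (fun t => atan (t / e)) _ (pi / 2) 0).
- by move=> t _; exact: poisson_atan.
- by move=> t _; exact: poisson_continuous.
- by move=> t _; exact/ltW/poisson_gt0.
- exact: atan_cvg0.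
- exact: atan_cvgy.
Qed.

Lemma intg_poisson e x : 0 < e -> intg setT (fun y => poisson e (x - y)).
Proof.
move=> e0; apply: intg_reflect; apply: intg_even; [exact: intgY_poisson|exact: poissonN].
Qed.

Lemma Rintegral_poisson e x : 0 < e -> \int[mu]_y poisson e (x - y) = pi.
Proof.
move=> e0; have pT : intg setT (poisson e).
  by apply: intg_even; [exact: intgY_poisson|exact: poissonN].
rewrite Rintegral_reflect// Rintegral_even//.
have -> : \int[mu]_(t in Y) poisson e t = pi / 2 - 0; last by field.
apply: (@FTC_half_line _ (fun t => atan (t / e))).
- by move=> t _; exact: poisson_atan.
- by move=> t _; exact: poisson_continuous.
- exact: atan_cvg0.
- exact: atan_cvgy.
- exact: intgY_poisson.
Qed.

(** Since [u] is only integrable, the tail cannot be estimated by a supremum. At distance at least d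
    from [x] one has poisson e <= e c (poisson 1) with c = (1 + d^2) / d^2, and poisson 1 <= 1, so
    the tail is at most [e * c] times the integrable [h]. Nearby, continuity gives [eta'], chosen as
    eta / (2 pi) because the mass is pi. *)
Lemma poisson_cvg (u : R -> R) x : intg setT u -> {for x, continuous u} ->
  \int[mu]_y (u y * poisson (n.+1%:R)^-1 (x - y)) @[n --> \oo] --> pi * u x.
Proof.
move=> ui cu.
have e0 n : 0 < (n.+1%:R : R)^-1 by rewrite invr_gt0.
have mp e : 0 < e -> measurable_fun setT (fun y => poisson e (x - y)).
  by move=> /(intg_poisson x)/intg_measurable.
have pe e y : 0 < e -> `|poisson e (x - y)| <= e^-1.
  move=> e_gt0; rewrite ger0_norm; last exact/ltW/poisson_gt0.
  rewrite /poisson ler_pdivrMr; last by rewrite ltr_pwDl ?exprn_gt0 ?sqr_ge0.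
  by rewrite mulrDr expr2 mulKf ?gt_eqF// lerDl mulr_ge0 ?sqr_ge0// invr_ge0 ltW.
have upi e : 0 < e -> intg setT (fun y => u y * poisson e (x - y)).
  move=> e_gt0; apply: (@intgM_bounded _ _ _ _ e^-1) => //; first exact: mp.
  by move=> y _; exact: pe.
apply/cvgrPdist_le => /= eta eta0.
pose eta' := eta / (2 * pi).
have eta'0 : 0 < eta' by rewrite divr_gt0// mulr_gt0// pi_gt0.
have /cvgrPdist_le/(_ _ eta'0) := cu.
rewrite -nbhs_ballE => -[d /= d0 hd].
pose c := (1 + d ^+ 2) / d ^+ 2.
have c0 : 0 < c by rewrite divr_gt0// ?exprn_gt0// ltr_pwDl// sqr_ge0.
pose h y := `|u y| + `|u x| * poisson 1 (x - y).
have hi : intg setT h.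
  apply: intgD => //; first exact: intg_norm.
  by apply: intgZ => //; exact: intg_poisson.
pose K := \int[mu]_y h y.
have K0 : 0 <= K.
  by apply: Rintegral_ge0 => y _; rewrite addr_ge0// mulr_ge0// ltW// poisson_gt0.
have key e y : 0 < e -> `|(u y - u x) * poisson e (x - y)| <= eta' * poisson e (x - y) + e * (c * h y).
  move=> e_gt0; have p0 := poisson_gt0 (x - y) e_gt0.
  rewrite normrM (gtr0_norm p0).
  have h0 : 0 <= h y by rewrite addr_ge0// mulr_ge0// ltW// poisson_gt0.
  have [xyd|xyd] := ltP `|x - y| d.
    have := hd y xyd; rewrite distrC => uy.
    apply: (@le_trans _ _ (eta' * poisson e (x - y))); first by rewrite ler_wpM2r// ltW.
    by rewrite lerDl; apply: mulr_ge0; [exact: ltW|apply: mulr_ge0 => //; exact: ltW].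
  apply: (@le_trans _ _ (e * (c * h y))); last by rewrite lerDr; apply: mulr_ge0; exact: ltW.
  have p1 : poisson e (x - y) <= e * (c * poisson 1 (x - y)).
    rewrite /poisson ler_wpM2l ?(ltW e_gt0)// /c expr1n div1r.
    set t := x - y in xyd *.
    have dt : d ^+ 2 <= t ^+ 2.
      by rewrite -(@real_normK _ t) ?num_real// lerXn2r ?nnegrE ?(ltW d0)// ltW// (lt_le_trans d0).
    have t20 : 0 < t ^+ 2 by rewrite (lt_le_trans _ dt)// exprn_gt0.
    rewrite -mulrA -invfM -[leLHS]div1r ler_pdivrMr; last by rewrite ltr_pwDl ?exprn_gt0 ?sqr_ge0.
    rewrite mulrAC ler_pdivlMr; last by rewrite mulr_gt0 ?exprn_gt0// ltr_pwDl// sqr_ge0.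
    have : 0 <= e ^+ 2 * (1 + d ^+ 2) by rewrite mulr_ge0 ?sqr_ge0// addr_ge0 ?sqr_ge0.
    by lra.
  have p11 : poisson 1 (x - y) <= 1.
    by have := pe 1 y ltr01; rewrite ger0_norm ?invr1// ltW// poisson_gt0.
  apply: (@le_trans _ _ ((`|u y| + `|u x|) * (e * (c * poisson 1 (x - y))))).
    by apply: ler_pM => //; [exact: ltW|exact: ler_normB].
  rewrite [leLHS](_ : _ = e * (c * (`|u y| * poisson 1 (x - y) + `|u x| * poisson 1 (x - y)))); last by ring.
  rewrite ler_wpM2l ?(ltW e_gt0)// ler_wpM2l ?(ltW c0)// lerD2r ler_piMr//.
have main e : 0 < e -> `|pi * u x - \int[mu]_y (u y * poisson e (x - y))| <= eta' * pi + e * (c * K).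
  move=> e_gt0; rewrite distrC.
  have -> : pi * u x = \int[mu]_y (u x * poisson e (x - y)).
    by rewrite RintegralZl ?Rintegral_poisson 1?mulrC//; exact: intg_poisson.
  rewrite -RintegralB//; [|exact: upi|by apply: intgZ => //; exact: intg_poisson].
  have -> : eta' * pi + e * (c * K) = \int[mu]_y (eta' * poisson e (x - y) + e * (c * h y)).
    rewrite RintegralD//; first last.
    - by apply: intgZ => //; apply: intgZ.
    - by apply: intgZ => //; exact: intg_poisson.
    rewrite RintegralZl ?Rintegral_poisson//; last exact: intg_poisson.
    by rewrite RintegralZl ?RintegralZl//; apply: intgZ.
  apply: Rintegral_le_norm => //.
  - apply: measurable_funB; first exact: intg_measurable (upi _ e_gt0).
    by apply: measurable_funM => //; exact: mp.
  - by move=> y _; rewrite -mulrBl; exact: key.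
  - apply: intgD => //; first by apply: intgZ => //; exact: intg_poisson.
    by apply: intgZ => //; apply: intgZ.
have eK : (n.+1%:R : R)^-1 * (c * K) @[n --> \oo] --> 0.
  rewrite -[X in _ --> X](mul0r (c * K)); apply: cvgM; last exact: cvg_cst.
  exact: cvg_harmonic.
have /cvgrPdist_le/(_ (eta / 2)) := eK.
have eta20 : 0 < eta / 2 by lra.
move=> /(_ eta20); apply: filterS => n /=.
rewrite sub0r normrN ger0_norm; last by apply: mulr_ge0; [exact: ltW|apply: mulr_ge0 => //; exact: ltW].
move=> hn; apply: (le_trans (main _ (e0 n))).
have pi_neq0 : (pi : R) != 0 by rewrite gt_eqF// pi_gt0.
have -> : eta' * pi = eta / 2 by rewrite /eta' invfM mulrA divfK.
by rewrite [leRHS](splitr eta) lerD2l.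
Qed.

End poisson_kernel.

(** * Cosine and sine transforms *)

Section trigonometric_transforms.
Context {R : realType}.
Implicit Types (D : set R) (f g : R -> R) (s x y w : R).

(** Used with [D = setT] for the transforms of [u], and with [D = Y] for the inversion integrals. *)
Definition fcos D f s : R := \int[mu]_(y in D) (f y * cos (y * s)).
Definition fsin D f s : R := \int[mu]_(y in D) (f y * sin (y * s)).

Lemma measurable_cosM s : measurable_fun setT (fun y : R => cos (y * s)).
Proof.
by apply: continuous_measurable_fun => x; exact: is_derive_continuous (rderiv_cos s x).
Qed.

Lemma measurable_sinM s : measurable_fun setT (fun y : R => sin (y * s)).
Proof.
by apply: continuous_measurable_fun => x; exact: is_derive_continuous (rderiv_sin s x).
Qed.

Lemma intg_fcos D f s : measurable D -> intg D f -> intg D (fun y => f y * cos (y * s)).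
Proof.
move=> mD fi; apply: (@intgM_bounded _ _ _ _ 1) => //.
- exact: measurable_funTS (measurable_cosM s).
- by move=> x _; exact: cos_max.
Qed.

Lemma intg_fsin D f s : measurable D -> intg D f -> intg D (fun y => f y * sin (y * s)).
Proof.
move=> mD fi; apply: (@intgM_bounded _ _ _ _ 1) => //.
- exact: measurable_funTS (measurable_sinM s).
- by move=> x _; exact: sin_max.
Qed.

Lemma fcos_bound D f s : measurable D -> intg D f ->
  `|fcos D f s| <= \int[mu]_(y in D) `|f y|.
Proof.
move=> mD fi; apply: Rintegral_le_norm => //.
- exact: intg_measurable (intg_fcos s mD fi).
- by move=> x _; rewrite normrM ler_piMr// cos_max.
- exact: intg_norm.
Qed.

Lemma fsin_bound D f s : measurable D -> intg D f ->
  `|fsin D f s| <= \int[mu]_(y in D) `|f y|.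
Proof.
move=> mD fi; apply: Rintegral_le_norm => //.
- exact: intg_measurable (intg_fsin s mD fi).
- by move=> x _; rewrite normrM ler_piMr// sin_max.
- exact: intg_norm.
Qed.

Lemma fcos_derive D f s : measurable D -> intg D f -> intg D (fun y => y * f y) ->
  is_derive s 1 (fcos D f) (- fsin D (fun y => y * f y) s).
Proof.
move=> mD fi yfi.
have h : is_derive s 1 (fcos D f) (\int[mu]_(y in D) (- 1 * (y * f y * sin (y * s)))).
  apply: (@is_derive_under_integral _ D (fun s y => f y * cos (y * s)) (fun s y => - 1 * (y * f y * sin (y * s)))
    (fun y => `|y * f y|) (s - 1) (s + 1)) => //.
  - by apply/andP; split; lra.
  - by move=> x _; exact: intg_fcos.
  - move=> x y _ _; have := rderivZ (f y) (rderiv_cosl y x).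
    by move/is_derive_eq; apply; ring.
  - by move=> x y _ _; rewrite !normrM normrN1 mul1r ler_piMr ?mulr_ge0// sin_max.
  - exact: intg_norm.
by apply: is_derive_eq h _; rewrite RintegralZl ?mulN1r//; exact: intg_fsin.
Qed.

Lemma fsin_derive D f s : measurable D -> intg D f -> intg D (fun y => y * f y) ->
  is_derive s 1 (fsin D f) (fcos D (fun y => y * f y) s).
Proof.
move=> mD fi yfi.
apply: (@is_derive_under_integral _ D (fun s y => f y * sin (y * s)) (fun s y => y * f y * cos (y * s))
    (fun y => `|y * f y|) (s - 1) (s + 1)) => //.
- by apply/andP; split; lra.
- by move=> x _; exact: intg_fsin.
- move=> x y _ _; have := rderivZ (f y) (rderiv_sinl y x).
  by move/is_derive_eq; apply; ring.
- by move=> x y _ _; rewrite !normrM ler_piMr ?mulr_ge0// cos_max.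
- exact: intg_norm.
Qed.

Lemma fcos_continuous D f : measurable D -> intg D f -> continuous (fcos D f).
Proof.
move=> mD fi s.
have := @continuity_under_integral R _ _ mu (fun s y => f y * cos (y * s)) D mD (s - 1) (s + 1) _ _ (fun y => `|f y|) _ _ s.
apply.
- by move=> x _; exact: intg_fcos.
- apply: aeW => y _ x _; apply: cvgM; first exact: cvg_cst.
  exact: is_derive_continuous (rderiv_cosl y x).
- exact: intg_norm.
- by move=> x _; apply: aeW => y _; rewrite normrM ler_piMr// cos_max.
- by rewrite inE/= in_itv/=; apply/andP; split; lra.
Qed.

Lemma fsin_continuous D f : measurable D -> intg D f -> continuous (fsin D f).
Proof.
move=> mD fi s.
have := @continuity_under_integral R _ _ mu (fun s y => f y * sin (y * s)) D mD (s - 1) (s + 1) _ _ (fun y => `|f y|) _ _ s.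
apply.
- by move=> x _; exact: intg_fsin.
- apply: aeW => y _ x _; apply: cvgM; first exact: cvg_cst.
  exact: is_derive_continuous (rderiv_sinl y x).
- exact: intg_norm.
- by move=> x _; apply: aeW => y _; rewrite normrM ler_piMr// sin_max.
- by rewrite inE/= in_itv/=; apply/andP; split; lra.
Qed.

Lemma intg_restrict D f : measurable D -> intg D f -> intg setT (f \_ D).
Proof.
move=> mD fi; rewrite -restrict_EFin.
exact: ((@integrable_mkcond _ _ _ mu D (EFin \o f) mD).1 fi).
Qed.

Lemma Rintegral_restrictM D f g : \int[mu]_x ((f \_ D) x * g x) = \int[mu]_(x in D) (f x * g x).
Proof.
rewrite [RHS]Rintegral_mkcond; apply: eq_Rintegral => x _.
by rewrite /patch; case: ifPn => // _; rewrite mul0r.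
Qed.

Lemma Fubini_bounded_on D (f g : R -> R) (k : R -> R -> R) : measurable D ->
  intg setT f -> intg D g ->
  measurable_fun setT (fun z : measurableTypeR R * measurableTypeR R => k z.1 z.2) ->
  (forall x y, `|k x y| <= 1) ->
  \int[mu]_x (f x * \int[mu]_(y in D) (g y * k x y)) =
  \int[mu]_(y in D) (g y * \int[mu]_x (f x * k x y)).
Proof.
move=> mD fi gi mk k1.
rewrite -[RHS]Rintegral_restrictM -(Fubini_bounded fi (intg_restrict mD gi) mk k1).
by apply: eq_Rintegral => x _; rewrite Rintegral_restrictM.
Qed.

Let measurable_sub_mul (h : R -> R) x : continuous h ->
  measurable_fun setT (fun z : measurableTypeR R * measurableTypeR R => h (z.2 * (x - z.1))).
Proof.
move=> ch; apply: (@measurableT_comp _ _ _ _ _ _ h).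
  exact: continuous_measurable_fun.
apply: measurable_funM; first exact: measurable_snd.
by apply: measurable_funB => //; exact: measurable_fst.
Qed.

Lemma measurable_mul (h : R -> R) : continuous h ->
  measurable_fun setT (fun z : measurableTypeR R * measurableTypeR R => h (z.2 * z.1)).
Proof.
move=> ch; apply: (@measurableT_comp _ _ _ _ _ _ h).
  exact: continuous_measurable_fun.
by apply: measurable_funM; [exact: measurable_snd|exact: measurable_fst].
Qed.

(* Abel summation of the inversion integral turns it into a Poisson integral. *)
Lemma abel_inversion (u : R -> R) e x : intg setT u -> 0 < e ->
  \int[mu]_(w in Y) (expR (- (e * w)) *
     (fcos setT u w * cos (w * x) + fsin setT u w * sin (w * x))) =
  \int[mu]_y (u y * poisson e (x - y)).
Proof.
move=> ui e0.
have mY : measurable (Y : set R) by exact: measurable_itv.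
have gi : intg Y (fun w : R => expR (- (e * w))).
  have := @intg_powR_exp R 1 e ltr01 e0.
  by under [X in integrable _ _ X]eq_fun do rewrite /= subrr powRr0 mul1r.
transitivity (\int[mu]_(w in Y) (expR (- (e * w)) * \int[mu]_y (u y * cos (w * (x - y))))).
  apply: eq_Rintegral => w _; congr (_ * _).
  rewrite /fcos /fsin -RintegralZr//; last exact: intg_fcos.
  rewrite -RintegralZr//; last exact: intg_fsin.
  rewrite -RintegralD//; last 2 first.
  - have := intgZ (cos (w * x)) measurableT (intg_fcos w measurableT ui).
    by under [X in integrable _ _ X]eq_fun do rewrite /= mulrC.
  - have := intgZ (sin (w * x)) measurableT (intg_fsin w measurableT ui).
    by under [X in integrable _ _ X]eq_fun do rewrite /= mulrC.
  apply: eq_Rintegral => y _; rewrite mulrBr cosB (mulrC y w).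
  by move: (cos (w * x)) (sin (w * x)) (cos (w * y)) (sin (w * y)) => *; ring.
rewrite -(@Fubini_bounded_on Y u _ (fun y w => cos (w * (x - y))))//.
- by apply: eq_Rintegral => y _; rewrite laplace_cos.
- exact: measurable_sub_mul (@continuous_cos R).
- by move=> *; exact: cos_max.
Qed.

Lemma expR_harmonic_cvg (w : R) : expR (- ((n.+1%:R)^-1 * w)) @[n --> \oo] --> (1 : R).
Proof.
have h : expR (- (e * w)) @[e --> (0 : R)] --> expR (- (0 * w)).
  exact: is_derive_continuous (rderiv_expN w 0).
have := cvg_comp _ _ (@cvg_harmonic R) h.
by rewrite mul0r oppr0 expR0.
Qed.

(** The Abel means with e = 1 / (n + 1) have two limits: the inversion integral, by dominated
    convergence in frequency, and pi times [u x], by the Poisson kernel. The limits agree. *)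
Lemma fourier_inversion (u : R -> R) x : intg setT u ->
  intg Y (fcos setT u) -> intg Y (fsin setT u) -> {for x, continuous u} ->
  u x = pi^-1 * (fcos Y (fcos setT u) x + fsin Y (fsin setT u) x).
Proof.
move=> ui Ai Bi cu.
have mY : measurable (Y : set R) by exact: measurable_itv.
have e0 n : 0 < (n.+1%:R : R)^-1 by rewrite invr_gt0.
pose K w := fcos setT u w * cos (w * x) + fsin setT u w * sin (w * x).
have Ki : intg Y K by apply: intgD => //; [exact: intg_fcos|exact: intg_fsin].
have [||||_ h] := @dominated_Rintegral _ Y (fun n w => expR (- ((n.+1%:R)^-1 * w)) * K w) K (fun w => `|K w|) mY.
- move=> n; apply: measurable_funM; last exact: intg_measurable Ki.
  apply: measurable_funTS; apply: continuous_measurable_fun => w.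
  exact: is_derive_continuous (rderiv_expNl _ w).
- move=> w _; rewrite -[X in _ --> X]mul1r; apply: cvgM; last exact: cvg_cst.
  exact: expR_harmonic_cvg.
- move=> n w; rewrite /= in_itv/= andbT => w0; rewrite normrM ler_piMl//.
  rewrite ger0_norm ?expR_ge0// -expR0 ler_expR oppr_le0.
  by rewrite mulr_ge0// ltW.
- exact: intg_norm.
have := poisson_cvg ui cu.
under eq_fun do rewrite -abel_inversion//.
move=> /(cvg_unique _ h) E.
have pi_neq0 : (pi : R) != 0 by rewrite gt_eqF// pi_gt0.
apply: (mulfI pi_neq0); rewrite mulVKf// -E// /K RintegralD//; [exact: intg_fcos|exact: intg_fsin].
Qed.

End trigonometric_transforms.

(** * The Riesz potential as a Fourier multiplier *)

Section riesz_potential.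
Context {R : realType}.
Implicit Types (b e s t x y w : R) (u : R -> R).

(** On [1, 2] the integrand is at least t^(- 1) e^(- 2) >= e^(- 2) / 2. Positivity is needed to
    cancel the normalisation of the Riesz derivative. *)
Lemma Gamma_gt0 b : 0 < b -> 0 < Gamma b.
Proof.
move=> b0; pose c : R := 2^-1 * expR (- 2).
have c0 : 0 < c by rewrite mulr_gt0 ?expR_gt0// invr_gt0.
have mY : measurable (Y : set R) by exact: measurable_itv.
apply: (@lt_le_trans _ _ (\int[mu]_(t in Y) (c * \1_(`[1, 2]%classic : set R) t))).
  have i1 : intg Y (\1_(`[1, 2]%classic : set R)).
    by apply: (@integrableS _ _ _ mu setT) => //; exact: integrable_indic_itv.
  rewrite RintegralZl// mulr_gt0//.
  rewrite /Rintegral integral_indic//= setIidl; last first.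
    by move=> t /=; rewrite !in_itv/= andbT => /andP[t1 _]; rewrite (lt_le_trans _ t1).
  by rewrite lebesgue_measure_itv/= lte_fin ltr1n/=; lra.
apply: le_Rintegral => //.
- apply: intgZ => //; apply: (@integrableS _ _ _ mu setT) => //; exact: integrable_indic_itv.
- have := intg_powR_exp b0 (@ltr01 R).
  by under [X in integrable _ _ X]eq_fun do rewrite /= mul1r.
move=> t; rewrite /= in_itv/= andbT => t0; rewrite indicE mem_setE in_itv/=.
have [/andP[t1 t2]|_] := boolP (1 <= t <= 2); last by rewrite mulr0 mulr_ge0 ?powR_ge0 ?expR_ge0.
rewrite mulr1 ler_pM// ?expR_ge0 ?invr_ge0//; last by rewrite ler_expR lerN2.
apply: (@le_trans _ _ (t `^ (- 1))); last by apply: ler_powR => //; lra.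
by rewrite powR_inv1 ?(ltW t0)// lef_pV2 ?posrE//; lra.
Qed.

(** For t >= 1 the power is at most 1; for t <= 1 the bound on v applies and e^(1 - t) >= 1. The sum
    covers both ranges with functions already known to be integrable. *)
Lemma powR_norm_le (p M v t : R) : p <= 0 -> 0 <= t -> `|v| <= M ->
  `|t `^ p * v| <= `|v| + M * expR 1 * (t `^ p * expR (- (1 * t))).
Proof.
move=> p0 t0 vM; have M0 : 0 <= M by rewrite (le_trans _ vM).
rewrite normrM (ger0_norm (powR_ge0 _ _)) mul1r.
have r0 : 0 <= M * expR 1 * (t `^ p * expR (- t)) by rewrite !mulr_ge0 ?expR_ge0 ?powR_ge0.
have [t1|t1] := leP t 1; last first.
  apply: (@le_trans _ _ `|v|); last by rewrite lerDl.
  by rewrite ler_piMl// -(powRr0 t); apply: ler_powR => //; exact: ltW.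
apply: (@le_trans _ _ (M * expR 1 * (t `^ p * expR (- t)))); last by rewrite lerDr.
rewrite [leRHS](_ : _ = t `^ p * (M * expR (1 - t))); last by rewrite expRD; ring.
rewrite ler_wpM2l ?powR_ge0// (le_trans vM)// ler_peMr// -[leLHS]expR0 ler_expR; lra.
Qed.

(** Boundedness of [f] handles the origin, where b < 1 makes the power integrable; integrability of
    [f] handles infinity. *)
Lemma intg_powR_neg b (f : R -> R) M : 0 < b -> b < 1 -> intg Y f ->
  (forall w, 0 < w -> `|f w| <= M) -> intg Y (fun w => w `^ (- b) * f w).
Proof.
move=> b0 b1 fi fM; have mY : measurable (Y : set R) by exact: measurable_itv.
have h := @intg_powR_exp R (1 - b) 1 _ ltr01.
apply: (@le_intg _ _ _ (fun w => `|f w| + M * expR 1 * (w `^ (1 - b - 1) * expR (- (1 * w))))) => //.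
- apply: measurable_funM; last exact: intg_measurable.
  exact: measurable_funTS (measurable_powR _).
- move=> w; rewrite /= in_itv/= andbT => w0.
  have -> : 1 - b - 1 = - b by ring.
  by apply: powR_norm_le; [lra|exact: ltW|exact: fM].
- apply: intgD => //; first exact: intg_norm.
  by apply: intgZ => //; apply: h; lra.
Qed.

(** The damped Riesz kernel, with b = 2 - gamma, so that b - 1 = 1 - gamma. *)
Let kernel b e t : R := `|t| `^ (b - 1) * expR (- (e * `|t|)).

Let kernelN b e t : kernel b e (- t) = kernel b e t.
Proof. by rewrite /kernel normrN. Qed.

Let kernelY b e t : Y t -> kernel b e t = t `^ (b - 1) * expR (- (e * t)).
Proof. by rewrite /= in_itv/= andbT /kernel => t0; rewrite gtr0_norm. Qed.

Let intg_kernel b e : 0 < b -> 0 < e -> intg setT (kernel b e).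
Proof.
move=> b0 e0; apply: intg_even; last exact: kernelN.
apply: (@eq_integrable _ _ _ mu _ _ (EFin \o (fun t => t `^ (b - 1) * expR (- (e * t))))).
- exact: measurable_itv.
- by move=> t /set_mem Yt /=; rewrite kernelY.
- exact: intg_powR_exp.
Qed.

Let kernel_cos_even b e w : 0 < b -> 0 < e ->
  \int[mu]_t (kernel b e t * cos (t * w)) = 2 * mellinC b e w.
Proof.
move=> b0 e0; rewrite Rintegral_even.
- congr (_ * _); apply: eq_Rintegral => t /set_mem Yt.
  by rewrite kernelY// (mulrC t w).
- exact: intg_fcos (intg_kernel b0 e0).
- by move=> t; rewrite kernelN mulNr cosN.
Qed.

Let kernel_sin_odd b e w : 0 < b -> 0 < e ->
  \int[mu]_t (kernel b e t * sin (t * w)) = 0.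
Proof.
move=> b0 e0; apply: Rintegral_odd.
- exact: intg_fsin (intg_kernel b0 e0).
- by move=> t; rewrite kernelN mulNr sinN mulrN.
Qed.

(** Convolution with an even kernel has the cosines as eigenfunctions: after the reflection s to x -
    s, the sine part of the addition formula integrates to 0. *)
Let kernel_cos b e w x : 0 < b -> 0 < e ->
  \int[mu]_s (kernel b e (x - s) * cos (w * s)) = 2 * mellinC b e w * cos (w * x).
Proof.
move=> b0 e0; have ki := intg_kernel b0 e0.
have ci := intg_fcos w measurableT ki; have si := intg_fsin w measurableT ki.
pose f t := cos (w * x) * (kernel b e t * cos (t * w)) + sin (w * x) * (kernel b e t * sin (t * w)).
have fi : intg setT f by apply: intgD => //; apply: intgZ.
transitivity (\int[mu]_s f (x - s)).
  apply: eq_Rintegral => s _; rewrite /f.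
  have -> : cos (w * s) = cos (w * x - (x - s) * w) by congr cos; ring.
  by rewrite cosB; ring.
rewrite Rintegral_reflect// RintegralD//; [|exact: intgZ|exact: intgZ].
by rewrite !RintegralZl// kernel_cos_even// kernel_sin_odd//; ring.
Qed.

Let kernel_sin b e w x : 0 < b -> 0 < e ->
  \int[mu]_s (kernel b e (x - s) * sin (w * s)) = 2 * mellinC b e w * sin (w * x).
Proof.
move=> b0 e0; have ki := intg_kernel b0 e0.
have ci := intg_fcos w measurableT ki; have si := intg_fsin w measurableT ki.
pose f t := sin (w * x) * (kernel b e t * cos (t * w)) - cos (w * x) * (kernel b e t * sin (t * w)).
have fi : intg setT f by apply: intgB => //; apply: intgZ.
transitivity (\int[mu]_s f (x - s)).
  apply: eq_Rintegral => s _; rewrite /f.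
  have -> : sin (w * s) = sin (w * x - (x - s) * w) by congr sin; ring.
  by rewrite sinB; ring.
rewrite Rintegral_reflect// RintegralB//; [|exact: intgZ|exact: intgZ].
by rewrite !RintegralZl// kernel_cos_even// kernel_sin_odd//; ring.
Qed.

(** The damped kernel is integrable, so Fubini may be applied to its product with the inversion
    formula of [u]; each cosine and sine is then an eigenfunction. *)
Let regularized b e x (u A B : R -> R) : 0 < b -> 0 < e -> intg Y A -> intg Y B ->
  (forall s, u s = pi^-1 * (fcos Y A s + fsin Y B s)) ->
  \int[mu]_s (kernel b e (x - s) * u s) =
  2 * pi^-1 * \int[mu]_(w in Y) (mellinC b e w * (A w * cos (w * x) + B w * sin (w * x))).
Proof.
move=> b0 e0 Ai Bi uE.
have mY : measurable (Y : set R) by exact: measurable_itv.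
have ki := intg_reflect x (intg_kernel b0 e0).
have kAi : intg setT (fun s => kernel b e (x - s) * fcos Y A s).
  apply: (@intgM_bounded _ _ _ _ (\int[mu]_(y in Y) `|A y|)) => //.
    exact: continuous_measurable_fun (fcos_continuous mY Ai).
  by move=> s _; exact: fcos_bound.
have kBi : intg setT (fun s => kernel b e (x - s) * fsin Y B s).
  apply: (@intgM_bounded _ _ _ _ (\int[mu]_(y in Y) `|B y|)) => //.
    exact: continuous_measurable_fun (fsin_continuous mY Bi).
  by move=> s _; exact: fsin_bound.
transitivity (\int[mu]_s (pi^-1 * (kernel b e (x - s) * fcos Y A s + kernel b e (x - s) * fsin Y B s))).
  by apply: eq_Rintegral => s _; rewrite uE mulrCA mulrDr.
rewrite RintegralZl ?RintegralD//; last exact: intgD.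
rewrite (@Fubini_bounded_on _ Y _ A (fun s w => cos (w * s)))//; last 2 first.
- exact: measurable_mul (@continuous_cos R).
- by move=> *; exact: cos_max.
rewrite (@Fubini_bounded_on _ Y _ B (fun s w => sin (w * s)))//; last 2 first.
- exact: measurable_mul (@continuous_sin R).
- by move=> *; exact: sin_max.
under eq_Rintegral do rewrite kernel_cos//.
under [X in _ + X]eq_Rintegral do rewrite kernel_sin//.
have mm : measurable_fun (Y : set R) (mellinC b e).
  apply: measurable_funTS; apply: continuous_measurable_fun => s.
  exact: is_derive_continuous (mellinC_derive s b0 e0).
(* A cosine transform of a nonnegative function is largest at frequency 0. *)
have mb w : Y w -> `|mellinC b e w| <= Gamma b * e `^ (- b).
  move=> _; rewrite -mellinC0// /mellinC.
  apply: Rintegral_le_norm => //.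
  - have := intg_fcos w mY (intg_powR_exp b0 e0) => /intg_measurable.
    by under [X in measurable_fun _ X -> _]eq_fun do rewrite mulrC (mulrC _ w) mulrC.
  - move=> y _; rewrite mul0r cos0 mulr1 !normrM (ger0_norm (powR_ge0 _ _)) (ger0_norm (expR_ge0 _)).
    by rewrite ler_piMr ?mulr_ge0 ?powR_ge0 ?expR_ge0// cos_max.
  - have := intg_powR_exp b0 e0.
    by under [X in _ -> integrable _ _ X]eq_fun do rewrite /= mul0r cos0 mulr1.
have i1 : intg Y (fun w => A w * cos (w * x) * mellinC b e w).
  by apply: (@intgM_bounded _ _ _ _ (Gamma b * e `^ (- b))) => //; exact: intg_fcos.
have i2 : intg Y (fun w => B w * sin (w * x) * mellinC b e w).
  by apply: (@intgM_bounded _ _ _ _ (Gamma b * e `^ (- b))) => //; exact: intg_fsin.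
transitivity (pi^-1 * (2 * \int[mu]_(w in Y) (A w * cos (w * x) * mellinC b e w) +
   2 * \int[mu]_(w in Y) (B w * sin (w * x) * mellinC b e w))).
  congr (_ * (_ + _)); rewrite -RintegralZl//; apply: eq_Rintegral => w _; ring.
rewrite -mulrDr -RintegralD// mulrA (mulrC _ 2); congr (_ * _).
by apply: eq_Rintegral => w _; ring.
Qed.

Lemma intg_riesz b x u M : 0 < b -> b < 1 -> intg setT u -> (forall s, `|u s| <= M) ->
  intg setT (fun s => `|x - s| `^ (b - 1) * u s).
Proof.
move=> b0 b1 ui uM.
apply: (@le_intg _ _ _ (fun s => `|u s| + M * expR 1 * kernel b 1 (x - s))) => //.
- apply: measurable_funM; last exact: intg_measurable.
  apply: (measurableT_comp (measurable_powR _)).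
  by apply: measurableT_comp => //; apply: measurable_funB.
- by move=> s _; apply: powR_norm_le => //; lra.
- apply: intgD => //; first exact: intg_norm.
  by apply: intgZ => //; apply: intg_reflect; exact: intg_kernel.
Qed.

(** Both sides of the damped identity converge along e = 1 / (n + 1): the left one is dominated by
    the undamped integrand, the right one through [mellinC_bound]. *)
Lemma riesz_fourier b x M (u A B : R -> R) : 0 < b -> b < 1 ->
  intg setT u -> (forall s, `|u s| <= M) ->
  intg Y A -> intg Y B -> (forall w, 0 < w -> `|A w| <= M) ->
  (forall w, 0 < w -> `|B w| <= M) ->
  (forall s, u s = pi^-1 * (fcos Y A s + fsin Y B s)) ->
  \int[mu]_s (`|x - s| `^ (b - 1) * u s) =
  2 * pi^-1 * (Gamma b * cos (b * (pi / 2))) *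
  (fcos Y (fun w => w `^ (- b) * A w) x + fsin Y (fun w => w `^ (- b) * B w) x).
Proof.
move=> b0 b1 ui uM Ai Bi AM BM uE.
have mY : measurable (Y : set R) by exact: measurable_itv.
have e0 n : 0 < (n.+1%:R : R)^-1 by rewrite invr_gt0.
have ri := intg_riesz x b0 b1 ui uM.
have bAi := intg_powR_neg b0 b1 Ai AM.
have bBi := intg_powR_neg b0 b1 Bi BM.
have [||||_ lhs] := @dominated_Rintegral _ setT (fun n s => kernel b (n.+1%:R)^-1 (x - s) * u s)
   (fun s => `|x - s| `^ (b - 1) * u s) (fun s => `| `|x - s| `^ (b - 1) * u s |) measurableT.
- move=> n; apply: measurable_funM; last exact: intg_measurable.
  exact: intg_measurable (intg_reflect x (intg_kernel b0 (e0 n))).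
- move=> s _; apply: cvgM; last exact: cvg_cst.
  rewrite -[X in _ --> X]mulr1; apply: cvgM; first exact: cvg_cst.
  exact: expR_harmonic_cvg.
- move=> n s _; rewrite /kernel !normrM ler_wpM2r// ler_piMr// (ger0_norm (expR_ge0 _)).
  by rewrite expR_le1 oppr_le0 mulr_ge0// ltW.
- exact: intg_norm.
pose K w := A w * cos (w * x) + B w * sin (w * x).
have wKi : intg Y (fun w => w `^ (- b) * K w).
  have := intgD mY (intg_fcos x mY bAi) (intg_fsin x mY bBi).
  by under [X in integrable _ _ X -> _]eq_fun do rewrite /= -2!mulrA -mulrDr.
have Ki : intg Y K by apply: intgD => //; [exact: intg_fcos|exact: intg_fsin].
have [||||_ rhs] := @dominated_Rintegral _ Y (fun n w => mellinC b (n.+1%:R)^-1 w * K w)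
   (fun w => Gamma b * cos (b * (pi / 2)) * (w `^ (- b) * K w)) (fun w => Gamma b * `|w `^ (- b) * K w|) mY.
- move=> n; apply: measurable_funM; last exact: intg_measurable.
  apply: measurable_funTS; apply: continuous_measurable_fun => s.
  exact: is_derive_continuous (mellinC_derive s b0 (e0 n)).
- move=> w; rewrite /= in_itv/= andbT => w0.
  rewrite mulrA; apply: cvgM; last exact: cvg_cst.
  exact: mellinC_cvg.
- move=> n w; rewrite /= in_itv/= andbT => w0.
  rewrite !normrM mulrA ler_wpM2r// (ger0_norm (powR_ge0 _ _)).
  exact: mellinC_bound.
- by apply: intgZ => //; exact: intg_norm.
have h : \int[mu]_s (kernel b (n.+1%:R)^-1 (x - s) * u s) @[n --> \oo] -->
   2 * pi^-1 * \int[mu]_(w in Y) (Gamma b * cos (b * (pi / 2)) * (w `^ (- b) * K w)).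
  under eq_fun do rewrite (regularized x b0 (e0 _) Ai Bi uE).
  by apply: cvgM; [exact: cvg_cst|exact: rhs].
rewrite (cvg_unique _ lhs h)// RintegralZl// -[RHS]mulrA; congr (_ * (_ * _)).
rewrite /fcos /fsin -RintegralD//; [|exact: intg_fcos|exact: intg_fsin].
by apply: eq_Rintegral => w _; rewrite /K; ring.
Qed.

End riesz_potential.

(** * Cosine series *)

Section bessel.
Context {R : realType}.
Variables (a b : R).
Implicit Types (f g k : R -> R).

Let I : set R := `[a, b]%classic.

(** A class stable under products and contained in L^1, so that inner products make sense.
    Continuity would be too strong: the difference quotient expanded later need not be continuous
    where its denominator vanishes. *)
Definition bounded_measurable f :=
  measurable_fun I f /\ exists M : R, forall x, I x -> `|f x| <= M.

Lemma bmD f g : bounded_measurable f -> bounded_measurable g ->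
  bounded_measurable (fun x => f x + g x).
Proof.
move=> [mf [M fM]] [mg [N gN]]; split; first exact: measurable_funD.
by exists (M + N) => x Ix; rewrite (le_trans (ler_normD _ _))// lerD// ?fM// gN.
Qed.

Lemma bmM f g : bounded_measurable f -> bounded_measurable g ->
  bounded_measurable (fun x => f x * g x).
Proof.
move=> [mf [M fM]] [mg [N gN]]; split; first exact: measurable_funM.
by exists (M * N) => x Ix; rewrite normrM ler_pM// ?fM// gN.
Qed.

Lemma bm_cst c : bounded_measurable (fun=> c).
Proof. by split; [exact: measurable_cst|exists `|c|]. Qed.

Lemma bmZ c f : bounded_measurable f -> bounded_measurable (fun x => c * f x).
Proof. exact: bmM (bm_cst c). Qed.

Lemma bm_intg f : bounded_measurable f -> intg I f.
Proof.
move=> [mf [M fM]]; apply: (@le_intg _ _ _ (fun=> M)) => //; first exact: measurable_itv.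
apply: continuous_compact_integrable; first exact: segment_compact.
by apply: continuous_subspaceT => x; exact: cvg_cst.
Qed.

Lemma continuous_bm f : continuous f -> bounded_measurable f.
Proof.
move=> cf; split; first by apply: measurable_funTS; exact: continuous_measurable_fun.
have [ab|ab] := leP a b; last first.
  by exists 0 => x; rewrite /I /= in_itv/= => /andP[ax xb]; move: (le_trans ax xb); rewrite leNgt ab.
have cnf : {within `[a, b], continuous (fun x => `|f x|)}.
  by apply: continuous_subspaceT => x; apply: cvg_norm; exact: cf.
have [c _ hc] := EVT_max ab cnf.
by exists `|f c| => x; exact: hc.
Qed.

(** Induction on [N] for all [k] at once: subtracting the projection of [k] on [e N] keeps the
    coefficients of index below [N] and lowers the squared norm by c_N^2 / kappa. *)
Lemma bessel_inequality (e : nat -> R -> R) (kappa : R) : 0 < kappa ->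
  (forall n, bounded_measurable (e n)) ->
  (forall n m, \int[mu]_(x in I) (e n x * e m x) = if n == m then kappa else 0) ->
  forall N k, bounded_measurable k ->
  \sum_(n < N) (\int[mu]_(x in I) (k x * e n x)) ^+ 2 <=
  kappa * \int[mu]_(x in I) (k x * k x).
Proof.
move=> kappa0 be ortho; elim=> [|N IH] k bk.
  rewrite big_ord0 mulr_ge0 ?(ltW kappa0)//.
  by apply: Rintegral_ge0 => x _; rewrite -expr2 sqr_ge0.
have mI : measurable I by exact: measurable_itv.
pose c n := \int[mu]_(x in I) (k x * e n x).
pose d := - (c N / kappa).
pose k' x := k x + d * e N x.
have bk' : bounded_measurable k' by apply: bmD => //; exact: bmZ.
have ck' n : \int[mu]_(x in I) (k' x * e n x) = c n + d * (if N == n then kappa else 0).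
  rewrite -ortho -RintegralZl//; last by apply: bm_intg; exact: bmM.
  rewrite -RintegralD//; first last.
  - by apply: bm_intg; apply: bmZ; exact: bmM.
  - by apply: bm_intg; exact: bmM.
  by apply: eq_Rintegral => x _; rewrite mulrDl mulrA.
have ekk' : \int[mu]_(x in I) (k x * k' x) = \int[mu]_(x in I) (k x * k x) + d * c N.
  rewrite -RintegralZl//; last by apply: bm_intg; exact: bmM.
  rewrite -RintegralD//; first last.
  - by apply: bm_intg; apply: bmZ; exact: bmM.
  - by apply: bm_intg; exact: bmM.
  by apply: eq_Rintegral => x _; rewrite /k'; ring.
have k'k' : \int[mu]_(x in I) (k' x * k' x) = \int[mu]_(x in I) (k x * k x) + d * c N.
  transitivity (\int[mu]_(x in I) (k x * k' x) + d * \int[mu]_(x in I) (k' x * e N x)).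
    rewrite -RintegralZl//; last by apply: bm_intg; exact: bmM.
    rewrite -RintegralD//; first last.
    - by apply: bm_intg; apply: bmZ; exact: bmM.
    - by apply: bm_intg; exact: bmM.
    by apply: eq_Rintegral => x _; rewrite /k'; ring.
  rewrite ekk' ck' eqxx /d; field; exact: lt0r_neq0.
rewrite big_ord_recr/=.
have := IH k' bk'; rewrite k'k'.
rewrite (eq_bigr (fun n : 'I_N => (\int[mu]_(x in I) (k x * e n x)) ^+ 2)); last first.
  by move=> n _; rewrite ck' gtn_eqF// mulr0 addr0.
rewrite -/(c N) => h.
rewrite -lerBrDr (le_trans h)// mulrDr lerD2l le_eqVlt; apply/orP; left; apply/eqP.
rewrite /d; field; exact: lt0r_neq0.
Qed.

(** Together with Bessel's inequality this plays the part of the Riemann-Lebesgue lemma. *)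
Lemma bounded_sum_sqr_cvg0 (c : nat -> R) M :
  (forall N, \sum_(n < N) c n ^+ 2 <= M) -> c n @[n --> \oo] --> 0.
Proof.
move=> cM.
have cs : cvgn (series (fun n => c n ^+ 2)).
  apply: nondecreasing_is_cvgn.
    apply/nondecreasing_seqP => n; rewrite -subr_ge0 seriesSB sqr_ge0//.
  by exists M => _ [n _ <-]; rewrite /series/= big_mkord.
have := cvg_series_cvg_0 cs => c20.
apply/cvgrPdist_lt => e e0.
have e20 : 0 < e ^+ 2 by rewrite exprn_gt0.
have /cvgrPdist_lt/(_ _ e20) := c20.
apply: filterS => n /=; rewrite !sub0r !normrN normrX => h.
by rewrite -(@ltr_pXn2r _ 2)// nnegrE// ltW.
Qed.

End bessel.

Section trigonometric_integrals.
Context {R : realType}.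

Lemma Rintegral_FTC (F f : R -> R) a b : a < b ->
  (forall x : R, is_derive x 1 F (f x)) -> continuous f ->
  \int[mu]_(x in `[a, b]) f x = F b - F a.
Proof.
move=> ab dF cf.
have cF : continuous F by move=> x; exact: is_derive_continuous (dF x).
rewrite /Rintegral (@continuous_FTC2 _ f F)//.
- exact: continuous_subspaceT.
- split.
  + by move=> x _; case: (dF x).
  + by apply: cvg_at_right_filter; exact: cF.
  + by apply: cvg_at_left_filter; exact: cF.
- by move=> x _; rewrite derive1E; case: (dF x).
Qed.

Lemma sin_natr_pi n : sin (n%:R * pi) = 0 :> R.
Proof.
elim: n => [|n IH]; first by rewrite mul0r sin0.
by rewrite -natr1 mulrDl mul1r sinDpi IH oppr0.
Qed.

Let cos_shift_continuous (k c : R) : continuous (fun t => cos (k * (t - c))).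
Proof.
move=> t; apply: (@continuous_cvg _ _ _ _ _ (fun t => k * (t - c)) cos); first exact: continuous_cos.
by apply: cvgM; [exact: cvg_cst|apply: cvgB; [exact: cvg_id|exact: cvg_cst]].
Qed.

Lemma Rintegral_cos_shift (k c a b : R) : a < b -> k != 0 ->
  \int[mu]_(t in `[a, b]) cos (k * (t - c)) = k^-1 * (sin (k * (b - c)) - sin (k * (a - c))).
Proof.
move=> ab k0.
rewrite mulrBr; apply: (@Rintegral_FTC (fun t => k^-1 * sin (k * (t - c)))) => //.
move=> t; have d : is_derive t 1 (fun t => k * (t - c)) k.
  rewrite -[X in is_derive _ _ _ X]mulr1; apply: rderivZ.
  have := rderivD (is_derive_id t (1 : R)) (is_derive_cst (- c) t (1 : R)).
  by rewrite addr0.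
have := rderivZ k^-1 (@rderiv_comp R _ sin t _ _ (is_derive_sin _) d).
by move/is_derive_eq; apply; rewrite mulrCA mulVf// mulr1.
Qed.

Lemma Rintegral_cos_period (k c : R) : k != 0 -> sin (k * pi) = 0 ->
  \int[mu]_(t in `[- pi, pi]) cos (k * (t - c)) = 0.
Proof.
move=> k0 kpi; rewrite Rintegral_cos_shift//; last by have := @pi_gt0 R; lra.
by rewrite (mulrBr k pi) (mulrBr k (- pi)) mulrN !sinB sinN cosN kpi; ring.
Qed.

End trigonometric_integrals.

(** The inverse is x (x^2)^(- 1), a product with a measurable real power; at 0 both sides are 0 by
    convention. *)
Lemma measurable_inv {R : realType} : measurable_fun setT (fun x : R => x^-1).
Proof.
have -> : (fun x : R => x^-1) = (fun x => x * (x ^+ 2) `^ (- 1)).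
  apply/funext => x; rewrite powR_inv1 ?sqr_ge0//.
  have [->|x0] := eqVneq x 0; first by rewrite invr0 mul0r.
  by field.
apply: measurable_funM => //.
by apply: (measurableT_comp (measurable_powR _)); exact: exprn_measurable.
Qed.

(** * Pointwise and absolute convergence of cosine series *)

Section fourier_series.
Context {R : realType}.
Implicit Types (g : R -> R) (t c : R).

Local Notation I := (`[- pi, pi]%classic).

(** Normalised by 2 pi for every [m], like the complex Fourier coefficients; hence the factor 2 on
    the terms of positive index in the series. *)
Definition cos_coef g (m : nat) : R := (2 * pi)^-1 * \int[mu]_(t in I) (g t * cos (m%:R * t)).

Let Npi : - pi < pi :> R.
Proof. by have := @pi_gt0 R; lra. Qed.

Let bm_cos (k c a b : R) : bounded_measurable a b (fun t => cos (k * (t - c))).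
Proof.
split; last by exists 1 => t _; exact: cos_max.
apply: measurable_funTS; apply: continuous_measurable_fun => t.
apply: (@continuous_cvg _ _ _ _ _ (fun t => k * (t - c)) cos); first exact: continuous_cos.
by apply: cvgM; [exact: cvg_cst|apply: cvgB; [exact: cvg_id|exact: cvg_cst]].
Qed.

Let bm_sin (k c a b : R) : bounded_measurable a b (fun t => sin (k * (t - c))).
Proof.
split; last by exists 1 => t _; exact: sin_max.
apply: measurable_funTS; apply: continuous_measurable_fun => t.
apply: (@continuous_cvg _ _ _ _ _ (fun t => k * (t - c)) sin); first exact: continuous_sin.
by apply: cvgM; [exact: cvg_cst|apply: cvgB; [exact: cvg_id|exact: cvg_cst]].
Qed.

Let Rintegral_1 : \int[mu]_(t in I) (1 : R) = 2 * pi.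
Proof.
rewrite Rintegral_cst; last exact: measurable_itv.
have := lebesgue_measure_itv (`[- pi, pi] : interval R); rewrite /= lte_fin Npi => ->.
by rewrite /=; lra.
Qed.

Let sinM (x y : R) : sin x * sin y = 2^-1 * (cos (x - y) - cos (x + y)).
Proof. by rewrite cosB cosD; field. Qed.

Let half_odd (n : nat) : R := n%:R + 2^-1.

(** Half-odd frequencies have integer sums and differences, so the two resulting cosines have period
    2 pi; the sum n + m + 1 never vanishes. *)
Let ortho_half_odd c n m :
  \int[mu]_(t in I) (sin (half_odd n * (t - c)) * sin (half_odd m * (t - c))) =
  if n == m then pi else 0.
Proof.
have E t : sin (half_odd n * (t - c)) * sin (half_odd m * (t - c)) =
  2^-1 * (cos ((n%:R - m%:R) * (t - c)) - cos ((n + m).+1%:R * (t - c))).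
  rewrite sinM -mulrBl -mulrDl /half_odd; congr (_ * (cos (_ * _) - cos (_ * _))); first by ring.
  by rewrite -[(n + m).+1]addn1 !natrD; field.
under eq_Rintegral do rewrite E.
have mI : measurable (I : set R) by exact: measurable_itv.
have i1 k := bm_intg (bm_cos k c (- pi) pi).
rewrite RintegralZl//; last by apply: intgB.
rewrite RintegralB// [X in _ - X]Rintegral_cos_period ?pnatr_eq0 ?sin_natr_pi//.
rewrite subr0; have [->|nm] := eqVneq n m.
  under eq_Rintegral do rewrite subrr mul0r cos0.
  by rewrite Rintegral_1; field.
rewrite Rintegral_cos_period ?mulr0//.
  by rewrite subr_eq0 eqr_nat.
by rewrite mulrBl sinB !sin_natr_pi mulr0 mul0r subrr.
Qed.

Let dirichlet (N : nat) (t : R) : R := 1 + \sum_(m < N) (2 * cos (m.+1%:R * t)).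

Let dirichletE N t : dirichlet N t * sin (t / 2) = sin (half_odd N * t).
Proof.
rewrite /dirichlet; elim: N => [|N IH].
  by rewrite big_ord0 addr0 mul1r /half_odd add0r mulrC.
rewrite big_ord_recr/= addrA mulrDl IH.
have -> : half_odd N.+1 * t = N.+1%:R * t + t / 2 by rewrite /half_odd; field.
have -> : half_odd N * t = N.+1%:R * t - t / 2 by rewrite /half_odd -natr1; field.
by rewrite sinB sinD; ring.
Qed.

Let Rintegral_odd_I (f : R -> R) : intg I f -> (forall t, f (- t) = - f t) ->
  \int[mu]_(t in I) f t = 0.
Proof.
move=> fi fN; rewrite Rintegral_mkcond; apply: Rintegral_odd.
  by apply: intg_restrict => //; exact: measurable_itv.
move=> t; rewrite /patch !mem_setE !in_itv/=.
have -> : (- pi <= - t <= pi) = (- pi <= t <= pi).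
  by apply/idP/idP => /andP[? ?]; apply/andP; split; lra.
by case: ifPn => _; rewrite ?fN// oppr0.
Qed.

Let Rintegral_even_I (f : R -> R) : intg I f -> (forall t, f (- t) = f t) ->
  \int[mu]_(t in I) f t = 2 * \int[mu]_(t in `[0, pi]) f t.
Proof.
move=> fi fN; have mI : measurable (I : set R) by exact: measurable_itv.
rewrite Rintegral_mkcond Rintegral_even.
- congr (_ * _); rewrite -Rintegral_mkcondr.
  have -> : Y `&` I = `]0, pi]%classic :> set R.
    apply/seteqP; split => t /=; rewrite !in_itv/= ?andbT.
      by move=> [-> /andP[_ ->]].
    by move=> /andP[t0 tp]; split=> //; apply/andP; split=> //; lra.
  rewrite Rintegral_itv_obnd_cbnd//; apply: (@integrableS _ _ _ mu I) fi => //.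
  by move=> t /=; rewrite !in_itv/= => /andP[t0 tp]; apply/andP; split=> //; lra.
- exact: intg_restrict.
move=> t; rewrite /patch !mem_setE !in_itv/=.
have -> : (- pi <= - t <= pi) = (- pi <= t <= pi).
  by apply/idP/idP => /andP[? ?]; apply/andP; split; lra.
by case: ifPn => _; rewrite ?fN.
Qed.

(* The difference quotient [(g t - g c) / sin ((t - c) / 2)] is bounded, and
   twice [pi] times the error of the partial sum is its [N]-th coefficient for the
   orthogonal system [sin ((N + 1/2) (t - c))]. *)
Lemma cos_series_cvg g (L : R) c : continuous g -> (forall t, g (- t) = g t) ->
  (forall t x, `|g t - g x| <= L * `|sin ((t - x) / 2)|) ->
  cos_coef g 0 + \sum_(m < N) (2 * cos_coef g m.+1 * cos (m.+1%:R * c)) @[N --> \oo] --> g c.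
Proof.
move=> cg gN gL.
have mI : measurable (I : set R) by exact: measurable_itv.
have bg : bounded_measurable (- pi) pi g by exact: continuous_bm.
have bgc : bounded_measurable (- pi) pi (fun t => g t - g c).
  by apply: bmD => //; exact: bm_cst.
pose k t := (g t - g c) / sin ((t - c) / 2).
(* Read off at the points pi and 0, where the sine is 1. *)
have L0 : 0 <= L.
  have := gL pi 0; rewrite subr0 sin_pihalf normr1 mulr1; exact: le_trans.
have bk : bounded_measurable (- pi) pi k.
  split.
    apply: measurable_funM; first exact: (proj1 bgc).
    apply: (measurableT_comp measurable_inv).
    have := proj1 (bm_sin 2^-1 c (- pi) pi).
    by under [X in measurable_fun _ X -> _]eq_fun do rewrite mulrC.
  exists L => t _; rewrite /k normrM normfV.
  have [->|s0] := eqVneq (sin ((t - c) / 2)) 0; first by rewrite normr0 invr0 mulr0.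
  by rewrite ler_pdivrMr ?normr_gt0.
pose T N := \int[mu]_(t in I) (k t * sin (half_odd N * (t - c))).
have coefE m : \int[mu]_(t in I) (g t * cos (m%:R * (t - c))) = 2 * pi * (cos_coef g m * cos (m%:R * c)).
  have bc : bounded_measurable (- pi) pi (fun t => cos (m%:R * t)).
    by have := bm_cos m%:R 0 (- pi) pi; under eq_fun do rewrite subr0.
  have bs : bounded_measurable (- pi) pi (fun t => sin (m%:R * t)).
    by have := bm_sin m%:R 0 (- pi) pi; under eq_fun do rewrite subr0.
  transitivity (\int[mu]_(t in I) (cos (m%:R * c) * (g t * cos (m%:R * t)) + sin (m%:R * c) * (g t * sin (m%:R * t)))).
    by apply: eq_Rintegral => t _; rewrite mulrBr cosB; ring.
  have ic : intg I (fun t => g t * cos (m%:R * t)) by apply: bm_intg; exact: bmM.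
  have is_ : intg I (fun t => g t * sin (m%:R * t)) by apply: bm_intg; exact: bmM.
  rewrite RintegralD//; [|exact: intgZ|exact: intgZ].
  rewrite !RintegralZl// (Rintegral_odd_I is_); last by move=> t; rewrite gN mulrN sinN mulrN.
  rewrite mulr0 addr0 /cos_coef mulrA mulrA divff ?mul1r 1?mulrC//.
  by rewrite mulf_neq0// gt_eqF// pi_gt0.
have TE N : T N = 2 * pi * (cos_coef g 0 + \sum_(m < N) (2 * cos_coef g m.+1 * cos (m.+1%:R * c)) - g c).
  transitivity (\int[mu]_(t in I) ((g t - g c) * dirichlet N (t - c))).
    apply: eq_Rintegral => t _; rewrite -dirichletE /k mulrA mulrAC.
    (* Where the sine vanishes [k t] is 0 by the convention for inverses, and the Lipschitz bound
       forces [g t = g c], so the identity persists. *)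
    have [s0|s0] := eqVneq (sin ((t - c) / 2)) 0; last by rewrite mulfVK// mulrC.
    have := gL t c; rewrite s0 normr0 mulr0 normr_le0 => /eqP ->.
    by rewrite !mul0r.
  have bd M : bounded_measurable (- pi) pi (fun t => dirichlet M (t - c)).
    elim: M => [|M IH]; rewrite /dirichlet.
      by under eq_fun do rewrite big_ord0; exact: bm_cst.
    under eq_fun do rewrite big_ord_recr/= addrA.
    by apply: bmD => //; apply: bmZ; exact: bm_cos.
  elim: N => [|N IH].
    rewrite /dirichlet big_ord0 addr0.
    under eq_Rintegral do rewrite big_ord0 addr0 mulr1.
    rewrite RintegralB//; [|exact: bm_intg|by apply: bm_intg; exact: bm_cst].
    have -> : \int[mu]_(t in I) g c = g c * (2 * pi).
      by rewrite -Rintegral_1 -RintegralZl ?mulr1//; apply: bm_intg; exact: bm_cst.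
    have := coefE 0%N; under eq_Rintegral do rewrite mul0r cos0 mulr1.
    by move=> ->; rewrite mul0r cos0 mulr1 mulrBr (mulrC (g c)).
  transitivity (\int[mu]_(t in I) ((g t - g c) * dirichlet N (t - c)) +
     2 * (\int[mu]_(t in I) (g t * cos (N.+1%:R * (t - c))) - g c * \int[mu]_(t in I) cos (N.+1%:R * (t - c)))).
    have bcN := bm_cos N.+1%:R c (- pi) pi.
    rewrite -RintegralZl//; last exact: bm_intg.
    rewrite -RintegralB//; first last.
    - by apply: bm_intg; exact: bmZ.
    - by apply: bm_intg; exact: bmM.
    rewrite -RintegralZl//; last first.
      apply: intgB => //; first by apply: bm_intg; exact: bmM.
      by apply: bm_intg; exact: bmZ.
    rewrite -RintegralD//; first last.
    - apply: intgZ => //; apply: intgB => //; first by apply: bm_intg; exact: bmM.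
      by apply: bm_intg; exact: bmZ.
    - by apply: bm_intg; exact: bmM.
    by apply: eq_Rintegral => t _; rewrite /dirichlet big_ord_recr/=; ring.
  rewrite IH Rintegral_cos_period ?pnatr_eq0 ?sin_natr_pi// mulr0 subr0 coefE big_ord_recr/=.
  by ring.
have T0 : T N @[N --> \oo] --> 0.
  apply: (@bounded_sum_sqr_cvg0 _ _ (pi * \int[mu]_(t in I) (k t * k t))) => N.
  have := @bessel_inequality R (- pi) pi (fun n t => sin (half_odd n * (t - c))) pi (@pi_gt0 R) _ _ N k bk.
  apply; first by move=> n; exact: bm_sin.
  by move=> n m; exact: ortho_half_odd.
have pi0 : (2 * pi : R) != 0 by rewrite mulf_neq0// gt_eqF// pi_gt0.
rewrite (_ : (fun N => _) = (fun N => (2 * pi)^-1 * T N + g c)); last first.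
  by apply/funext => N; rewrite TE mulKf// subrK.
rewrite -[X in _ --> X]add0r -[X in _ --> X + _](mulr0 (2 * pi)^-1).
by apply: cvgD; [apply: cvgM; [exact: cvg_cst|exact: T0]|exact: cvg_cst].
Qed.

Let ortho_sin n m :
  \int[mu]_(t in `[0, pi]) (sin (n.+1%:R * t) * sin (m.+1%:R * t)) =
  if n == m then pi / 2 else (0 : R).
Proof.
have E t : sin (n.+1%:R * t) * sin (m.+1%:R * t) =
  2^-1 * (cos ((n%:R - m%:R) * (t - 0)) - cos ((n + m).+2%:R * (t - 0))).
  rewrite sinM subr0 -mulrBl -mulrDl; congr (_ * (cos (_ * _) - cos (_ * _))).
    by rewrite -!(natr1 n, natr1 m); ring.
  by rewrite -natrD addSn addnS.
under eq_Rintegral do rewrite E.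
have mI : measurable (`[0, pi]%classic : set R) by exact: measurable_itv.
have i1 k := bm_intg (bm_cos k 0 0 pi).
rewrite RintegralZl//; last by apply: intgB.
have C k : k != 0 -> sin (k * pi) = 0 -> \int[mu]_(t in `[0, pi]) cos (k * (t - 0)) = 0.
  by move=> k0 kpi; rewrite Rintegral_cos_shift ?pi_gt0// !subr0 mulr0 sin0 kpi subrr mulr0.
rewrite RintegralB// [X in _ - X]C ?pnatr_eq0 ?sin_natr_pi//.
rewrite subr0; have [->|nm] := eqVneq n m.
  under eq_Rintegral do rewrite subrr mul0r cos0.
  rewrite Rintegral_cst//.
  have := lebesgue_measure_itv (`[0, pi] : interval R); rewrite /= lte_fin pi_gt0 => ->.
  by rewrite /=; field.
rewrite C ?mulr0//.
  by rewrite subr_eq0 eqr_nat.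
by rewrite mulrBl sinB !sin_natr_pi mulr0 mul0r subrr.
Qed.

(** Telescoping: 1 / (x + 1)^2 <= 1 / x - 1 / (x + 1). The subtracted term carries the induction. *)
Let sum_inv_sqr N : \sum_(m < N.+1) (m.+1%:R ^+ 2)^-1 <= 2 - (N.+1%:R)^-1 :> R.
Proof.
elim: N => [|N IH]; first by rewrite big_ord1 expr1n invr1; lra.
rewrite big_ord_recr/= (le_trans (lerD IH (lexx _)))//.
have -> : N.+2%:R = N.+1%:R + 1 :> R by rewrite natr1.
have : 0 < N.+1%:R :> R by [].
move: (N.+1%:R : R) => x x0.
have x1 : 0 < x + 1 by lra.
have -> : 2 - x^-1 + ((x + 1) ^+ 2)^-1 = 2 - (x + 1)^-1 - ((x + 1) ^+ 2 * x)^-1.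
  by field; rewrite (gt_eqF x0) gt_eqF.
by rewrite gerBl invr_ge0 mulr_ge0 ?sqr_ge0// ltW.
Qed.

(* Integration by parts turns [m * cos_coef g m] into a sine coefficient of [g'],
   and these are square summable. *)
Lemma cos_coef_summable g g' : continuous g -> (forall t, g (- t) = g t) ->
  (forall t : R, 0 < t < pi -> is_derive t 1 g (g' t)) -> continuous g' ->
  exists C, forall N, \sum_(m < N) `|cos_coef g m| <= C.
Proof.
move=> cg gN dg cg'.
have mJ : measurable (`[0, pi]%classic : set R) by exact: measurable_itv.
have bg' : bounded_measurable 0 pi g' by exact: continuous_bm.
pose c m := \int[mu]_(t in `[0, pi]) (g' t * sin (m.+1%:R * t)).
pose B := pi / 2 * \int[mu]_(t in `[0, pi]) (g' t * g' t).
have cB N : \sum_(m < N) c m ^+ 2 <= B.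
  have := @bessel_inequality R 0 pi (fun n t => sin (n.+1%:R * t)) (pi / 2) _ _ _ N g' bg'.
  apply; first by rewrite divr_gt0// pi_gt0.
  - by move=> n; have := bm_sin n.+1%:R 0 0 pi; under eq_fun do rewrite subr0.
  - by move=> n m; exact: ortho_sin.
have coefE m : cos_coef g m.+1 = - (pi^-1 * (c m / m.+1%:R)).
  have m0 : m.+1%:R != 0 :> R by rewrite pnatr_eq0.
  rewrite /cos_coef Rintegral_even_I; first last.
  - by move=> t; rewrite gN mulrN cosN.
  - apply: bm_intg; apply: bmM; first exact: continuous_bm.
    by have := bm_cos m.+1%:R 0 (- pi) pi; under eq_fun do rewrite subr0.
  rewrite (@Rintegration_by_parts _ g (fun t => m.+1%:R^-1 * sin (m.+1%:R * t)) g' (fun t => cos (m.+1%:R * t))).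
  - rewrite mulr0 sin0 mulr0 mulr0 subr0 sin_natr_pi mulr0 mulr0 sub0r.
    have -> : \int[mu]_(x in `[0, pi]) (g' x * (m.+1%:R^-1 * sin (m.+1%:R * x))) = m.+1%:R^-1 * c m.
      rewrite -RintegralZl//; first by apply: eq_Rintegral => t _; rewrite mulrCA.
      apply: bm_intg; apply: bmM => //.
      by have := bm_sin m.+1%:R 0 0 pi; under eq_fun do rewrite subr0.
    have pi0 : (pi : R) != 0 by rewrite gt_eqF// pi_gt0.
    move: pi0 m0; move: (pi : R) (m.+1%:R : R) (c m) => p q r p0 q0.
    by field; rewrite p0 q0.
  - exact: pi_gt0.
  - exact: continuous_subspaceT.
  - split; first by move=> t; rewrite in_itv/= => /dg[].
    + by apply: cvg_at_right_filter; exact: cg.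
    + by apply: cvg_at_left_filter; exact: cg.
  - by move=> t; rewrite in_itv/= derive1E => /dg[].
  - by apply: continuous_subspaceT => t; exact: is_derive_continuous (rderiv_cosl _ t).
  - have d t : is_derive t 1 (fun t => m.+1%:R^-1 * sin (m.+1%:R * t)) (cos (m.+1%:R * t)).
      have := rderivZ m.+1%:R^-1 (rderiv_sinl m.+1%:R t).
      by move/is_derive_eq; apply; rewrite mulrCA mulVf// mulr1.
    split; first by move=> t _; case: (d t).
    + by apply: cvg_at_right_filter; exact: is_derive_continuous (d _).
    + by apply: cvg_at_left_filter; exact: is_derive_continuous (d _).
  - move=> t _; rewrite derive1E.
    have := rderivZ m.+1%:R^-1 (rderiv_sinl m.+1%:R t) => -[_ ->].
    by rewrite mulrCA mulVf// mulr1.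
exists (`|cos_coef g 0| + (B + 2)) => -[|N].
  rewrite big_ord0 addr_ge0// addr_ge0//; have := cB 0%N; by rewrite big_ord0.
rewrite big_ord_recl/= lerD2l.
(* From 1 / pi <= 1 and a b <= a^2 + b^2: two square-summable sequences have a summable product. *)
have h m : `|cos_coef g m.+1| <= c m ^+ 2 + (m.+1%:R ^+ 2)^-1.
  rewrite coefE normrN normrM normfV (ger0_norm (pi_ge0 R)).
  have x0 : 0 <= (m.+1%:R : R)^-1 by rewrite invr_ge0.
  rewrite normrM (ger0_norm x0) -exprVn.
  move: (m.+1%:R^-1 : R) x0 => x x0.
  rewrite (@le_trans _ _ (`|c m| * x))//.
    by rewrite ler_piMl ?mulr_ge0// invf_le1 ?pi_gt0//; have := @pi_ge2 R; lra.
  rewrite -(@real_normK _ (c m)) ?num_real//.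
  have := sqr_ge0 (`|c m| - x); rewrite sqrrB.
  have := sqr_ge0 (`|c m|); have := sqr_ge0 x; lra.
apply: (@le_trans _ _ (\sum_(m < N) (c m ^+ 2 + (m.+1%:R ^+ 2)^-1))); first exact: ler_sum.
rewrite big_split/= lerD//; first exact: cB.
case: N => [|N]; first by rewrite big_ord0.
by rewrite (le_trans (sum_inv_sqr N))// gerBl invr_ge0.
Qed.

End fourier_series.

(** * The symbol of the difference operator *)

Section powers_of_norm.
Context {R : realType}.
Implicit Types (p t x y : R).

Lemma abs_powR_continuous p : 0 < p -> continuous (fun x : R => `|x| `^ p).
Proof.
move=> p0 x; have [->|x0] := eqVneq x 0; last first.
  have nx0 : 0 < `|x| by rewrite normr_gt0.
  apply: (@continuous_cvg _ _ _ _ _ (fun x => `|x|) (fun t => t `^ p)).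
    exact: is_derive_continuous (is_derive1_powR p nx0).
  exact: norm_continuous.
rewrite /continuous_at normr0 powR0 ?gt_eqF//.
apply/cvgrPdist_lt => e e0; near=> y.
rewrite sub0r normrN ger0_norm ?powR_ge0//.
have ye : `|y| < e `^ p^-1.
  near: y; exists (e `^ p^-1); first exact: powR_gt0.
  by move=> z /=; rewrite sub0r normrN.
have -> : e = (e `^ p^-1) `^ p by rewrite -powRrM mulVf ?gt_eqF// powRr1// ltW.
by apply: gt0_ltr_powR => //; rewrite nnegrE ?powR_ge0.
Unshelve. all: by end_near. Qed.

Lemma is_derive_abs_powR p x : 0 < x ->
  is_derive x 1 (fun x : R => `|x| `^ p) (p * `|x| `^ (p - 1)).
Proof.
move=> x0; rewrite (gtr0_norm x0).
apply: (near_eq_is_derive _ (is_derive1_powR p x0)).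
by near=> y; rewrite gtr0_norm//; near: y; exact: lt_nbhsr.
Unshelve. all: by end_near. Qed.

Lemma powR_lipschitz p x y : 1 <= p -> 0 <= x <= 2 -> 0 <= y <= 2 ->
  `|x `^ p - y `^ p| <= p * 2 `^ (p - 1) * `|x - y|.
Proof.
move=> p1; wlog xy : x y / x < y => [H|] xI yI.
  have [xy|yx|->] := ltgtP x y; first exact: H.
  - by rewrite distrC [X in _ * X]distrC; exact: H.
  - by rewrite !subrr normr0 mulr0.
have [x0 x2] := andP xI; have [y0 y2] := andP yI.
(* The absolute value makes the function continuous on the whole line, whatever the real power
   returns at negative arguments. *)
have c0 : {within `[x, y], continuous (fun x : R => `|x| `^ p)}.
  by apply: continuous_subspaceT => t; apply: abs_powR_continuous; lra.
have d t : t \in `]x, y[ -> is_derive t 1 (fun x : R => `|x| `^ p) (p * `|t| `^ (p - 1)).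
  by rewrite in_itv/= => /andP[xt _]; apply: is_derive_abs_powR; exact: le_lt_trans xt.
have [c] := MVT xy d c0; rewrite in_itv/= => /andP[xc cy].
have cp : 0 <= c by lra.
rewrite (ger0_norm x0) (ger0_norm y0) (ger0_norm cp) distrC => ->.
rewrite normrM ger0_norm ?mulr_ge0 ?powR_ge0//; last by lra.
rewrite (distrC x) ler_wpM2r// ler_wpM2l//; first by lra.
by apply: ge0_ler_powR; rewrite ?nnegrE; lra.
Qed.

End powers_of_norm.

Section symbol.
Context {R : realType}.
Implicit Types (gamma t x : R).

(** The real value of [G gamma (expi t)], with 2 - w - w^(- 1) replaced by 4 sin(t / 2)^2 as in
    [symbol_base_expi]. *)
Definition symbol gamma t : R :=
  (4 * sin (t / 2) ^+ 2) `^ (gamma / 2) *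
  (1 + gamma / 24 * (4 * sin (t / 2) ^+ 2)
     + gamma * (5 * gamma + 22) / 5760 * (4 * sin (t / 2) ^+ 2) ^+ 2).

Lemma symbolN gamma t : symbol gamma (- t) = symbol gamma t.
Proof. by rewrite /symbol !mulNr sinN !sqrrN. Qed.

Lemma symbol_norm gamma t (r := `|2 * sin (t / 2)|) : symbol gamma t =
  r `^ gamma * (1 + gamma / 24 * r ^+ 2 + gamma * (5 * gamma + 22) / 5760 * r ^+ 4).
Proof.
have r0 : 0 <= r by exact: normr_ge0.
have rr : 4 * sin (t / 2) ^+ 2 = r ^+ 2.
  by rewrite /r real_normK ?num_real// exprMn; congr (_ * _); rewrite expr2; lra.
rewrite /symbol rr -(powR_mulrn 2 r0) -powRrM.
have -> : 2 * (gamma / 2) = gamma by field.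
by rewrite (powR_mulrn 2 r0) -exprM.
Qed.

(** Pure powers of |2 sin(t / 2)|: continuity, Lipschitz bounds and derivatives can be treated one
    exponent at a time. *)
Lemma symbolE gamma t : 0 < gamma -> symbol gamma t =
  `|2 * sin (t / 2)| `^ gamma + gamma / 24 * `|2 * sin (t / 2)| `^ (gamma + 2) +
  gamma * (5 * gamma + 22) / 5760 * `|2 * sin (t / 2)| `^ (gamma + 4).
Proof.
move=> g0; rewrite symbol_norm; set r := `|_|; have r0 : 0 <= r by exact: normr_ge0.
have gn (k : R) : 0 < k -> (gamma + k == 0) ==> (r != 0).
  by move=> k0; rewrite (_ : (_ == 0) = false)//; apply/negbTE; rewrite gt_eqF//; lra.
rewrite (@powRD _ r gamma 2) ?gn// (@powRD _ r gamma 4) ?gn//.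
by rewrite (powR_mulrn 4 r0) (powR_mulrn 2 r0); ring.
Qed.

(** The modulus is |sin((t - x) / 2)| because the convergence proof divides by that sine. It comes
    from |sin u| - |sin v| <= |sin(u - v)|, an instance of the addition formula, and from the
    Lipschitz bound for powers on [0, 2], the range of |2 sin|. *)
Lemma symbol_lipschitz gamma : 1 < gamma ->
  exists L, forall t x, `|symbol gamma t - symbol gamma x| <= L * `|sin ((t - x) / 2)|.
Proof.
move=> g1; have g0 : 0 < gamma by lra.
pose c1 := gamma / 24.
have c10 : 0 <= c1 by rewrite divr_ge0//; lra.
pose c2 := gamma * (5 * gamma + 22) / 5760.
have c20 : 0 <= c2.
  apply: mulr_ge0; last by rewrite invr_ge0 ler0n.
  by apply: mulr_ge0; lra.
pose K p : R := p * 2 `^ (p - 1).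
pose L := K gamma + c1 * K (gamma + 2) + c2 * K (gamma + 4).
have K0 p : 1 <= p -> 0 <= K p by move=> p1; rewrite mulr_ge0 ?powR_ge0//; lra.
have L0 : 0 <= L.
  by rewrite !addr_ge0//; [apply: K0; lra|rewrite mulr_ge0// K0//; lra|rewrite mulr_ge0// K0//; lra].
exists (L * 2) => t x; rewrite !symbolE// -/c1 -/c2.
set a := `|2 * sin (t / 2)|; set b := `|2 * sin (x / 2)|.
have bnd (s : R) : 0 <= `|2 * sin s| <= 2.
  by rewrite normr_ge0/= normrM ger0_norm// ler_piMr// sin_max.
have aI : 0 <= a <= 2 by exact: bnd.
have bI : 0 <= b <= 2 by exact: bnd.
have ab : `|a - b| <= 2 * `|sin ((t - x) / 2)|.
  have -> : a - b = 2 * (`|sin (t / 2)| - `|sin (x / 2)|).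
    by rewrite /a /b !normrM ger0_norm//; ring.
  rewrite normrM ger0_norm// ler_wpM2l//.
  have key (u v : R) : `|sin u| - `|sin v| <= `|sin (u - v)|.
    rewrite lerBlDr -[X in `|sin X| <= _](subrK v u) (sinD (u - v) v).
    by rewrite (le_trans (ler_normD _ _))// !normrM lerD// ?ler_piMr ?ler_piMl ?cos_max.
  have E : (t - x) / 2 = t / 2 - x / 2 by field.
  rewrite E ler_norml; apply/andP; split; last exact: key.
  by have := key (x / 2) (t / 2); rewrite -(opprB (t / 2) (x / 2)) sinN normrN; lra.
have H p : 1 <= p -> `|a `^ p - b `^ p| <= K p * (2 * `|sin ((t - x) / 2)|).
  move=> p1; apply: (le_trans (powR_lipschitz p1 aI bI)).
  by rewrite ler_wpM2l// K0.
rewrite [X in `|X|](_ : _ = (a `^ gamma - b `^ gamma) + c1 * (a `^ (gamma + 2) - b `^ (gamma + 2))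
  + c2 * (a `^ (gamma + 4) - b `^ (gamma + 4))); last by ring.
rewrite [leRHS](_ : _ = K gamma * (2 * `|sin ((t - x) / 2)|)
  + c1 * (K (gamma + 2) * (2 * `|sin ((t - x) / 2)|))
  + c2 * (K (gamma + 4) * (2 * `|sin ((t - x) / 2)|))); last by rewrite /L; ring.
rewrite (le_trans (ler_normD _ _))// lerD//; last first.
  by rewrite normrM ger0_norm// ler_wpM2l// H//; lra.
rewrite (le_trans (ler_normD _ _))// lerD//; first by apply: H; lra.
by rewrite normrM ger0_norm// ler_wpM2l// H//; lra.
Qed.

Let continuous_half_sin : continuous (fun t : R => 2 * sin (t / 2)).
Proof.
move=> t; apply: cvgM; first exact: cvg_cst.
exact: is_derive_continuous (rderiv_sin 2^-1 t).
Qed.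

Let continuous_abs_half_sin p : 0 < p -> continuous (fun t : R => `|2 * sin (t / 2)| `^ p).
Proof.
move=> p0 t; apply: (@continuous_cvg _ _ _ _ _ (fun t => 2 * sin (t / 2)) (fun x => `|x| `^ p)).
  exact: abs_powR_continuous.
exact: continuous_half_sin.
Qed.

Lemma symbol_continuous gamma : 0 < gamma -> continuous (symbol gamma).
Proof.
move=> g0; rewrite (_ : symbol gamma = (fun t => `|2 * sin (t / 2)| `^ gamma + gamma / 24 * `|2 * sin (t / 2)| `^ (gamma + 2) +
  gamma * (5 * gamma + 22) / 5760 * `|2 * sin (t / 2)| `^ (gamma + 4))); last first.
  by apply/funext => t; rewrite symbolE.
move=> t; apply: cvgD; [apply: cvgD|]; last 2 first.
- by apply: cvgM; [exact: cvg_cst|apply: continuous_abs_half_sin; lra].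
- by apply: cvgM; [exact: cvg_cst|apply: continuous_abs_half_sin; lra].
- exact: continuous_abs_half_sin.
Qed.

(** All exponents exceed 1, so the formula for [g'] is continuous on the whole line; it is claimed
    as the derivative on the open interval, where 2 sin(t / 2) is positive. *)
Lemma symbol_derive gamma : 1 < gamma -> exists2 g' : R -> R, continuous g' &
  forall t, 0 < t < pi -> is_derive t 1 (symbol gamma) (g' t).
Proof.
move=> g1; have g0 : 0 < gamma by lra.
pose P p t := p * `|2 * sin (t / 2)| `^ (p - 1) * (2 * (cos (t / 2) * 2^-1)).
have cP p : 1 < p -> continuous (P p).
  move=> p1 t; apply: cvgM.
    by apply: cvgM; [exact: cvg_cst|apply: continuous_abs_half_sin; lra].
  apply: cvgM; first exact: cvg_cst.
  by apply: cvgM; [exact: is_derive_continuous (rderiv_cos 2^-1 t)|exact: cvg_cst].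
exists (fun t => P gamma t + gamma / 24 * P (gamma + 2) t +
  gamma * (5 * gamma + 22) / 5760 * P (gamma + 4) t).
  move=> t; apply: cvgD; [apply: cvgD|]; last 2 first.
  - by apply: cvgM; [exact: cvg_cst|apply: cP; lra].
  - by apply: cvgM; [exact: cvg_cst|apply: cP; lra].
  - exact: cP.
move=> t /andP[t0 tpi].
have s0 : 0 < 2 * sin (t / 2).
  by rewrite mulr_gt0// sin_gt0_pi//; apply/andP; split; lra.
have dP p : is_derive t 1 (fun t => `|2 * sin (t / 2)| `^ p) (P p t).
  exact: (@rderiv_comp R (fun t => 2 * sin (t / 2)) (fun x => `|x| `^ p) t _ _
    (is_derive_abs_powR p s0) (rderivZ 2 (rderiv_sin 2^-1 t))).
rewrite (_ : symbol gamma = (fun t => `|2 * sin (t / 2)| `^ gamma + gamma / 24 * `|2 * sin (t / 2)| `^ (gamma + 2) +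
  gamma * (5 * gamma + 22) / 5760 * `|2 * sin (t / 2)| `^ (gamma + 4))); last first.
  by apply/funext => x; rewrite symbolE.
exact: (rderivD (rderivD (dP _) (rderivZ _ (dP _))) (rderivZ _ (dP _))).
Qed.

End symbol.

(** * Taylor expansion of the symbol at the origin *)

Section symbol_expansion.
Context {R : realType}.
Implicit Types (gamma t v x : R).

(** The mean value theorem in place of integration: the division by n + 1 is given up, and the
    constant [M] stays the same through iterations. *)
Let mean_le (F f : R -> R) (c M : R) n : 0 <= M -> F 0 = 0 ->
  (forall x : R, 0 <= x <= c -> is_derive x 1 F (f x)) ->
  (forall x, 0 <= x <= c -> `|f x| <= M * x ^+ n) ->
  forall x, 0 <= x <= c -> `|F x| <= M * x ^+ n.+1.
Proof.
move=> M0 F0 dF fM x /andP[x0 xc].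
have inI (y : R) : y \in `[0, x] -> 0 <= y <= c.
  by rewrite in_itv/= => /andP[y0 yx]; rewrite y0 (le_trans yx).
have cF : {within `[0, x], continuous F}.
  apply: continuous_in_subspaceT => y; rewrite inE => /inI yI.
  exact: is_derive_continuous (dF y yI).
have dF' (y : R) : y \in `]0, x[ -> is_derive y 1 F (f y).
  by rewrite in_itv/= => /andP[y0 yx]; apply: dF; apply/andP; split; lra.
have [y yI] := MVT_segment x0 dF' cF.
rewrite F0 !subr0 => ->.
move: (yI); rewrite in_itv/= => /andP[y0 yx].
rewrite normrM (ger0_norm x0) exprSr mulrA ler_wpM2r// (le_trans (fM y (inI y yI)))//.
by rewrite ler_wpM2l// lerXn2r.
Qed.

Let dXn n x : is_derive x 1 (fun x : R => x ^+ n.+1) (n.+1%:R * x ^+ n).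
Proof.
elim: n => [|n IH].
  under eq_fun do rewrite expr1; rewrite expr0 mulr1; exact: is_derive_id.
have := rderivM (is_derive_id x (1 : R)) IH.
under [X in is_derive _ _ X]eq_fun do rewrite -exprS.
have -> : n.+2%:R = n.+1%:R + 1 :> R by rewrite natr1.
by move/is_derive_eq; apply; rewrite exprS; ring.
Qed.

(** Starting from |cos| <= 1, [mean_le] is applied seven times, alternately to remainders of the
    sine and of the cosine, each being up to sign an antiderivative of the preceding one. *)
Lemma sin_taylor v : 0 <= v <= 1 ->
  `|sin v - (v - v ^+ 3 / 6 + v ^+ 5 / 120)| <= v ^+ 7.
Proof.
move=> vI; rewrite -[leRHS]mul1r.
have dX n (a x : R) : is_derive x 1 (fun x => a * x ^+ n.+1) (a * (n.+1%:R * x ^+ n)) by exact: rderivZ.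
have h1 : forall x : R, 0 <= x <= 1 -> `|sin x| <= 1 * x ^+ 1.
  apply: (@mean_le _ cos) => //; first exact: sin0.
  by move=> y _; rewrite expr0 mulr1; exact: cos_max.
have h2 : forall x : R, 0 <= x <= 1 -> `|cos x - 1| <= 1 * x ^+ 2.
  apply: (@mean_le _ (fun x => - sin x)) => //; first by rewrite cos0 subrr.
    by move=> y _; have := rderivD (is_derive_cos y) (is_derive_cst (- 1 : R) y (1 : R)); rewrite addr0.
  by move=> y yI; rewrite normrN; exact: h1.
have h3 : forall x : R, 0 <= x <= 1 -> `|sin x + (- 1) * x ^+ 1| <= 1 * x ^+ 3.
  apply: (@mean_le _ (fun x => cos x - 1)) => //; first by rewrite sin0 mulr0 addr0.
  move=> y _; have := rderivD (is_derive_sin y) (dX 0%N (-1) y).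
  by move/is_derive_eq; apply; rewrite expr0; ring.
have h4 : forall x : R, 0 <= x <= 1 -> `|cos x + (2^-1 * x ^+ 2 + - 1)| <= 1 * x ^+ 4.
  apply: (@mean_le _ (fun x => - (sin x + (- 1) * x ^+ 1))) => //; first by rewrite cos0 expr0n/=; ring.
    move=> y _; have := rderivD (is_derive_cos y) (rderivD (dX 1%N 2^-1 y) (is_derive_cst (- 1 : R) y (1 : R))).
    by move/is_derive_eq; apply; field.
  by move=> y yI; rewrite normrN; exact: h3.
have h5 : forall x : R, 0 <= x <= 1 -> `|sin x + (6^-1 * x ^+ 3 + - 1 * x ^+ 1)| <= 1 * x ^+ 5.
  apply: (@mean_le _ (fun x => cos x + (2^-1 * x ^+ 2 + - 1))) => //.
    by rewrite sin0 !expr0n/=; ring.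
  move=> y _; have := rderivD (is_derive_sin y) (rderivD (dX 2%N 6^-1 y) (dX 0%N (-1) y)).
  by move/is_derive_eq; apply; rewrite expr0; field.
have h6 : forall x : R, 0 <= x <= 1 -> `|cos x + ((- 24^-1) * x ^+ 4 + (2^-1 * x ^+ 2 + - 1))| <= 1 * x ^+ 6.
  apply: (@mean_le _ (fun x => - (sin x + (6^-1 * x ^+ 3 + - 1 * x ^+ 1)))) => //.
    by rewrite cos0 !expr0n/=; ring.
    move=> y _; have := rderivD (is_derive_cos y) (rderivD (dX 3%N (- 24^-1) y) (rderivD (dX 1%N 2^-1 y) (is_derive_cst (- 1 : R) y (1 : R)))).
    by move/is_derive_eq; apply; field.
  by move=> y yI; rewrite normrN; exact: h5.
have h7 : forall x : R, 0 <= x <= 1 -> `|sin x + ((- 120^-1) * x ^+ 5 + (6^-1 * x ^+ 3 + - 1 * x ^+ 1))| <= 1 * x ^+ 7.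
  apply: (@mean_le _ (fun x => cos x + ((- 24^-1) * x ^+ 4 + (2^-1 * x ^+ 2 + - 1)))) => //.
    by rewrite sin0 !expr0n/=; ring.
  move=> y _; have := rderivD (is_derive_sin y) (rderivD (dX 4%N (- 120^-1) y) (rderivD (dX 2%N 6^-1 y) (dX 0%N (-1) y))).
  by move/is_derive_eq; apply; rewrite expr0; field.
have := h7 v vI; rewrite [X in `|X| <= _ -> _](_ : _ = sin v - (v - v ^+ 3 / 6 + v ^+ 5 / 120))//; by field.
Qed.

(** Three applications of [mean_le] from the third derivative c3 (1 - x)^(gamma - 3), where
    [gamma <= 2] makes [c3] nonnegative. The exponent is negative, so the largest value on [0, 1/2]
    is attained at 1/2, which gives [M]. *)
Lemma powR_taylor gamma : 1 < gamma -> gamma <= 2 -> exists2 M, 0 <= M &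
  forall x, 0 <= x <= 2^-1 ->
  `|(1 - x) `^ gamma - (1 - gamma * x + gamma * (gamma - 1) / 2 * x ^+ 2)| <= M * x ^+ 3.
Proof.
move=> g1 g2; pose c3 := gamma * (gamma - 1) * (2 - gamma).
have c30 : 0 <= c3 by rewrite !mulr_ge0//; lra.
pose M := c3 * 2^-1 `^ (gamma - 3).
have M0 : 0 <= M by rewrite mulr_ge0// powR_ge0.
exists M => // x0 x0I.
have dpow p (x : R) : 0 <= x <= 2^-1 -> is_derive x 1 (fun x => (1 - x) `^ p) (- (p * (1 - x) `^ (p - 1))).
  move=> /andP[xge0 xle]; have x1 : 0 < 1 - x by lra.
  have d : is_derive x 1 (fun x : R => 1 - x) (- 1).
    have := rderivD (is_derive_cst (1 : R) x (1 : R)) (is_deriveNid x (1 : R)).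
    by rewrite add0r.
  have := @rderiv_comp R (fun x => 1 - x) (fun x => x `^ p) x _ _ (is_derive1_powR p x1) d.
  by rewrite mulrN1.
have dX n (a x : R) : is_derive x 1 (fun x => a * x ^+ n.+1) (a * (n.+1%:R * x ^+ n)) by exact: rderivZ.
have p1 p : (1 - 0) `^ p = 1 :> R by rewrite subr0 powR1.
pose a2 := gamma * (gamma - 1).
have h1 : forall x : R, 0 <= x <= 2^-1 -> `|a2 * (1 - x) `^ (gamma - 1 - 1) + - a2| <= M * x ^+ 1.
  apply: (@mean_le _ (fun x => c3 * (1 - x) `^ (gamma - 1 - 1 - 1))).
  - exact: M0.
  - by rewrite p1; ring.
  - move=> y yI; have := rderivD (rderivZ a2 (dpow (gamma - 1 - 1) y yI)) (is_derive_cst (- a2) y (1 : R)).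
    by move/is_derive_eq; apply; rewrite /a2 /c3; ring.
  - move=> y /andP[y0 y1]; rewrite expr0 mulr1 ger0_norm; last by rewrite mulr_ge0// powR_ge0.
    rewrite /M ler_wpM2l//; have -> : gamma - 1 - 1 - 1 = - (3 - gamma) by ring.
    have -> : gamma - 3 = - (3 - gamma) by ring.
    rewrite !powRN lef_pV2 ?posrE ?powR_gt0//; last by lra.
    by apply: ge0_ler_powR; rewrite ?nnegrE; lra.
have h2 : forall x : R, 0 <= x <= 2^-1 -> `|(- gamma) * (1 - x) `^ (gamma - 1) + (- a2 * x ^+ 1 + gamma)| <= M * x ^+ 2.
  apply: (@mean_le _ (fun x => a2 * (1 - x) `^ (gamma - 1 - 1) + - a2)).
  - exact: M0.
  - by rewrite p1; ring.
  - move=> y yI; have := rderivD (rderivZ (- gamma) (dpow (gamma - 1) y yI)) (rderivD (dX 0%N (- a2) y) (is_derive_cst gamma y (1 : R))).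
    by move/is_derive_eq; apply; rewrite /a2 expr0; ring.
  - exact: h1.
have h3 : forall x : R, 0 <= x <= 2^-1 -> `|(1 - x) `^ gamma + ((- (a2 / 2)) * x ^+ 2 + (gamma * x ^+ 1 + - 1))| <= M * x ^+ 3.
  apply: (@mean_le _ (fun x => (- gamma) * (1 - x) `^ (gamma - 1) + (- a2 * x ^+ 1 + gamma))).
  - exact: M0.
  - by rewrite p1 !expr0n/=; ring.
  - move=> y yI; have := rderivD (dpow gamma y yI) (rderivD (dX 1%N (- (a2 / 2)) y) (rderivD (dX 0%N gamma y) (is_derive_cst (- 1 : R) y (1 : R)))).
    by move/is_derive_eq; apply; rewrite /a2 expr0; field.
  - exact: h2.
have := h3 x0 x0I.
rewrite [X in `|X| <= _ -> _](_ : _ = (1 - x0) `^ gamma - (1 - gamma * x0 + gamma * (gamma - 1) / 2 * x0 ^+ 2))//.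
by rewrite /a2; field.
Qed.

(** Replaces O-notation: remainders are written as explicit power of v times a function in this
    class, which is closed under ring operations. *)
Let bnd (f : R -> R) := exists C, forall v, 0 < v <= 2^-1 -> `|f v| <= C.

Let bndD f g : bnd f -> bnd g -> bnd (fun v => f v + g v).
Proof.
move=> [C fC] [D gD]; exists (C + D) => v vI.
by rewrite (le_trans (ler_normD _ _))// lerD// ?fC// gD.
Qed.

Let bndM f g : bnd f -> bnd g -> bnd (fun v => f v * g v).
Proof.
move=> [C fC] [D gD]; exists (C * D) => v vI.
by rewrite normrM ler_pM// ?fC// gD.
Qed.

Let bndN f : bnd f -> bnd (fun v => - f v).
Proof. by move=> [C fC]; exists C => v vI; rewrite normrN fC. Qed.

Let bnd_cst c : bnd (fun=> c).
Proof. by exists `|c|. Qed.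

Let bndX f n : bnd f -> bnd (fun v => f v ^+ n).
Proof.
move=> bf; elim: n => [|n IH]; first exact: bnd_cst.
by under eq_fun do rewrite exprS; exact: bndM.
Qed.

Let bnd_id : bnd id.
Proof. by exists 2^-1 => v /andP[v0 v1]; rewrite gtr0_norm. Qed.

(** With v = t / 2 the symbol is t^gamma times the product of (sin v / v)^gamma and the bracket.
    Both factors are expanded up to v^6 with exact remainders, so that the cancellation becomes a
    polynomial identity. *)
Let symbol_near0 gamma : 1 < gamma -> gamma <= 2 -> exists C, forall t, 0 < t <= 1 ->
  `|symbol gamma t - t `^ gamma| <= C * t `^ (6 + gamma).
Proof.
move=> g1 g2; have g0 : 0 < gamma by lra.
have [M M0 hM] := powR_taylor g1 g2.
pose e v := (sin v - (v - v ^+ 3 / 6 + v ^+ 5 / 120)) / v ^+ 7.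
have be : bnd e.
  exists 1 => v /andP[v0 v1]; have v7 : 0 < v ^+ 7 by rewrite exprn_gt0.
  rewrite normrM normfV (gtr0_norm v7) ler_pdivrMr// mul1r.
  by apply: sin_taylor; apply/andP; split; lra.
pose y v := 6^-1 - v ^+ 2 / 120 - v ^+ 4 * e v.
pose x v := v ^+ 2 * y v.
pose f v := ((1 - x v) `^ gamma - (1 - gamma * x v + gamma * (gamma - 1) / 2 * x v ^+ 2)) / x v ^+ 3.
have qE v : 0 < v <= 2^-1 -> sin v / v = 1 - x v.
  by move=> /andP[v0 _]; rewrite /x /y /e; field; rewrite gt_eqF.
(* Keeps [x v] in the range of [powR_taylor]; with v^2 <= 1/4 the Taylor bounds for the sine reduce
   it to polynomial inequalities in v^2. *)
have xI v : 0 < v <= 2^-1 -> 0 <= x v <= 2^-1.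
  move=> vI; have /andP[v0 v1] := vI.
  have -> : x v = 1 - sin v / v by rewrite qE//; ring.
  have v01 : 0 <= v <= 1 by apply/andP; split; lra.
  have := sin_taylor v01; rewrite ler_norml => /andP[lo hi].
  have b2 : v ^+ 2 <= 4^-1.
    have -> : 4^-1 = (2^-1) ^+ 2 :> R by field.
    by rewrite lerXn2r// nnegrE; lra.
  have v20 : 0 <= v ^+ 2 by exact: sqr_ge0.
  have v3 : v ^+ 3 = v ^+ 2 * v by rewrite exprSr.
  have v5 : v ^+ 5 = v ^+ 2 * v ^+ 2 * v by rewrite -exprD -exprSr.
  have v7 : v ^+ 7 = v ^+ 2 * v ^+ 2 * v ^+ 2 * v by rewrite -!exprD -exprSr.
  rewrite v3 v5 v7 in lo hi.
  move: (v ^+ 2) b2 v20 lo hi => w b2 w0 lo hi.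
  rewrite subr_ge0 ler_pdivrMr// mul1r; apply/andP; split.
    have : 0 <= v * w * (6^-1 - w / 120 - w * w).
      rewrite mulr_ge0 ?mulr_ge0 ?(ltW v0)//; nra.
    lra.
  rewrite lerBlDr -lerBlDl ler_pdivlMr//.
  have : 0 <= v * (2^-1 - w / 6 - w * w * w).
    rewrite mulr_ge0 ?(ltW v0)//; nra.
  have : 0 <= v * (w * w) by rewrite !mulr_ge0// ltW.
  lra.
have bf : bnd f.
  exists M => v vI; have := hM _ (xI v vI); have [x0 _] := andP (xI v vI).
  have [xv0|xv0] := eqVneq (x v) 0.
    by move=> _; rewrite /f xv0 !expr0n/= invr0 mulr0 normr0.
  move=> h; have x3 : 0 < x v ^+ 3 by rewrite exprn_gt0// lt0r xv0.
  by rewrite normrM normfV (gtr0_norm x3) ler_pdivrMr.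
(* If [x v] is 0, the quotient [f v] is 0 by convention and both sides equal 1. *)
have fE v : 0 < v <= 2^-1 -> (1 - x v) `^ gamma =
    1 - gamma * x v + gamma * (gamma - 1) / 2 * x v ^+ 2 + x v ^+ 3 * f v.
  move=> vI; have [xv0|xv0] := eqVneq (x v) 0.
    by rewrite xv0 subr0 powR1 !expr0n/=; ring.
  by rewrite /f; field.
have by_ : bnd y.
  apply: bndD; first apply: bndD; first exact: bnd_cst.
  - by apply: bndN; apply: bndM; [exact: bndX|exact: bnd_cst].
  - by apply: bndN; apply: bndM => //; exact: bndX.
pose yy v := - 120^-1 - v ^+ 2 * e v.
have byy : bnd yy.
  by apply: bndD; [exact: bnd_cst|apply: bndN; apply: bndM => //; exact: bndX].
have yE v : y v = 6^-1 + v ^+ 2 * yy v by rewrite /y /yy; field.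
(* The two factors begin 1 - al v^2 + A v^4 and 1 + al v^2 + B v^4. The v^2 terms cancel thanks to
   the coefficient gamma / 24, the v^4 terms thanks to [AB], which determines [c2]. *)
pose a := gamma * (gamma - 1) / 2; pose al := gamma / 6.
pose c2 := gamma * (5 * gamma + 22) / 5760.
pose A := gamma / 120 + a / 36; pose B := 16 * c2 - gamma / 18.
have AB : A + B = al ^+ 2 by rewrite /A /B /al /a /c2; field.
(* [p] is the coefficient of v^6 left over in (sin v / v)^gamma; [z] below is its analogue for the
   bracket. *)
pose p v := gamma * e v + a * (yy v / 3 + v ^+ 2 * yy v ^+ 2) + y v ^+ 3 * f v.
have bp : bnd p.
  apply: bndD; first apply: bndD.
  - by apply: bndM => //; exact: bnd_cst.
  - apply: bndM; first exact: bnd_cst.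
    apply: bndD; first by apply: bndM => //; exact: bnd_cst.
    by apply: bndM; exact: bndX.
  - by apply: bndM => //; exact: bndX.
(* Defined by (1 - x)^2 = 1 - v^2 / 3 + v^4 s2, and likewise (1 - x)^4 = 1 + v^2 s4 for [s4]. *)
pose s2 v := - 2 * yy v + y v ^+ 2.
have bs2 : bnd s2.
  by apply: bndD; [apply: bndM => //; exact: bnd_cst|exact: bndX].
pose s4 v := - (2 / 3) + 2 * v ^+ 2 * s2 v + v ^+ 2 * (- (1 / 3) + v ^+ 2 * s2 v) ^+ 2.
have bs4 : bnd s4.
  apply: bndD; first apply: bndD; first exact: bnd_cst.
  - by apply: bndM => //; apply: bndM; [exact: bnd_cst|exact: bndX].
  - apply: bndM; first exact: bndX.
    by apply: bndX; apply: bndD; [exact: bnd_cst|apply: bndM => //; exact: bndX].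
pose z v := al * s2 v + 16 * c2 * s4 v.
have bz : bnd z.
  by apply: bndD; apply: bndM => //; exact: bnd_cst.
(* The terms of degree at least 6 in the product of the two expansions, divided by v^6. *)
pose Z v := z v - al * B + A * al + p v + v ^+ 2 * (- al * z v + A * B + p v * al)
  + v ^+ 4 * (A * z v + p v * B) + v ^+ 6 * (p v * z v).
have bZ : bnd Z.
  have bc c g : bnd g -> bnd (fun v => c * g v) by move=> bg; apply: bndM => //; exact: bnd_cst.
  have bcr c g : bnd g -> bnd (fun v => g v * c) by move=> bg; apply: bndM => //; exact: bnd_cst.
  have bX n g : bnd g -> bnd (fun v => v ^+ n * g v) by move=> bg; apply: bndM => //; exact: bndX.
  have b1 : bnd (fun v => z v - al * B + A * al + p v).
    by apply: bndD => //; apply: bndD; [apply: bndD => //; exact: bnd_cst|exact: bnd_cst].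
  have b2 : bnd (fun v => - al * z v + A * B + p v * al).
    by apply: bndD; [apply: bndD; [exact: bc|exact: bnd_cst]|exact: bcr].
  have b3 : bnd (fun v => A * z v + p v * B) by apply: bndD; [exact: bc|exact: bcr].
  have b4 : bnd (fun v => p v * z v) by exact: bndM.
  by apply: bndD; [apply: bndD; [apply: bndD => //|]|]; exact: bX.
have [D hD] := bZ.
exists D => t /andP[t0 t1]; pose v := t / 2.
have vI : 0 < v <= 2^-1 by rewrite /v; apply/andP; split; lra.
have [v0 _] := andP vI; have [x0 x1] := andP (xI v vI).
have tv : t = 2 * v by rewrite /v; field.
have rE : `|2 * sin (t / 2)| = t * (1 - x v).
  have -> : 2 * sin (t / 2) = t * (1 - x v).
    by rewrite -qE// -/v tv; field; rewrite gt_eqF.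
  by rewrite ger0_norm// mulr_ge0 ?(ltW t0)//; lra.
have PE : (1 - x v) `^ gamma = 1 - al * v ^+ 2 + A * v ^+ 4 + v ^+ 6 * p v.
  by rewrite fE// /x /p /al /A -/a /y /yy; field.
have QE : 1 + gamma / 24 * (t * (1 - x v)) ^+ 2 + c2 * (t * (1 - x v)) ^+ 4 =
   1 + al * v ^+ 2 + B * v ^+ 4 + v ^+ 6 * z v.
  rewrite tv /x /z /s4 /s2 /B /al yE.
  by move: (yy v) => ?; generalize c2 => ?; field.
rewrite symbol_norm -/c2 rE QE powRM; [|exact: ltW|by lra].
rewrite -mulrA -[X in _ - X]mulr1 -mulrBr normrM (ger0_norm (powR_ge0 _ _)).
rewrite (_ : _ * _ - 1 = v ^+ 6 * Z v); last first.
  rewrite PE; transitivity (v ^+ 4 * (A + B - al ^+ 2) + v ^+ 6 * Z v).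
    rewrite /Z; move: (z v) (p v) => ? ?; generalize A B al => ? ? ?; ring.
  by rewrite AB subrr mulr0 add0r.
rewrite addrC powRD; last by rewrite (_ : (_ == 0) = false)//; apply/negbTE; rewrite gt_eqF//; lra.
rewrite (powR_mulrn 6 (ltW t0)) mulrCA ler_wpM2l ?powR_ge0//.
rewrite normrM ger0_norm ?exprn_ge0 ?(ltW v0)// mulrC ler_pM ?exprn_ge0 ?(ltW v0)//; first exact: hD.
by rewrite lerXn2r ?nnegrE ?(ltW v0) ?(ltW t0)//; lra.
Qed.


Lemma symbol_expansion gamma : 1 < gamma -> gamma <= 2 -> exists2 C, 0 <= C & forall t, 0 < t ->
  `|symbol gamma t - t `^ gamma| <= C * t `^ (6 + gamma).
Proof.
move=> g1 g2; have g0 : 0 < gamma by lra.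
have [C hC] := symbol_near0 g1 g2.
have [L hL] := symbol_lipschitz g1.
have L0 : 0 <= L.
  by have := hL pi 0; rewrite subr0 sin_pihalf normr1 mulr1; exact: le_trans.
exists (`|C| + (L + 1)) => [|t t0]; first by rewrite !addr_ge0.
have tp : 0 <= t `^ (6 + gamma) by exact: powR_ge0.
have [t1|t1] := leP t 1.
  apply: (@le_trans _ _ (C * t `^ (6 + gamma))); first by apply: hC; rewrite t0.
  by rewrite ler_wpM2r// (le_trans (ler_norm C))// lerDl addr_ge0.
apply: (@le_trans _ _ ((L + 1) * t `^ (6 + gamma))); last by rewrite ler_wpM2r// lerDr.
(* As the symbol vanishes at 0, its Lipschitz estimate and |sin| <= 1 bound it by [L]; for t > 1
   both 1 and t^gamma are below t^(6 + gamma). *)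
have s0 : symbol gamma 0 = 0.
  by rewrite symbolE// mul0r sin0 mulr0 normr0 !powR0 ?gt_eqF//; [ring|lra..].
rewrite (le_trans (ler_normB _ _))// mulrDl mul1r (ger0_norm (powR_ge0 _ _)).
have tle : t `^ gamma <= t `^ (6 + gamma) by apply: ler_powR; lra.
rewrite lerD//; have := hL t 0; rewrite s0 subr0 subr0 => h.
apply: (le_trans h); rewrite ler_wpM2l// (le_trans (sin_max _))//.
by rewrite -[leLHS](powRr0 t); apply: ler_powR; lra.
Qed.

End symbol_expansion.

(** * Action on Fourier integrals *)

Section harmonic.
Context {R : realType}.
Implicit Types (f g F H : R -> R).

Let mY : measurable (Y : set R). Proof. exact: measurable_itv. Qed.

Lemma eq_intg (D : set R) f g : measurable D -> (forall w, D w -> f w = g w) ->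
  intg D f -> intg D g.
Proof.
move=> mD fg; apply: (@eq_integrable _ _ _ mu D mD (EFin \o f) (EFin \o g)) => w.
by rewrite inE => Dw /=; rewrite fg.
Qed.

Lemma eq_fcos (D : set R) f g s : (forall w, D w -> f w = g w) -> fcos D f s = fcos D g s.
Proof. by move=> fg; apply: eq_Rintegral => w; rewrite inE => Dw; rewrite fg. Qed.

Lemma eq_fsin (D : set R) f g s : (forall w, D w -> f w = g w) -> fsin D f s = fsin D g s.
Proof. by move=> fg; apply: eq_Rintegral => w; rewrite inE => Dw; rewrite fg. Qed.

Lemma intgS_Y f : intg setT f -> intg Y f.
Proof. exact: (@integrableS _ _ _ mu setT). Qed.

(** [F2] and [H2] stand for w^2 F and w^2 H. As parameters they may be given as w^gamma times the
    transform, both for gamma = 2, where [F] is the transform itself, and for gamma < 2, where it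
    carries w^(gamma - 2). *)
Lemma harmonic_derive2 F H F2 H2 (c : R) (V := fun x : R => c * (fcos Y F x + fsin Y H x)) :
  intg Y F -> intg Y H ->
  intg Y (fun w => w * F w) -> intg Y (fun w => w * H w) ->
  intg Y F2 -> intg Y H2 ->
  (forall w, 0 < w -> w * (w * F w) = F2 w) -> (forall w, 0 < w -> w * (w * H w) = H2 w) ->
  twice_derivable V /\ forall x, V^`(2)%classic x = - c * (fcos Y F2 x + fsin Y H2 x).
Proof.
move=> iF iH iF1 iH1 iF2 iH2 FE HE.
have YE w : Y w -> 0 < w by rewrite /= in_itv/= andbT.
have iwF : intg Y (fun w => w * (w * F w)).
  by apply: (@eq_intg _ F2) => // w /YE w0; rewrite FE.
have iwH : intg Y (fun w => w * (w * H w)).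
  by apply: (@eq_intg _ H2) => // w /YE w0; rewrite HE.
have d1 (x : R) : is_derive x 1 V
    (c * (- fsin Y (fun w => w * F w) x + fcos Y (fun w => w * H w) x)).
  by apply: rderivZ; apply: rderivD; [exact: fcos_derive|exact: fsin_derive].
have V1 : V^`()%classic = (fun x => c * (- fsin Y (fun w => w * F w) x + fcos Y (fun w => w * H w) x)).
  by apply/funext => x; rewrite derive1E (@derive_val _ _ _ _ _ _ _ (d1 x)).
have d2 (x : R) : is_derive x 1 V^`()%classic (- c * (fcos Y F2 x + fsin Y H2 x)).
  rewrite V1; have := rderivZ c (rderivD (rderivZ (-1) (fsin_derive x mY iF1 iwF)) (fcos_derive x mY iH1 iwH)).
  under [X in is_derive _ _ X]eq_fun do rewrite mulN1r.
  move/is_derive_eq; apply.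
  rewrite (@eq_fcos _ _ F2); last by move=> w /YE; exact: FE.
  rewrite (@eq_fsin _ _ H2); last by move=> w /YE; exact: HE.
  by ring.
split=> [x|x]; first by split; [case: (d1 x)|case: (d2 x)].
by rewrite derive1nS derive1n1 derive1E (@derive_val _ _ _ _ _ _ _ (d2 x)).
Qed.

End harmonic.

(** * Sums over all integers *)

Section bisum_lemmas.
Context {R : realType}.
Implicit Types (a : int -> R) (c : nat -> R).

Lemma summable_int a (C : R) : (forall N, \sum_(m < N) `|a (Posz m)| <= C) ->
  (forall N, \sum_(m < N) `|a (Negz m)| <= C) ->
  summable [set: int] (fun m => (a m)%:E).
Proof.
move=> aP aN; rewrite /summable.
have half (e : nat -> int) : injective e -> (forall N, \sum_(m < N) `|a (e m)| <= C) ->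
    (\esum_(m in range e) `|(a m)%:E| < +oo)%E.
  move=> ie h.
  rewrite (@reindex_esum _ _ _ setT (range e) e); last first.
    by split=> [m _|m n _ _ /ie|m]//; exists m.
  rewrite -nneseries_esumT//; apply: le_lt_trans (ltry C).
  apply: lime_le; first exact: is_cvg_nneseries.
  apply: nearW => N; rewrite big_mkord.
  under eq_bigr do rewrite /=.
  by rewrite sumEFin lee_fin.
rewrite (esumID (range Posz))//; apply: lte_add_pinfty.
  by rewrite setTI; apply: half => // m n [].
rewrite setTI (_ : ~` _ = range Negz); first by apply: half => // m n [].
apply/seteqP; split=> [[n|n] /= h|_ [n _ <-] [m]//]; last by exists n.
by exfalso; apply: h; exists n.
Qed.

Lemma abs_series_cvg c (C : R) : (forall N, \sum_(m < N) `|c m| <= C) -> cvgn (series c).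
Proof.
move=> cC; apply: normed_cvg; apply: nondecreasing_is_cvgn.
  by apply: nondecreasing_series => n _ _; exact: normr_ge0.
by exists C => _ [N _ <-]; have := cC N; rewrite -(big_mkord predT (fun m => `|c m|)).
Qed.

(** [Negz m] is [- m.+1], so symmetric partial sums pair it with [Posz m.+1] and leave the term at 0
    alone. Once both one-sided series converge, the symmetric limit is the sum. *)
Lemma bisum_lim a (l : R) : cvgn (series (fun n => a (Posz n))) ->
  cvgn (series (fun n => a (Negz n))) ->
  (a 0 + \sum_(m < N) (a (Posz m.+1) + a (Negz m)))%R @[N --> \oo] --> l ->
  bisum a = l.
Proof.
move=> cP cN h; rewrite /bisum; apply/esym.
have cP1 : (\sum_(m < N.+1) a (Posz m))%R @[N --> \oo] --> limn (series (fun n => a (Posz n))).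
  have := cvg_comp _ _ (cvg_addnr 1) cP; apply: cvg_trans.
  by apply: near_eq_cvg; near=> N; rewrite /= /series/= addn1 big_mkord.
have cN1 : (\sum_(m < N) a (Negz m))%R @[N --> \oo] --> limn (series (fun n => a (Negz n))).
  have := cN; apply: cvg_trans.
  by apply: near_eq_cvg; near=> N; rewrite /series/= big_mkord.
apply: (cvg_unique _ h) => //.
apply: cvg_trans (cvgD cP1 cN1).
apply: near_eq_cvg; near=> N.
transitivity (\sum_(m < N.+1) a (Posz m) + \sum_(m < N) a (Negz m)); first by [].
by rewrite big_ord_recl -addrA big_split.
Unshelve. all: by end_near. Qed.

End bisum_lemmas.

(** * The difference coefficients as cosine coefficients of the symbol *)

Section gcoef.
Local Open Scope complex_scope.
Context {R : realType}.
Implicit Types (gamma s : R) (m : int).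

Lemma Re_integrand_expi gamma m s :
  complex.Re (G gamma (expi s) * expi (- (m%:~R * s))) = symbol gamma s * cos (m%:~R * s).
Proof.
rewrite /G symbol_base_expi.
set z := 4 * _; rewrite -!rmorphXn -!rmorphM -(rmorph1 (complex.real_complex R)).
by rewrite -!rmorphD -rmorphM /= mul0r subr0 cosN.
Qed.

Lemma Re_gcoef gamma m : complex.Re (gcoef gamma m) = cos_coef (symbol gamma) `|m|%N.
Proof.
have ReZ (r : R) (z : R[i]) : complex.Re (r%:C * z) = r * complex.Re z.
  by case: z => z1 z2 /=; rewrite mul0r subr0.
rewrite /gcoef ReZ /cos_coef /cintegral [complex.Re (_ +i* _)]/complex.Re; congr (_ * _).
apply: eq_Rintegral => s _; rewrite Re_integrand_expi; congr (_ * _).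
case: m => n /=; first by [].
by rewrite NegzE mulrNz mulNr cosN.
Qed.

End gcoef.

(** * Both operators on the class, and the error estimate *)

Section class_C.
Local Open Scope complex_scope.
Context {R : realType}.
Variables (gamma : R) (u : R -> R).
Hypotheses (gamma_gt1 : 1 < gamma) (gamma_le2 : gamma <= 2).
Hypotheses (u_C : in_C (6 + gamma) u) (u_cont : continuous u).

Let A : R -> R := fcos setT u.
Let B : R -> R := fsin setT u.

Let g0 : 0 < gamma. Proof. exact: lt_trans ltr01 gamma_gt1. Qed.

Let mY : measurable (Y : set R). Proof. exact: measurable_itv. Qed.

Let YE w : (Y : set R) w -> 0 < w. Proof. by rewrite /= in_itv/= andbT. Qed.

Let iu : intg setT u. Proof. by case: u_C. Qed.

Let cA : continuous A. Proof. exact: fcos_continuous. Qed.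

Let cB : continuous B. Proof. exact: fsin_continuous. Qed.

Let mcont (D : set R) (f : R -> R) : continuous f -> measurable_fun D f.
Proof. by move=> cf; apply: measurable_funTS; exact: continuous_measurable_fun. Qed.

Let fourierE s : fourier u s = A s +i* - B s.
Proof.
rewrite /fourier /cintegral; congr (_ +i* _).
  by apply: eq_Rintegral => y _; rewrite /= mul0r subr0 cosN mulrC (mulrC s) mulrC.
transitivity (\int[mu]_y (-1 * (u y * sin (y * s)))).
  by apply: eq_Rintegral => y _; rewrite /= mul0r addr0 sinN mulN1r mulrN (mulrC s).
rewrite RintegralZl ?mulN1r//.
exact: (intg_fsin s _ iu).
Qed.

Let W (s : R) : R := (1 + `|s|) `^ (6 + gamma) * Num.sqrt (A s ^+ 2 + B s ^+ 2).

Let normcE s : Normc.normc (fourier u s) = Num.sqrt (A s ^+ 2 + B s ^+ 2).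
Proof. by rewrite fourierE /= sqrrN. Qed.

Let intg_W : intg setT W.
Proof.
have [_ h] := u_C.
apply/integrableP; split.
  apply/measurable_EFinP; apply: measurable_funM.
    apply: (measurableT_comp (measurable_powR _)).
    by apply: measurable_funD => //; exact: measurable_normr.
  apply: mcont => s.
  apply: (@continuous_cvg _ _ _ _ _ (fun s => A s ^+ 2 + B s ^+ 2) (fun t => Num.sqrt t)).
    exact: sqrt_continuous.
  apply: cvgD; [apply: (@continuous_cvg _ _ _ _ _ A (fun t => t ^+ 2)) |
    apply: (@continuous_cvg _ _ _ _ _ B (fun t => t ^+ 2))];
    [exact: exprn_continuous|exact: cA|exact: exprn_continuous|exact: cB].
move: h; under eq_integral do rewrite normcE.
apply: le_lt_trans; rewrite le_eqVlt; apply/orP; left; apply/eqP.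
apply: eq_integral => s _ /=; rewrite ger0_norm//.
by rewrite mulr_ge0 ?powR_ge0 ?sqrtr_ge0.
Qed.

Let A_le s : `|A s| <= Num.sqrt (A s ^+ 2 + B s ^+ 2).
Proof. by rewrite -sqrtr_sqr ler_wsqrtr// lerDl sqr_ge0. Qed.

Let B_le s : `|B s| <= Num.sqrt (A s ^+ 2 + B s ^+ 2).
Proof. by rewrite -sqrtr_sqr ler_wsqrtr// lerDr sqr_ge0. Qed.

(** For w > 0, w^p <= (1 + w)^p <= (1 + w)^(6 + gamma), so the class weight [W] dominates. *)
Let intg_weight (f : R -> R) p : continuous f ->
  (forall s, `|f s| <= Num.sqrt (A s ^+ 2 + B s ^+ 2)) -> 0 <= p <= 6 + gamma ->
  intg Y (fun w => w `^ p * f w).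
Proof.
move=> cf fle /andP[p0 pg]; apply: (@le_intg _ _ _ W) => //; last exact: intgS_Y.
  apply: measurable_funM; last exact: mcont.
  by apply: measurable_funTS; exact: measurable_powR.
move=> w /YE w0; rewrite normrM ger0_norm ?powR_ge0// ler_pM ?powR_ge0//.
rewrite (gtr0_norm w0) (@le_trans _ _ ((1 + w) `^ p))//.
  by apply: ge0_ler_powR; rewrite ?nnegrE//; lra.
by apply: ler_powR => //; lra.
Qed.

Let powR0_mul (f : R -> R) w : (Y : set R) w -> w `^ 0 * f w = f w.
Proof. by move=> _; rewrite powRr0 mul1r. Qed.

Let intg_Y (f : R -> R) : continuous f ->
  (forall s, `|f s| <= Num.sqrt (A s ^+ 2 + B s ^+ 2)) -> intg Y f.
Proof.
move=> cf fle; apply: (@eq_intg _ _ (fun w => w `^ 0 * f w)) => //.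
  by move=> w; exact: powR0_mul.
by apply: intg_weight => //; rewrite lexx addr_ge0// ltW.
Qed.

Let iA : intg Y A. Proof. exact: intg_Y cA A_le. Qed.
Let iB : intg Y B. Proof. exact: intg_Y cB B_le. Qed.

Let u_inv x : u x = pi^-1 * (fcos Y A x + fsin Y B x).
Proof. by apply: fourier_inversion => //; exact: u_cont. Qed.

(** One constant for three functions: the first summand bounds [A] and [B], the second bounds [u]
    through inversion. *)
Let M := \int[mu]_y `|u y| + pi^-1 * (\int[mu]_(w in Y) `|A w| + \int[mu]_(w in Y) `|B w|).

Let intu_ge0 : 0 <= \int[mu]_y `|u y|. Proof. exact: Rintegral_ge0. Qed.

Let intAB_ge0 : 0 <= pi^-1 * (\int[mu]_(w in Y) `|A w| + \int[mu]_(w in Y) `|B w|).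
Proof. by rewrite mulr_ge0 ?invr_ge0 ?pi_ge0// addr_ge0// Rintegral_ge0. Qed.

Let A_bound w : `|A w| <= M.
Proof. by rewrite (le_trans (fcos_bound w measurableT iu))// lerDl. Qed.

Let B_bound w : `|B w| <= M.
Proof. by rewrite (le_trans (fsin_bound w measurableT iu))// lerDl. Qed.

Let u_bound x : `|u x| <= M.
Proof.
rewrite u_inv normrM ger0_norm ?invr_ge0 ?pi_ge0// (@le_trans _ _ (pi^-1 * (\int[mu]_(w in Y) `|A w| + \int[mu]_(w in Y) `|B w|)))//; last by rewrite lerDr.
rewrite ler_wpM2l ?invr_ge0 ?pi_ge0// (le_trans (ler_normD _ _))// lerD//.
  exact: fcos_bound.
exact: fsin_bound.
Qed.

(** For gamma = 2 the inversion integral itself is differentiated twice; for gamma < 2 it is the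
    potential, with multiplier w^(- b), and w^2 w^(- b) = w^gamma. *)
Let riesz_harmonic :
  riesz_derivable gamma u /\
  forall x, riesz_derivative gamma u x =
    - pi^-1 * (fcos Y (fun w => w `^ gamma * A w) x + fsin Y (fun w => w `^ gamma * B w) x).
Proof.
have wA p : 0 <= p <= 6 + gamma -> intg Y (fun w => w `^ p * A w) by exact: intg_weight.
have wB p : 0 <= p <= 6 + gamma -> intg Y (fun w => w `^ p * B w) by exact: intg_weight.
have g1 := gamma_gt1; have wg : 0 <= gamma <= 6 + gamma by apply/andP; split; lra.
rewrite /riesz_derivable /riesz_derivative; have [g2|g2] := eqVneq gamma 2.
  have uE : u = (fun x => pi^-1 * (fcos Y A x + fsin Y B x)) by apply/funext.
  have w1 : 0 <= (1 : R) <= 6 + gamma by apply/andP; split; lra.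
  have [] := @harmonic_derive2 R A B (fun w => w `^ gamma * A w) (fun w => w `^ gamma * B w) pi^-1 iA iB.
  - by apply: eq_intg (wA _ w1) => // w /YE w0; rewrite powRr1// ltW.
  - by apply: eq_intg (wB _ w1) => // w /YE w0; rewrite powRr1// ltW.
  - exact: wA.
  - exact: wB.
  - by move=> w w0; rewrite g2 (powR_mulrn 2 (ltW w0)) expr2 mulrA.
  - by move=> w w0; rewrite g2 (powR_mulrn 2 (ltW w0)) expr2 mulrA.
  by rewrite -uE.
have g2' : gamma < 2 by rewrite lt_neqAle g2 gamma_le2.
pose b := 2 - gamma; have b0 : 0 < b by rewrite /b; lra.
have b1 : b < 1 by rewrite /b; lra.
have gb : 1 - gamma = b - 1 by rewrite /b; ring.
have PE : riesz_potential gamma u = (fun x => 2 * pi^-1 * (Gamma b * cos (b * (pi / 2))) *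
    (fcos Y (fun w => w `^ (- b) * A w) x + fsin Y (fun w => w `^ (- b) * B w) x)).
  apply/funext => x; rewrite /riesz_potential /riesz_kernel gb.
  by apply: (@riesz_fourier R b x M u A B).
have iAb : intg Y (fun w => w `^ (- b) * A w) by exact: (@intg_powR_neg _ _ _ M).
have iBb : intg Y (fun w => w `^ (- b) * B w) by exact: (@intg_powR_neg _ _ _ M).
have wb (w p : R) : 0 < w -> w * w `^ p = w `^ (1 + p).
  move=> w0; rewrite powRD; last by rewrite (gt_eqF w0) implybT.
  by rewrite powRr1// ltW.
have w1 : 0 <= 1 - b <= 6 + gamma by apply/andP; split; lra.
have [] := @harmonic_derive2 R _ _ (fun w => w `^ gamma * A w) (fun w => w `^ gamma * B w)
  (2 * pi^-1 * (Gamma b * cos (b * (pi / 2)))) iAb iBb.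
- by apply: eq_intg (wA _ w1) => // w /YE w0; rewrite mulrA wb.
- by apply: eq_intg (wB _ w1) => // w /YE w0; rewrite mulrA wb.
- exact: wA.
- exact: wB.
- by move=> w w0; rewrite (mulrA w (w `^ _)) wb// mulrA wb//; congr (_ `^ _ * _); rewrite /b; ring.
- by move=> w w0; rewrite (mulrA w (w `^ _)) wb// mulrA wb//; congr (_ `^ _ * _); rewrite /b; ring.
rewrite -PE => td dE; split.
  by split=> // x; rewrite /riesz_kernel gb; exact: (@intg_riesz _ b x u M).
move=> x; rewrite dE.
(* As b = 2 - gamma, the cosine produced by the potential is minus the one in the normalisation;
   with [Gamma b] they cancel down to - 1 / pi. *)
have cb : cos (b * (pi / 2)) = - cos (pi / 2 * gamma).
  have -> : b * (pi / 2) = - (pi / 2 * gamma) + pi by rewrite /b; field.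
  by rewrite cosDpi cosN.
have cb0 : 0 < cos (b * (pi / 2)).
  apply: cos_gt0_pihalf; have := pi_gt0 R => pi0; rewrite -ltr_norml gtr0_norm ?mulr_gt0 ?divr_gt0//.
  by rewrite gtr_pMl// divr_gt0.
have G0 := Gamma_gt0 b0; rewrite -/b.
have -> : cos (pi / 2 * gamma) = - cos (b * (pi / 2)) by rewrite cb opprK.
have pi0 : pi != 0 :> R by rewrite gt_eqF// pi_gt0.
have cn := lt0r_neq0 cb0; have Gn := lt0r_neq0 G0.
have simp (p q g t : R) : p != 0 -> q != 0 -> g != 0 ->
    - (2 * - q * g)^-1 * (- (2 * p^-1 * (g * q)) * t) = - p^-1 * t.
  by move=> p0 q0 g_0; field; rewrite ?oppr_eq0 p0 g_0 q0.
exact: simp.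
Qed.

Let k (x w : R) : R := A w * cos (w * x) + B w * sin (w * x).

Let intg_k x : intg Y (k x).
Proof. by apply: intgD => //; [exact: intg_fcos|exact: intg_fsin]. Qed.

Let u_k x : u x = pi^-1 * \int[mu]_(w in Y) k x w.
Proof.
by rewrite u_inv /k RintegralD//; [exact: intg_fcos|exact: intg_fsin].
Qed.

(** Opposite translates are added so that the sine parts cancel; coefficients even in [m] then act
    as a cosine series. *)
Let Rintegral_cos_k x s : u (x - s) + u (x + s) = pi^-1 * \int[mu]_(w in Y) (k x w * (2 * cos (s * w))).
Proof.
rewrite !u_k -mulrDr -RintegralD//; congr (_ * _); apply: eq_Rintegral => w _.
rewrite /k (mulrC s) !mulrDr mulrN !cosD !sinD cosN sinN; ring.
Qed.

Let c := cos_coef (symbol gamma).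

Let c_summable : exists C, forall N, \sum_(m < N) `|c m| <= C.
Proof.
have [g' cg' dg'] := symbol_derive gamma_gt1.
by apply: (@cos_coef_summable R (symbol gamma) g') => //; [exact: symbol_continuous g0|exact: symbolN].
Qed.

Let terms_bound h x : exists C,
  (forall N, \sum_(m < N) `|delta_term gamma h u x (Posz m)| <= C) /\
  (forall N, \sum_(m < N) `|delta_term gamma h u x (Negz m)| <= C).
Proof.
have [C hC] := c_summable.
have M0 : 0 <= M by exact: le_trans (normr_ge0 _) (u_bound 0).
exists (C * M); split=> N.
  apply: (@le_trans _ _ ((\sum_(m < N) `|c m|) * M)); last by rewrite ler_wpM2r.
  rewrite mulr_suml; apply: ler_sum => m _.
  by rewrite /delta_term Re_gcoef normrM ler_wpM2l.
(* [Negz m] has absolute value [m.+1], so the coefficients are shifted by one and the sum up to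
   [N.+1] is used. *)
apply: (@le_trans _ _ ((\sum_(m < N.+1) `|c m|) * M)); last by rewrite ler_wpM2r.
rewrite big_ord_recl mulrDl -[leLHS]add0r lerD ?mulr_ge0// mulr_suml; apply: ler_sum => m _.
by rewrite /delta_term Re_gcoef normrM ler_wpM2l.
Qed.

Let partial h (N : nat) (w : R) : R := c 0 + \sum_(m < N) 2 * c m.+1 * cos (m.+1%:R * (h * w)).

(** Absolute summability of the coefficients makes the bound uniform in [N] and [w], so a multiple
    of |k x| dominates in the passage to the limit. *)
Let partial_bound h : exists C, forall N w, `|partial h N w| <= C.
Proof.
have [C hC] := c_summable; exists (2 * C) => N w.
apply: (@le_trans _ _ (2 * \sum_(m < N.+1) `|c m|)); last by rewrite ler_wpM2l.
rewrite big_ord_recl mulrDr (le_trans (ler_normD _ _))// lerD//.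
  by rewrite ler_peMl// ler1n.
rewrite (le_trans (ler_norm_sum _ _ _))// mulr_sumr ler_sum// => m _.
by rewrite normrM normrM ger0_norm// ler_piMr ?mulr_ge0// cos_max.
Qed.

Let partial_continuous h N : continuous (partial h N).
Proof.
elim: N => [|N IH].
  by rewrite /partial; under eq_fun do rewrite big_ord0; move=> w; exact: cvg_cst.
rewrite /partial; under eq_fun do rewrite big_ord_recr /= addrA.
move=> w; apply: cvgD; first exact: IH.
apply: cvgM; first exact: cvg_cst.
apply: (@continuous_cvg _ _ _ _ _ (fun w : R => N.+1%:R * (h * w)) cos); first exact: continuous_cos.
by apply: cvgM; [exact: cvg_cst|apply: cvgM; [exact: cvg_cst|exact: cvg_id]].
Qed.

Let intg_partial h x N : intg Y (fun w => k x w * partial h N w).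
Proof.
have [C hC] := partial_bound h.
by apply: (@intgM_bounded _ _ _ _ C) => //; exact: mcont (@partial_continuous h N).
Qed.

Let partial_sum h x N :
  delta_term gamma h u x 0 +
    \sum_(m < N) (delta_term gamma h u x (Posz m.+1) + delta_term gamma h u x (Negz m)) =
  pi^-1 * \int[mu]_(w in Y) (k x w * partial h N w).
Proof.
have tE m : delta_term gamma h u x (Posz m.+1) + delta_term gamma h u x (Negz m) =
    pi^-1 * \int[mu]_(w in Y) (c m.+1 * (k x w * (2 * cos (m.+1%:R * h * w)))).
  have ik : intg Y (fun w => k x w * (2 * cos (m.+1%:R * h * w))).
    apply: (@intgM_bounded _ _ _ _ 2) => //.
      apply: mcont => w; apply: cvgM; first exact: cvg_cst.
      exact: is_derive_continuous (rderiv_cosl _ w).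
    by move=> w _; rewrite normrM ger0_norm// ler_piMr// cos_max.
  rewrite RintegralZl// mulrCA -Rintegral_cos_k /delta_term !Re_gcoef mulrDr.
  by congr (_ * _ + _ * u _); rewrite NegzE mulrNz mulNr opprK.
elim: N => [|N IH].
  rewrite big_ord0 addr0 /delta_term Re_gcoef mul0r subr0 u_k mulrCA; congr (_ * _).
  rewrite -RintegralZl//; apply: eq_Rintegral => w _.
  by rewrite /partial big_ord0 addr0 mulrC.
rewrite big_ord_recr/= addrA IH tE -mulrDr -RintegralD//; last first.
  apply: intgZ => //; apply: (@intgM_bounded _ _ _ _ 2) => //.
    apply: mcont => w; apply: cvgM; first exact: cvg_cst.
    exact: is_derive_continuous (rderiv_cosl _ w).
  by move=> w _; rewrite normrM ger0_norm// ler_piMr// cos_max.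
congr (_ * _); apply: eq_Rintegral => w _.
by rewrite /partial big_ord_recr/= -(mulrA _ h w); ring.
Qed.

(** Symmetric partial sums of the difference operator are integrals of [k x] against partial Fourier
    sums of the symbol at [h * w]; dominated convergence exchanges sum and integral. *)
Let delta_harmonic h x :
  intg Y (fun w => k x w * symbol gamma (h * w)) /\
  delta gamma h u x = - h `^ (- gamma) * (pi^-1 * \int[mu]_(w in Y) (k x w * symbol gamma (h * w))).
Proof.
have [C hC] := partial_bound h; have [L hL] := symbol_lipschitz gamma_gt1.
have [] := @dominated_Rintegral R Y (fun N w => k x w * partial h N w)
  (fun w => k x w * symbol gamma (h * w)) (fun w => C * `|k x w|) mY.
- by move=> N; exact: intg_measurable (intg_partial h x N).
- move=> w _; apply: cvgM; first exact: cvg_cst.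
  by apply: (@cos_series_cvg R (symbol gamma) L) => //; [exact: symbol_continuous g0|exact: symbolN].
- by move=> N w _; rewrite normrM mulrC ler_wpM2r.
- by apply: intgZ => //; exact: intg_norm.
move=> ik cvk; split=> //; rewrite /delta; congr (_ * _).
have [D [hP hN]] := terms_bound h x.
apply: bisum_lim; [exact: abs_series_cvg hP|exact: abs_series_cvg hN|].
under eq_fun do rewrite partial_sum.
by apply: cvgM => //; exact: cvg_cst.
Qed.

Let delta_error : exists C, forall h x, 0 < h ->
  `|riesz_derivative gamma u x - delta gamma h u x| <= C * h ^+ 6.
Proof.
have [C C0 hC] := symbol_expansion gamma_gt1 gamma_le2.
pose J := \int[mu]_(w in Y) (w `^ (6 + gamma) * `|A w| + w `^ (6 + gamma) * `|B w|).
have iJ : intg Y (fun w => w `^ (6 + gamma) * `|A w| + w `^ (6 + gamma) * `|B w|).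
  have wg : 0 <= 6 + gamma <= 6 + gamma by rewrite lexx andbT addr_ge0// ltW.
  apply: intgD => //.
    apply: (@eq_intg _ _ (fun w => `|w `^ (6 + gamma) * A w|)) => //.
      by move=> w _; rewrite normrM ger0_norm// powR_ge0.
    by apply: intg_norm => //; exact: intg_weight.
  apply: (@eq_intg _ _ (fun w => `|w `^ (6 + gamma) * B w|)) => //.
    by move=> w _; rewrite normrM ger0_norm// powR_ge0.
  by apply: intg_norm => //; exact: intg_weight.
exists (pi^-1 * (C * J)) => h x h0.
have [ik ->] := delta_harmonic h x.
have [_ ->] := riesz_harmonic.
have g1 := gamma_gt1; have wg : 0 <= gamma <= 6 + gamma by apply/andP; split; lra.
have igA : intg Y (fun w => w `^ gamma * A w) by exact: intg_weight.
have igB : intg Y (fun w => w `^ gamma * B w) by exact: intg_weight.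
have igk : intg Y (fun w => w `^ gamma * k x w).
  apply: (@eq_intg _ _ (fun w => w `^ gamma * A w * cos (w * x) + w `^ gamma * B w * sin (w * x))) => //.
    by move=> w _; rewrite /k mulrDr !mulrA.
  by apply: intgD => //; [exact: intg_fcos|exact: intg_fsin].
have -> : fcos Y (fun w => w `^ gamma * A w) x + fsin Y (fun w => w `^ gamma * B w) x =
    \int[mu]_(w in Y) (w `^ gamma * k x w).
  rewrite -RintegralD//; [|exact: intg_fcos|exact: intg_fsin].
  by apply: eq_Rintegral => w _; rewrite /k mulrDr !mulrA.
have ihk : intg Y (fun w => h `^ (- gamma) * (k x w * symbol gamma (h * w))) by exact: intgZ.
have -> : - pi^-1 * (\int[mu]_(w in Y) (w `^ gamma * k x w)) -
    - h `^ (- gamma) * (pi^-1 * \int[mu]_(w in Y) (k x w * symbol gamma (h * w))) =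
    pi^-1 * \int[mu]_(w in Y) (h `^ (- gamma) * (k x w * symbol gamma (h * w)) - w `^ gamma * k x w).
  by rewrite RintegralB// RintegralZl//; ring.
rewrite normrM ger0_norm ?invr_ge0 ?pi_ge0// -mulrA ler_wpM2l ?invr_ge0 ?pi_ge0//.
rewrite mulrAC -RintegralZl//.
apply: Rintegral_le_norm => //; last exact: intgZ.
  exact: intg_measurable (intgB mY ihk igk).
move=> w /YE w0.
have hw : 0 < h * w by rewrite mulr_gt0.
(* Both multipliers are expressed at the frequency h w, using w^gamma = h^(- gamma) (h w)^gamma; the
   expansion of the symbol then leaves h^(- gamma) (h w)^(6 + gamma) = h^6 w^(6 + gamma). *)
have -> : h `^ (- gamma) * (k x w * symbol gamma (h * w)) - w `^ gamma * k x w =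
    k x w * (h `^ (- gamma) * (symbol gamma (h * w) - (h * w) `^ gamma)).
  have hE : h `^ (- gamma) * h `^ gamma = 1 by rewrite powRN mulVf// gt_eqF// powR_gt0.
  rewrite powRM ?(ltW h0) ?(ltW w0)//.
  have -> : w `^ gamma * k x w = (h `^ (- gamma) * h `^ gamma) * (w `^ gamma * k x w) by rewrite hE mul1r.
  by ring.
rewrite normrM -mulrDr mulrC [leRHS]mulrA ler_pM//.
  rewrite normrM ger0_norm ?powR_ge0//.
  apply: (le_trans (ler_wpM2l (powR_ge0 _ _) (hC _ hw))).
  rewrite mulrCA -mulrA ler_wpM2l// powRM ?(ltW h0) ?(ltW w0)// mulrA ler_wpM2r ?powR_ge0//.
  rewrite powRD; last by rewrite (gt_eqF h0) implybT.
  by rewrite (powR_mulrn 6 (ltW h0)) powRN mulrCA mulVf ?mulr1// gt_eqF// powR_gt0.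
by rewrite (le_trans (ler_normD _ _))// lerD// normrM ler_piMr// ?cos_max ?sin_max.
Qed.

Lemma riesz_difference :
  [/\ riesz_derivable gamma u,
      forall h x : R, 0 < h ->
        summable [set: int] (fun m => (delta_term gamma h u x m)%:E) &
      exists C : R, forall h x : R, 0 < h ->
        `|riesz_derivative gamma u x - delta gamma h u x| <= C * h ^+ 6].
Proof.
split; first by case: riesz_harmonic.
  by move=> h x _; have [C [hP hN]] := terms_bound h x; exact: summable_int hP hN.
exact: delta_error.
Qed.

End class_C.

Theorem theorem2p1 (R : realType) (gamma : R) (u : R -> R)
  (gamma_gt1 : 1 < gamma) (gamma_le2 : gamma <= 2)
  (u_C : in_C (6 + gamma) u) (u_cont : continuous u) :
  [/\ riesz_derivable gamma u,
      forall h x : R, 0 < h ->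
        summable [set: int] (fun m => (delta_term gamma h u x m)%:E) &
      exists C : R, \forall h \near 0^'+, forall x : R,
        `|riesz_derivative gamma u x - delta gamma h u x| <= C * h ^+ 6].
Proof.
have [rd sm [C hC]] := riesz_difference gamma_gt1 gamma_le2 u_C u_cont.
split=> //; exists C; near=> h => x; apply: hC.
by near: h; exact: nbhs_right_gt.
Unshelve. all: by end_near. Qed.
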